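(* Let $X$ be either a real-valued Lévy process $\{X_t\}_{t\ge0}$ or a random walk $\{X_n\}_{n\ge 0}$ ($X_0=0$, i.i.d. real increments), with $X_t\to-\infty$ almost surely (respectively $X_n\to-\infty$ almost surely). Let $\gamma\ge0$ and suppose that the sequence $$\frac{\mathbf P(X_n\ge 0)}{n},\qquad n\in\mathbf N,$$ belongs to the class $\mathcal Ss(\gamma)$. In addition assume that for some $\alpha\ge 0$ $$\lim_{n\to\infty,\ n\in\mathbf N}\frac{\mathbf P(X_n\ge 0)}{\mathbf P(X_n\ge y)}=e^{\alpha y}\quad\text{for any fixed } y\in\mathbf R.$$ (a) If $X$ is a Lévy process, then for any $x\ge 0$, with $\tau_x=\inf\{t\ge0:X_t<-x\}$, $$\mathbf P(\tau_x>t)\sim V(x)\,e^{-\gamma(t-[t])}\,\frac{\mathbf P(X_{[t]}\ge 0)}{t},\qquad t\to\infty,$$ where, with $N_t=\inf_{0\le s\le t}X_s$, $$V(x)=\begin{cases}\mathbf E\,\tau_x, & \gamma=\alpha=0,\\ e^{\alpha x}\int_0^\infty e^{\gamma t}\,\mathbf E\{e^{\alpha N_t};\,|N_t|\le x\}\,dt, & \text{otherwise.}\end{cases}$$ (b) If $X$ is a random walk, then for any $x\ge 0$, with $\nu_x=\min\{n\ge 1:X_n<-x\}$, $$\mathbf P(\nu_x>n)\sim V_{rw}(x)\,\frac{\mathbf P(X_n\ge 0)}{n},\qquad n\to\infty,$$ where, with $N_k=\min_{0\le l\le k}X_l$, $$V_{rw}(x)=\begin{cases}\mathbf E\,\nu_x,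 & \gamma=\alpha=0,\\ e^{\alpha x}\sum_{k=0}^\infty e^{\gamma k}\,\mathbf E\{e^{\alpha N_k};\,|N_k|\le x\}, & \text{otherwise.}\end{cases}$$
   Context: A sequence $\{a_n\}_{n\ge 0}$ of nonnegative numbers belongs to the class $\mathcal Ss(\gamma)$, $\gamma\ge0$, if $a_n>0$ for all sufficiently large $n$, and (i) $\lim_{n\to\infty}a_{n-1}/a_n=e^{\gamma}$; (ii) $\lim_{n\to\infty}\frac{\sum_{i=0}^n a_ia_{n-i}}{a_n}=2d$, where $d=\sum_{i=0}^\infty a_ie^{\gamma i}<\infty$. A sequence given only for $n\ge 1$ is completed by $a_0=0$. $[t]$ is the integer part of $t$. $\mathbf E\{Y;A\}$ denotes $\mathbf E\{Y\mathbf 1_A\}$. $a\sim b$ means that the ratio tends to $1$; by convention $a\sim 0\cdot b$ means $a=o(b)$. *)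

(* Defs.v *)
From HB Require Import structures.
From mathcomp Require Import all_boot all_order all_algebra.
From mathcomp Require Import all_classical all_reals all_analysis.

Set Implicit Arguments.
Unset Strict Implicit.
Unset Printing Implicit Defensive.

Import Order.TTheory GRing.Theory Num.Theory.
Import numFieldNormedType.Exports.

Local Open Scope classical_set_scope.
Local Open Scope ring_scope.

(* A sequence given only for n >= 1 is completed by a_0 = 0. *)
Definition complete0 {R : realType} (a : nat -> R) (n : nat) : R :=
  if n == 0%N then 0 else a n.

Definition in_Ss {R : realType} (gamma : R) (a : nat -> R) : Prop :=
  [/\ forall n, 0 <= a n,
      \forall n \near \oo, 0 < a n,
      (a n / a n.+1) @[n --> \oo] --> expR gamma
    & exists d : R,
        [series a i * expR (gamma * i%:R)]_i @ \oo --> d /\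
        ((\sum_(0 <= i < n.+1) a i * a (n - i)%N) / a n) @[n --> \oo]
          --> 2 * d].

(* [a ~ V * b] along [F]: the ratio tends to 1, or a = o(b) when V = 0.
   The relation presupposes that the constant V is finite. *)
Definition equiv_mul {R : realType} {I : Type} (F : set_system I)
    {FF : Filter F} (a : I -> R) (V : \bar R) (b : I -> R) : Prop :=
  V \is a fin_num /\
  let G := FilterType F FF in
  if V == 0%E then (a : I -> R^o) =o_G (b : I -> R^o)
  else (a t / (fine V * b t)) @[t --> F] --> (1 : R).
Arguments equiv_mul {R I} F {FF} a V b.

Section Processes.
Context {d : measure_display} {T : measurableType d} {R : realType}.
Variable P : probability T R.

Definition prob_ge (Y : T -> R) (y : R) : R := fine (P [set w | y <= Y w]).

Definition mutually_independent (Y : nat -> T -> R) : Prop :=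
  forall (s : seq nat) (B : nat -> set R),
    uniq s -> (forall i, measurable (B i)) ->
    P (\bigcap_(i in [set` s]) (Y i @^-1` B i))
    = (\prod_(i <- s) P (Y i @^-1` B i))%E.

(* Equality is required on Borel sets only: a measure takes unspecified values
   on the other sets. *)
Definition same_law (Y Z : T -> R) : Prop :=
  forall B : set R, measurable B -> P (Y @^-1` B) = P (Z @^-1` B).

(* Only the times t >= 0 matter. Stochastic continuity follows from right
   continuity and the stationarity of the increments. *)
Definition levy_process (X : R -> {RV P >-> R}) : Prop :=
  [/\ forall w, X 0 w = 0,
      forall t : nat -> R, 0 <= t 0%N -> (forall i, t i <= t i.+1) ->
        mutually_independent (fun i w => X (t i.+1) w - X (t i) w),
      forall s h : R, 0 <= s -> 0 <= h ->
        same_law (fun w => X (s + h) w - X s w) (X h),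
      forall w t, 0 <= t -> X u w @[u --> t^'+] --> X t w
    & forall w t, 0 < t -> exists l : R, X u w @[u --> t^'-] --> l].

Definition random_walk (X : nat -> {RV P >-> R}) : Prop :=
  [/\ forall w, X 0%N w = 0,
      mutually_independent (fun n w => X n.+1 w - X n w)
    & forall n, same_law (fun w => X n.+1 w - X n w)
                         (fun w => X 1%N w - X 0%N w)].

(* The hypotheses on the values of the process at the integer times. *)
Definition tail_conditions (gamma alpha : R) (X : nat -> T -> R) : Prop :=
  in_Ss gamma (complete0 (fun n => prob_ge (X n) 0 / n%:R)) /\
  forall y : R,
    (prob_ge (X n) 0 / prob_ge (X n) y) @[n --> \oo] --> expR (alpha * y).

(* Exit times take the value +oo when the level is never crossed. *)
Definition exit_time (X : R -> T -> R) (x : R) (w : T) : \bar R :=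
  ereal_inf [set t%:E | t in [set t : R | 0 <= t /\ X t w < - x]].

Definition exit_time_rw (X : nat -> T -> R) (x : R) (w : T) : \bar R :=
  ereal_inf [set n%:R%:E | n in [set n : nat | (1 <= n)%N /\ X n w < - x]].

(* The set is bounded, since cadlag paths are bounded on [0, t]. *)
Definition running_inf (X : R -> T -> R) (t : R) (w : T) : R :=
  inf [set X s w | s in `[0, t]].

Definition running_min (X : nat -> T -> R) (k : nat) (w : T) : R :=
  \big[Num.min/X 0%N w]_(0 <= l < k.+1) X l w.

(* E{e^(alpha N); |N| <= x} *)
Definition trunc_exp_moment (alpha x : R) (N : T -> R) : \bar R :=
  'E_P[(fun w => expR (alpha * N w)) \* \1_[set w | `|N w| <= x]].

Definition V_levy (gamma alpha : R) (X : R -> T -> R) (x : R) : \bar R :=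
  if (gamma == 0) && (alpha == 0) then (\int[P]_w exit_time X x w)%E
  else ((expR (alpha * x))%:E *
        \int[lebesgue_measure]_(t in `[0%R, +oo[)
          ((expR (gamma * t))%:E
           * trunc_exp_moment alpha x (running_inf X t)))%E.

Definition V_rw (gamma alpha : R) (X : nat -> T -> R) (x : R) : \bar R :=
  if (gamma == 0) && (alpha == 0) then (\int[P]_w exit_time_rw X x w)%E
  else ((expR (alpha * x))%:E *
        \sum_(0 <= k <oo)
          ((expR (gamma * k%:R))%:E
           * trunc_exp_moment alpha x (running_min X k)))%E.

End Processes.

(* Main.v *)
(** Let N_n be the running minimum of a random walk.  A Rota-Baxter identity for
    x |-> min(x, 0) gives the recursion
      n P(N_n >= -x) = sum_(1 <= k <= n) E{P(X_k >= -x - z)|_(z = N'_(n-k)); N'_(n-k) >= -x},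
    where N' is an independent copy of N.  Since P(X_n >= 0)/n is in the class
    Ss(gamma), only the terms with k close to n matter after division by
    P(X_n >= 0) (those with k bounded are negligible thanks to the factor n), and
    P(X_k >= y) ~ e^(-alpha y) e^(gamma (n-k)) P(X_n >= 0) yields the walk case.

    For a Lévy process the same applies to the skeletons X_(k/2^l).  Their tails
    at fractional times follow from E e^(alpha X_1) = e^(-gamma).  The exit time is
    bounded above by that of a fixed fine skeleton, and below by letting the mesh
    tend to 0 in the recursion; the two bounds are Riemann sums of the integral
    that defines V. *)
Require Import Defs.
From HB Require Import structures.
From mathcomp Require Import all_boot all_order all_algebra.
From mathcomp Require Import all_classical all_reals all_analysis.
From mathcomp Require Import measurable_realfun ring lra zify.

Set Implicit Arguments.
Unset Strict Implicit.
Unset Printing Implicit Defensive.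

Import Order.TTheory GRing.Theory Num.Theory.
Import numFieldNormedType.Exports.

Local Open Scope classical_set_scope.
Local Open Scope ring_scope.
(** * Convolution tails and the renewal-type recursion *)

(** The recursion alone gives no limit. Bounding its kernel by P(X_k >= -x) P(N_(n-k) >= -x) first
    yields P(N_n >= -x) <= C P(X_n >= 0)/n by strong induction, and only this a priori bound makes
    the middle of the sum negligible. Summability of the limiting series is a by-product.

    The class Ss enters through its negligible middle convolution. This property survives two-sided
    comparison up to constants, unlike the limit of the full convolution, so it is what passes from
    integer times to a grid of mesh 1/m.

    The hypotheses bear on integer times only. They force E e^(alpha X_1) = e^(-gamma): a larger
    value contradicts Fatou's lemma, a smaller one Chernoff's bound.

    A skeleton misses the exits between grid points, so it bounds survival from above only. For the
    lower bound the mesh must tend to 0 at a fixed time, before t tends to infinity. The estimates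
    must therefore be uniform in the mesh, and they are obtained by comparing the tails on all finer
    grids with those on one fixed grid, at the price of one small jump. *)

Section RealSequences.
Context {R : realType}.
Implicit Types a f h q : nat -> R.

Lemma near_infty_ex (Q : nat -> Prop) :
  (\forall n \near \oo, Q n) <-> exists N, forall n, (N <= n)%N -> Q n.
Proof.
split=> [[N _ HN]|[N HN]]; first by exists N => n Nn; exact: HN.
by exists N.
Qed.

Lemma ratio_shift a (g : R) (k : nat) :
  (\forall n \near \oo, 0 < a n) ->
  (a n / a n.+1) @[n --> \oo] --> expR g ->
  (a (n - k)%N / a n) @[n --> \oo] --> expR (g * k%:R).
Proof.
move=> a0 ag.
have H : (a n / a (n + k)%N) @[n --> \oo] --> expR (g * k%:R).
  elim: k => [|k IH].
    rewrite mulr0 expR0; apply: cvg_near_cst.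
    near=> n; rewrite addn0 divff// gt_eqF//; near: n; exact: a0.
  have -> : expR (g * k.+1%:R) = expR (g * k%:R) * expR g.
    by rewrite -expRD -natr1 mulrDr mulr1.
  have agk : (a (n + k)%N / a (n + k).+1) @[n --> \oo] --> expR g.
    by rewrite (cvg_shiftn k (fun n => a n / a n.+1)).
  apply: cvg_trans (cvgM IH agk).
  apply: near_eq_cvg; near=> n => /=.
  rewrite addnS mulrA divfK// gt_eqF//; near: n.
  case: a0 => N _ HN; exists N => // n /= Nn.
  by apply: HN => /=; rewrite (leq_trans Nn)// leq_addr.
rewrite -(cvg_shiftn k).
by under eq_fun do rewrite addnK.
Unshelve. all: by end_near. Qed.

(* Stands for the second defining property of the class Ss: the convolution
   square of [a] is asymptotically carried by the two ends of the range. *)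
Definition conv_tail_negligible a := forall eps : R, 0 < eps ->
  exists K0 : nat, forall K : nat, (K0 <= K)%N -> \forall n \near \oo,
    \sum_(K <= i < (n - K).+1) a i * a (n - i)%N <= eps * a n.

(** Two values of [S] are compared through a common [u n], so [S] is Cauchy and [u] has the same
    limit. In the application [S K] is a partial sum, whose convergence is thus a conclusion and not
    an assumption. *)
Lemma approx_cvg (u S : nat -> R) :
  (forall eps : R, 0 < eps -> exists K0 : nat, forall K : nat, (K0 <= K)%N ->
     \forall n \near \oo, `|u n - S K| <= eps) ->
  exists l : R, S @ \oo --> l /\ u @ \oo --> l.
Proof.
move=> uS.
have SS eps : 0 < eps -> exists K0 : nat, forall K K' : nat,
    (K0 <= K)%N -> (K0 <= K')%N -> `|S K - S K'| <= eps.
  move=> e0; have [K0 HK0] := uS (eps / 2) (divr_gt0 e0 (ltr0n _ 2)).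
  exists K0 => K K' KK KK'.
  have [N _ HN] := HK0 K KK; have [N' _ HN'] := HK0 K' KK'.
  have := HN (maxn N N') (leq_maxl _ _); have := HN' (maxn N N') (leq_maxr _ _).
  move=> /=; set x := u _ => A B.
  rewrite [eps]splitr (_ : S K - S K' = (S K - x) + (x - S K')); last by ring.
  by rewrite (le_trans (ler_normD _ _))// lerD// distrC.
have cS : cvg (S @ \oo).
  apply/cauchy_cvgP/cauchy_exP => e e0.
  have [K0 HK] := SS (e / 2) (divr_gt0 e0 (ltr0n _ 2)).
  exists (S K0), K0 => // K /= KK.
  rewrite /ball /= (le_lt_trans (HK _ _ _ KK))//.
  by rewrite ltr_pdivrMr// ltr_pMr// ltr1n.
exists (lim (S @ \oo)); split => //.
apply/cvgrPdist_le => e e0.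
have [K0 HK] := uS (e / 2) (divr_gt0 e0 (ltr0n _ 2)).
move/cvgrPdist_le : cS => /(_ (e / 2) (divr_gt0 e0 (ltr0n _ 2))) [K1 _ HK1].
have [N _ HN] := HK (maxn K0 K1) (leq_maxl _ _).
exists N => // n Nn /=.
have A := HN n Nn; have B := HK1 (maxn K0 K1) (leq_maxr _ _).
rewrite [e]splitr (_ : _ - u n = (lim (S @ \oo) - S (maxn K0 K1))
   + (S (maxn K0 K1) - u n)); last by ring.
by rewrite (le_trans (ler_normD _ _))// lerD// distrC.
Qed.

(** By symmetry the two ends of the convolution contribute twice the same sum of [K] terms. Divided
    by [a n], it tends to a partial sum of [d]. Both ends together thus exhaust the limit [2 * d] up
    to a small error, and nothing is left for the middle. *)
Lemma Ss_conv_tail_negligible (g : R) a : in_Ss g a -> conv_tail_negligible a.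
Proof.
move=> [a_ge0 a_gt0 ag [d [sd cd]]] eps e0.
have e4 : 0 < eps / 8 by rewrite divr_gt0.
move/cvgrPdist_le : sd => /(_ _ e4) [K0 _ HK0]; exists K0 => K KK.
have {}HK0 := HK0 K KK.
have sK : (\sum_(0 <= i < K) a i * (a (n - i)%N / a n)) @[n --> \oo] -->
    series (fun i => a i * expR (g * i%:R)) K.
  apply: cvg_big; first exact: add_continuous.
  by move=> i _; apply: cvgM; [exact: cvg_cst|exact: ratio_shift].
move/cvgrPdist_le : sK => /(_ _ e4) sK.
move/cvgrPdist_le : cd => /(_ _ e4) cd.
near=> n.
have an0 : 0 < a n by near: n; exact: a_gt0.
have nK : (2 * K <= n)%N by near: n; exact: nbhs_infty_ge.
have sKn : `|series (fun i => a i * expR (g * i%:R)) K -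
   \sum_(0 <= i < K) a i * (a (n - i)%N / a n)| <= eps / 8.
  by near: n; exact: sK.
have cdn : `|2 * d - (\sum_(0 <= i < n.+1) a i * a (n - i)%N) / a n|
   <= eps / 8.
  by near: n; exact: cd.
rewrite -ler_pdivrMr//.
have split3 : \sum_(0 <= i < n.+1) a i * a (n - i)%N =
  2 * (\sum_(0 <= i < K) a i * a (n - i)%N) +
  \sum_(K <= i < (n - K).+1) a i * a (n - i)%N.
  rewrite (@big_cat_nat _ _ _ K)//=; last by lia.
  rewrite (@big_cat_nat _ _ _ (n - K).+1 K)//=; [|lia|lia].
  have -> : \sum_((n - K).+1 <= i < n.+1) a i * a (n - i)%N =
     \sum_(0 <= i < K) a i * a (n - i)%N.
    rewrite big_nat_rev/= -{1}[(n-K).+1]add0n big_addn.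
    rewrite (_ : (n.+1 - (n - K).+1 = K)%N); last by lia.
    apply: eq_big_nat => i /andP[_ iK].
    rewrite mulrC; congr (a _ * a _); lia.
  by rewrite mulr2n mulrDl mul1r; ring.
have E : \sum_(0 <= i < K) a i * (a (n - i)%N / a n) =
   (\sum_(0 <= i < K) a i * a (n - i)%N) / a n.
  by rewrite mulr_suml; apply: eq_bigr => i _; rewrite mulrA.
rewrite E in sKn; move: HK0 sKn cdn => /=; rewrite !ler_norml split3.
rewrite [(_ + _) / _]mulrDl -[2 * _ / _]mulrA.
set x := (_ / a n); set y := (_ / a n); set z := series _ _.
by move=> /andP[? ?] /andP[? ?] /andP[? ?]; lra.
Unshelve. all: by end_near. Qed.

End RealSequences.

Section Asymptotics.
Context {R : realType}.

(** Here [f] is the survival probability, [h k] is P(X_k >= -x) and [H] is the kernel of the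
    recursion. The sum is cut into [k < K], which the division by [n] kills, a middle part, killed
    by the negligible convolution, and [n - k < K], which converges to a partial sum of the answer.
    The first two estimates need [f <= C * a], which has to be proved beforehand. *)
Lemma spitzer_asymptotics (a f h qq : nat -> R) (H : nat -> nat -> R) (g : R) :
  (\forall n \near \oo, 0 < a n) ->
  (a n / a n.+1) @[n --> \oo] --> expR g ->
  conv_tail_negligible a ->
  (forall n, 0 <= f n <= 1) -> (forall k, 0 <= h k) ->
  (forall k j, 0 <= H k j <= h k * f j) ->
  (exists C, \forall k \near \oo, h k <= C * (k%:R * a k)) ->
  (forall j, (H k j / (k%:R * a k)) @[k --> \oo] --> qq j) ->
  (forall n, n%:R * f n = \sum_(1 <= k < n.+1) H k (n - k)%N) ->
  exists S : R, [series expR (g * j%:R) * qq j]_j @ \oo --> S /\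
    (f n / a n) @[n --> \oo] --> S.
Proof.
move=> a_gt0 ag atail f01 h0 H01 [C0' hC0] Hqq fH.
have f0 n : 0 <= f n by case/andP: (f01 n).
have Hle k j : H k j <= h k * f j by case/andP: (H01 k j).
pose C0 := Num.max C0' 1.
have C0gt0 : 0 < C0 by rewrite /C0 lt_max ltr01 orbT.
have {hC0 a_gt0} [N0 HN0] : exists N0, forall k, (N0 <= k)%N ->
    [/\ (0 < k)%N, 0 < a k & h k <= C0 * (k%:R * a k)].
  apply/near_infty_ex; near=> k.
  have ak : 0 < a k by near: k.
  split=> //; first by near: k; exact: nbhs_infty_gt.
  have : h k <= C0' * (k%:R * a k) by near: k.
  move=> /le_trans; apply; rewrite ler_wpM2r//; last by rewrite le_max lexx.
  by rewrite mulr_ge0// ltW.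
have a_gt0 n : (N0 <= n)%N -> 0 < a n by move=> /HN0[].
have a_gt0' : \forall n \near \oo, 0 < a n by exists N0.
(* Relative to [n * a n], [fst] controls the terms with [k < K] once [f <= C * a] is known, and
   [lst] those with [n - k < K] using only [f <= 1]. *)
pose fst K n : R := (\sum_(1 <= k < K) h k * (a (n - k)%N / a n)) / n%:R.
pose lst K n : R := \sum_(0 <= j < K) a (n - j)%N / a n.
have fst0 K : fst K n @[n --> \oo] --> 0.
  rewrite -(mulr0 (\sum_(1 <= k < K) h k * expR (g * k%:R))).
  apply: cvgM; last first.
    apply: (@squeeze_cvgr _ _ _ _ (cst 0) (fun n => harmonic n.-1)).
    - near=> n; rewrite invr_ge0 ler0n/= prednK//.
      by near: n; exact: nbhs_infty_gt.
    - exact: cvg_cst.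
    - rewrite -(cvg_shiftn 1); under eq_fun do rewrite addn1/=.
      exact: cvg_harmonic.
  apply: cvg_big; first exact: add_continuous.
  by move=> i _; apply: cvgM; [exact: cvg_cst|exact: ratio_shift].
have lstB K : exists2 B : R, 0 <= B & \forall n \near \oo, lst K n <= B.
  exists (\sum_(0 <= j < K) expR (g * j%:R) + 1).
    by rewrite addr_ge0// sumr_ge0// => i _; exact: expR_ge0.
  have : lst K n @[n --> \oo] --> \sum_(0 <= j < K) expR (g * j%:R).
    apply: cvg_big; first exact: add_continuous.
    by move=> i _; exact: ratio_shift.
  by move/cvgr_le => /(_ (_ + 1)); apply; rewrite ltrDl.
have split3 K n : (2 * K < n)%N -> (0 < K)%N -> (N0 <= K)%N ->
    \sum_(1 <= k < n.+1) H k (n - k)%N =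
    \sum_(1 <= k < K) H k (n - k)%N + \sum_(K <= k < (n - K).+1) H k (n - k)%N
    + \sum_(0 <= j < K) H (n - j)%N j.
  move=> nK K0 NK.
  rewrite (@big_cat_nat _ _ _ K)//=; last by lia.
  rewrite (@big_cat_nat _ _ _ (n - K).+1 K)//=; [|lia|lia].
  rewrite addrA; congr (_ + _).
  rewrite big_nat_rev/= -{1}[(n-K).+1]add0n big_addn.
  rewrite (_ : (n.+1 - (n - K).+1 = K)%N); last by lia.
  by apply: eq_big_nat => i /andP[_ iK]; congr (H _ _); lia.
(* The comparison of [f] with [a] is required below [n] only, so that this estimate can serve inside
   the strong induction that proves the comparison. *)
have small K n C : (2 * K < n)%N -> (0 < K)%N -> (N0 <= K)%N -> 0 <= C ->
    (forall m, (N0 <= m < n)%N -> f m <= C * a m) ->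
    \sum_(1 <= k < K) H k (n - k)%N + \sum_(K <= k < (n - K).+1) H k (n - k)%N
    <= C * fst K n * (n%:R * a n) +
       C * C0 * n%:R * \sum_(K <= i < (n - K).+1) a i * a (n - i)%N.
  move=> nK K0 NK C_ge0 fC; apply: lerD.
    rewrite /fst.
    have an : a n != 0 by rewrite gt_eqF// a_gt0//; lia.
    have n0 : n%:R != 0 :> R by rewrite pnatr_eq0; lia.
    rewrite [leRHS](_ : _ = C * (\sum_(1 <= k < K) h k * (a (n - k)%N / a n)) * a n); last first.
      by field; rewrite n0.
    rewrite -mulrA mulr_suml mulr_sumr ler_sum_nat// => k /andP[k1 kK].
    rewrite (le_trans (Hle _ _))//.
    rewrite [leRHS](_ : _ = h k * (C * a (n - k)%N)); last by field.
    by rewrite ler_wpM2l// fC//; lia.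
  rewrite mulr_sumr ler_sum_nat// => k /andP[Kk kn].
  have [_ _ hk] := HN0 k (leq_trans NK Kk).
  rewrite (le_trans (Hle _ _))//.
  have ak : 0 < a k by apply: a_gt0; lia.
  have ank : f (n - k)%N <= C * a (n - k)%N by apply: fC; lia.
  rewrite (le_trans (ler_pM (h0 _) (f0 _) hk ank))//.
  rewrite [leRHS](_ : _ = C0 * (n%:R * a k) * (C * a (n - k)%N)); last by ring.
  rewrite ler_wpM2r// ?(le_trans (f0 _) ank)//.
  apply: ler_wpM2l; first exact: ltW.
  by apply: ler_wpM2r; [exact: ltW|rewrite ler_nat; lia].
have last_le K n : (2 * K < n)%N -> (N0 <= K)%N ->
    \sum_(0 <= j < K) H (n - j)%N j <= C0 * lst K n * (n%:R * a n).
  move=> nK NK.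
  have an : a n != 0 by rewrite gt_eqF// a_gt0//; lia.
  rewrite [leRHS](_ : _ = C0 * n%:R * (lst K n * a n)); last by ring.
  rewrite /lst mulr_suml mulr_sumr ler_sum_nat// => k /andP[_ kK].
  rewrite divfK// (le_trans (Hle _ _))//.
  have [_ _ hk] : [/\ _, _ & h (n - k)%N <= _] := HN0 (n - k)%N ltac:(lia).
  have [_ fk1] := andP (f01 k).
  rewrite (le_trans (ler_pM (h0 _) (f0 _) hk fk1))// mulr1.
  rewrite -mulrA; apply: ler_wpM2l; first exact: ltW.
  apply: ler_wpM2r; last by rewrite ler_nat; lia.
  by apply/ltW/a_gt0; lia.
have [C Cge0 fC] : exists2 C : R, 0 <= C &
    forall n, (N0 <= n)%N -> f n <= C * a n.
  have e0 : 0 < (4 * C0)^-1 by rewrite invr_gt0 mulr_gt0.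
  have [K [K_gt0 NK tailK]] : exists K, [/\ (0 < K)%N, (N0 <= K)%N &
      \forall n \near \oo, \sum_(K <= i < (n - K).+1) a i * a (n - i)%N
        <= (4 * C0)^-1 * a n].
    have [K0 /(_ (K0 + N0).+1 ltac:(lia)) ?] := atail _ e0.
    by exists (K0 + N0).+1; split => //; lia.
  have [B B0 lB] := lstB K.
  have fst14 : \forall n \near \oo, fst K n <= 4^-1.
    by move/cvgr_le : (fst0 K); apply; rewrite invr_gt0.
  have [N1 HN1] : exists N1, forall n, (N1 <= n)%N -> [/\ (2 * K < n)%N,
     \sum_(K <= i < (n - K).+1) a i * a (n - i)%N <= (4 * C0)^-1 * a n,
     lst K n <= B & fst K n <= 4^-1].
    apply/near_infty_ex; near=> n; split; near: n.
    - exact: nbhs_infty_gt.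
    - exact: tailK.
    - exact: lB.
    - exact: fst14.
  (* The first two blocks take [C / 4] each, and [2 * C0 * B] leaves at most [C / 2] to the last
     one. The finite sum starts the induction below [N1]; absolute values keep its terms
     nonnegative, since the sign of the first values of [a] is unknown. *)
  pose C := 2 * C0 * B + \sum_(0 <= m < N1) f m / `|a m|.
  have sum0 : 0 <= \sum_(0 <= m < N1) f m / `|a m|.
    by apply: sumr_ge0 => i _; rewrite divr_ge0.
  have C_ge0 : 0 <= C by rewrite addr_ge0// mulr_ge0// mulr_ge0// ltW.
  exists C => //; elim/ltn_ind => n IH Nn.
  have an : 0 < a n by exact: a_gt0.
  have [nN1|N1n] := ltnP n N1.
    rewrite -ler_pdivrMr// (le_trans _ (_ : f n / `|a n| <= _))//.
      by rewrite gtr0_norm.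
    apply: (@le_trans _ _ (\sum_(0 <= m < N1) f m / `|a m|)).
      rewrite (bigD1_seq n)//= ?mem_index_iota ?iota_uniq//.
      by rewrite lerDl sumr_ge0// => i _; rewrite divr_ge0.
    by rewrite lerDr mulr_ge0// mulr_ge0// ltW.
  have [nK tn ln fn] := HN1 n N1n.
  have n0 : 0 < n%:R :> R by rewrite ltr0n (leq_ltn_trans _ nK).
  rewrite -(ler_pM2l n0) fH (split3 K)//.
  have sm := small K n C nK K_gt0 NK C_ge0 _.
  have ll := last_le K n nK NK.
  apply: le_trans (lerD (sm _) ll) _.
    by move=> m /andP[? ?]; exact: IH.
  have na : 0 < n%:R * a n by exact: mulr_gt0.
  apply: (@le_trans _ _ (C * 4^-1 * (n%:R * a n) +
     C * C0 * n%:R * ((4 * C0)^-1 * a n) + C0 * B * (n%:R * a n))).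
    apply: lerD; first apply: lerD.
    - by apply: ler_wpM2r; [exact: ltW|exact: (ler_wpM2l C_ge0)].
    - by apply: ler_wpM2l => //; rewrite !mulr_ge0// ltW.
    - by apply: ler_wpM2r; [exact: ltW|apply: ler_wpM2l => //; exact: ltW].
  rewrite [leLHS](_ : _ = (C / 2 + C0 * B) * (n%:R * a n)); last first.
    by field; rewrite gt_eqF.
  rewrite [leRHS]mulrCA; apply: ler_wpM2r; first exact: ltW.
  rewrite [leRHS](_ : _ = C / 2 + C / 2); last by field.
  rewrite lerD2l ler_pdivlMr// /C -mulrA (mulrC _ 2) mulrA.
  by rewrite lerDl.
apply: approx_cvg => e e0.
have D0 : 0 < 2 * (C * C0 + 1).
  by rewrite mulr_gt0// ltr_wpDl// mulr_ge0// ltW.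
have [K0 HK0] := atail _ (divr_gt0 (divr_gt0 e0 (ltr0n _ 2)) D0).
exists (K0 + N0).+1 => K KK.
have [K_gt0 NK K0K] : [/\ (0 < K)%N, (N0 <= K)%N & (K0 <= K)%N] by split; lia.
have e4 : 0 < e / 4 / (C + 1) by rewrite divr_gt0// ?divr_gt0// ltr_wpDl.
have tailK := HK0 K K0K.
have fste : \forall n \near \oo, fst K n <= e / 4 / (C + 1).
  by move/cvgr_le : (fst0 K); apply.
have lastc : (\sum_(0 <= j < K) H (n - j)%N j) / (n%:R * a n) @[n --> \oo]
    --> [series expR (g * j%:R) * qq j]_j K.
  have -> : (fun n => (\sum_(0 <= j < K) H (n - j)%N j) / (n%:R * a n)) =
     (fun n => \sum_(0 <= j < K) H (n - j)%N j / (n%:R * a n)).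
    by apply/funext => n; rewrite mulr_suml.
  apply: cvg_big; first exact: add_continuous.
  move=> j _.
  suff : H (n - j)%N j / (n%:R * a n) @[n --> \oo] --> expR (g * j%:R) * qq j.
    by [].
  have c1 : H (n - j)%N j / ((n - j)%:R * a (n - j)%N) @[n --> \oo] --> qq j.
    by rewrite (cvg_centern j (fun k => H k j / (k%:R * a k))).
  have c2 : (n - j)%:R / n%:R @[n --> \oo] --> (1 : R).
    rewrite -(cvg_shiftn 1).
    have : (1 - j%:R * n.+1%:R^-1) @[n --> \oo] --> (1 - j%:R * 0 : R).
      by apply: cvgB; [exact: cvg_cst|apply: cvgMr; exact: cvg_harmonic].
    rewrite mulr0 subr0 => c3; apply: (cvg_trans _ c3); apply: near_eq_cvg.
    exists j => // n /= jn; rewrite addn1 natrB; last exact: leqW.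
    by field; rewrite addrC natr1 pnatr_eq0.
  have := cvgM (cvgM c1 c2) (ratio_shift (k := j) a_gt0' ag).
  rewrite mulr1 [qq j * _]mulrC => /(_ _ _) c3; apply: (cvg_trans _ c3); apply: near_eq_cvg; near=> n => /=.
  have anj : 0 < a (n - j)%N by apply: a_gt0; near: n; apply/near_infty_ex; exists (N0 + j)%N => m; clear; lia.
  have nj0 : 0 < (n - j)%:R :> R.
    by rewrite ltr0n; near: n; apply/near_infty_ex; exists j.+1 => m; clear; lia.
  have an : 0 < a n by near: n.
  have n0 : 0 < n%:R :> R by rewrite ltr0n; near: n; exists 1%N.
  by field; rewrite !gt_eqF.
have lastc' : \forall n \near \oo, `| (\sum_(0 <= j < K) H (n - j)%N j) / (n%:R * a n) - [series expR (g * j%:R) * qq j]_j K| <= e / 4.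
  move/cvgrPdist_le : lastc => /(_ _ (divr_gt0 e0 (ltr0n _ 4))).
  by under eq_near do rewrite distrC.
near=> n.
have nK : (2 * K < n)%N by near: n; exact: nbhs_infty_gt.
have an : 0 < a n by near: n.
have n0 : 0 < n%:R :> R by rewrite ltr0n (leq_ltn_trans _ nK).
have na : 0 < n%:R * a n by exact: mulr_gt0.
rewrite (_ : f n / a n = (n%:R * f n) / (n%:R * a n)); last first.
  by field; rewrite !gt_eqF.
have := small K n C nK K_gt0 NK Cge0 _.
move=> /(_ ltac:(by move=> m /andP[? ?]; exact: fC)) sm.
rewrite fH (split3 K)//.
rewrite [(_ + _) / _]mulrDl.
set x := _ / _ in sm *.
have x0 : 0 <= x.
  rewrite divr_ge0 ?(ltW na)// addr_ge0// big_seq sumr_ge0// => i _.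
  - by case/andP : (H01 i (n - i)%N).
  - by case/andP : (H01 i (n - i)%N).
have {sm} xe : x <= e / 2.
  rewrite /x ler_pdivrMr// (le_trans sm)//.
  have fe : fst K n <= e / 4 / (C + 1) by near: n.
  have te : \sum_(K <= i < (n - K).+1) a i * a (n - i)%N <=
      e / 2 / (2 * (C * C0 + 1)) * a n by near: n.
  apply: (@le_trans _ _ ((C + 1) * (e / 4 / (C + 1)) * (n%:R * a n) +
     (C * C0 + 1) * n%:R * (e / 2 / (2 * (C * C0 + 1)) * a n))).
    apply: lerD.
      apply: ler_wpM2r; first exact: ltW.
      apply: (@le_trans _ _ (C * (e / 4 / (C + 1)))).
        exact: (ler_wpM2l Cge0).
      by apply: ler_wpM2r; [exact: ltW|rewrite lerDl].
    apply: (@le_trans _ _ (C * C0 * n%:R * (e / 2 / (2 * (C * C0 + 1)) * a n))).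
      by apply: ler_wpM2l => //; rewrite !mulr_ge0// ltW.
    apply: ler_wpM2r; first by rewrite mulr_ge0 ?(ltW an)// divr_ge0// ltW// divr_gt0.
    by apply: ler_wpM2r => //; rewrite lerDl.
  rewrite le_eqVlt; apply/orP; left; apply/eqP; field.
  have D1 : C + 1 != 0 by rewrite gt_eqF// ltr_wpDl.
  have D2 : C * C0 + 1 != 0 by rewrite gt_eqF//; move: D0; rewrite pmulr_rgt0.
  by rewrite ?D1 ?D2.
have ye : `| (\sum_(0 <= j < K) H (n - j)%N j) / (n%:R * a n) - [series expR (g * j%:R) * qq j]_j K| <= e / 4 by near: n.
rewrite -addrA (le_trans (ler_normD _ _))// (ger0_norm x0).
lra.
Unshelve. all: by end_near. Qed.
End Asymptotics.

(** * Transfer of the negligible convolution from integer times to a finer grid *)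

Section Skeleton.
Context {R : realType}.

Lemma near_infty_divn (m : nat) (Q : nat -> Prop) : (0 < m)%N ->
  (\forall n \near \oo, Q n) -> \forall n \near \oo, Q (n %/ m)%N.
Proof.
move=> m0 [N _ HN]; exists (N * m)%N => // n /= Nn.
by apply: HN => /=; rewrite leq_divRL.
Qed.

Lemma sum_divn (F : nat -> R) (m M : nat) : (0 < m)%N ->
  \sum_(0 <= i < M * m) F (i %/ m)%N = m%:R * \sum_(0 <= p < M) F p.
Proof.
move=> m0; elim: M => [|M IH]; first by rewrite mul0n !big_nil mulr0.
rewrite (@big_cat_nat _ _ _ (M * m))//=; last by rewrite leq_mul2r leqnSn orbT.
rewrite IH big_nat_recr//= mulrDr; congr (_ + _).
rewrite -{1}[(M * m)%N]add0n big_addn -mulnBl subSnn mul1n.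
rewrite mulr_natl -[in RHS](card_ord m) -sumr_const big_mkord.
apply: eq_bigr => i _; congr F.
by rewrite addnC divnMDl// divn_small ?addn0.
Qed.

Lemma ler_sum_nat_subrange (F : nat -> R) (m n m' n' : nat) :
  (m' <= m)%N -> (n <= n')%N -> (forall i, 0 <= F i) ->
  \sum_(m <= i < n) F i <= \sum_(m' <= i < n') F i.
Proof.
move=> mm nn F0; have [mn|nm] := leqP m n; last first.
  by rewrite big_geq ?(ltnW nm)// sumr_ge0.
rewrite [leRHS](@big_cat_nat _ _ _ m)//=; last exact: leq_trans nn.
rewrite [X in _ <= _ + X](@big_cat_nat _ _ _ n)//=.
by rewrite addrCA lerDl addr_ge0// sumr_ge0.
Qed.

(** The alternative is the carry in the addition of the two remainders. Starting one block later
    than [m * K0] puts the quotient in the window of [n %/ m] as well as in that of its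
    predecessor. *)
Lemma divn_subn_window (m n i K K0 : nat) : (0 < m)%N -> (m * K0.+1 <= K)%N ->
  (K <= i < (n - K).+1)%N ->
  (K0 <= i %/ m < ((n %/ m).-1 - K0).+1)%N /\
  ((n - i) %/ m = n %/ m - i %/ m \/ (n - i) %/ m = (n %/ m).-1 - i %/ m)%N.
Proof.
move=> m0 mK /andP[Ki iK].
have q1 : (K0 < i %/ m)%N by rewrite leq_divRL// mulnC; lia.
have q2 : (K0 < (n - i) %/ m)%N by rewrite leq_divRL// mulnC; lia.
have : (n %/ m = i %/ m + (n - i) %/ m + (m <= i %% m + (n - i) %% m))%N.
  by rewrite -divnD// subnKC//; lia.
move: (i %/ m)%N ((n - i) %/ m)%N (n %/ m)%N q1 q2 => p q r.
by case: (m <= _)%N => /= {m0 mK Ki iK}; lia.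
Qed.

(** Replacing [b] by [a] at the quotients turns its middle convolution into [m] copies of two middle
    convolutions of [a], at [n %/ m] and at its predecessor. The ratio condition on [a] bounds the
    value at the predecessor. *)
Lemma conv_tail_negligible_skeleton (a b : nat -> R) (m : nat) (C g : R) :
  (0 < m)%N -> (forall n, 0 <= a n) -> (forall n, 0 <= b n) -> 0 < C ->
  (\forall n \near \oo, 0 < a n) ->
  (a n / a n.+1) @[n --> \oo] --> expR g ->
  (\forall k \near \oo, b k <= C * a (k %/ m)%N) ->
  (\forall k \near \oo, a (k %/ m)%N <= C * b k) ->
  conv_tail_negligible a -> conv_tail_negligible b.
Proof.
move=> m0 a0 b0 C0 a_gt0 ag /near_infty_ex[N1 bC] aC atail eps eps0.
pose D := expR g + 1.
have D0 : 0 < D by rewrite addr_gt0// expR_gt0.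
have aD : \forall n \near \oo, (0 < n)%N -> a n.-1 <= D * a n.
  have /near_infty_ex[N HN] : \forall n \near \oo, a n / a n.+1 <= D.
    by move/cvgr_le : ag => /(_ (_ + 1)); apply; rewrite ltrDl.
  have /near_infty_ex[N' HN'] := a_gt0.
  apply/near_infty_ex; exists (N + N').+1 => -[//|n] nN _ /=.
  by rewrite -ler_pdivrMr; [apply: HN|apply: HN']; lia.
(* The factor [m] counts the indices with a given quotient, [1 + D] the two convolutions; [C ^+ 2]
   comes from replacing both factors [b] by [a], and one more [C] from the return to [b n]. *)
pose eps' := eps / (m%:R * C ^+ 3 * (1 + D)).
have eps'0 : 0 < eps'.
  by rewrite divr_gt0// mulr_gt0 ?ltr_wpDl ?(ltW D0)// ?mulr_gt0 ?exprn_gt0 ?ltr0n ?(addr_gt0 ltr01).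
have [K0 HK0] := atail eps' eps'0.
exists (N1 + m * K0.+1)%N => K KK.
have KN1 : (N1 <= K)%N by lia.
have Km : (m * K0.+1 <= K)%N by lia.
have tail0 := HK0 K0 (leqnn _).
have tail1 := near_infty_divn m0 tail0.
have /(near_infty_divn m0) tail2 : \forall n \near \oo,
   \sum_(K0 <= i < (n.-1 - K0).+1) a i * a (n.-1 - i)%N <= eps' * a n.-1.
  have /near_infty_ex[N HN] := tail0.
  by apply/near_infty_ex; exists N.+1 => n Nn; apply: HN; rewrite -ltnS (ltn_predK Nn).
have aD' := near_infty_divn m0 aD.
near=> n.
have nm : (2 * K0.+2 <= n %/ m)%N.
  by near: n; apply: near_infty_divn m0 (nbhs_infty_ge _).
have t1 : \sum_(K0 <= i < (n %/ m - K0).+1) a i * a (n %/ m - i)%N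
   <= eps' * a (n %/ m)%N by near: n.
have t2 : \sum_(K0 <= i < ((n %/ m).-1 - K0).+1) a i * a ((n %/ m).-1 - i)%N
   <= eps' * a (n %/ m).-1 by near: n; exact: tail2.
have aDn : (0 < n %/ m)%N -> a (n %/ m).-1 <= D * a (n %/ m)%N.
  by near: n; exact: aD'.
have aCn : a (n %/ m)%N <= C * b n by near: n.
set M := (n %/ m)%N in nm t1 t2 aDn aCn.
(* Both possible values of the second quotient are included, so that the summand depends on [i]
   through [i %/ m] only. *)
pose F p := if (K0 <= p < (M.-1 - K0).+1)%N
  then a p * a (M - p)%N + a p * a (M.-1 - p)%N else 0.
have F0 p : 0 <= F p.
  by rewrite /F; case: ifP => // _; rewrite addr_ge0// mulr_ge0.
have step1 : \sum_(K <= i < (n - K).+1) b i * b (n - i)%N <=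
    C ^+ 2 * \sum_(K <= i < (n - K).+1) F (i %/ m)%N.
  rewrite mulr_sumr ler_sum_nat// => i iw.
  have iN : (N1 <= i)%N by case/andP: iw => Ki _; exact: leq_trans Ki.
  have niN : (N1 <= n - i)%N by clear -iw KN1; lia.
  rewrite (le_trans (ler_pM (b0 _) (b0 _) (bC _ iN) (bC _ niN)))//.
  rewrite [leLHS](_ : _ = C ^+ 2 * (a (i %/ m)%N * a ((n - i) %/ m)%N)); last by ring.
  apply: ler_wpM2l; first by rewrite exprn_ge0// ltW.
  have [pw pq] := divn_subn_window m0 Km iw.
  rewrite /F pw; case: pq => ->; first by rewrite lerDl mulr_ge0.
  by rewrite lerDr mulr_ge0.
have step2 : \sum_(K <= i < (n - K).+1) F (i %/ m)%N <=
    m%:R * \sum_(0 <= p < M.+1) F p.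
  rewrite -sum_divn//; apply: ler_sum_nat_subrange => //.
  by rewrite (leq_ltn_trans (leq_subr _ _))//; exact: ltn_ceil.
have step3 : \sum_(0 <= p < M.+1) F p <= eps' * a M + eps' * a M.-1.
  apply: (@le_trans _ _ (\sum_(K0 <= i < (M.-1 - K0).+1) (a i * a (M - i)%N +
     a i * a (M.-1 - i)%N))).
    rewrite [leRHS](@big_nat_widenl _ _ _ _ 0)//.
    rewrite [leRHS](@big_nat_widen _ _ _ _ _ M.+1)//; last by clear; lia.
    rewrite big_mkcond/= /F le_eqVlt; apply/orP; left; apply/eqP.
    by apply: eq_bigr => p _; rewrite andbC.
  rewrite big_split/=; apply: lerD => //.
  apply: le_trans t1; apply: ler_sum_nat_subrange => // [|i]; last exact: mulr_ge0.
  by clear; lia.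
apply: (le_trans step1).
apply: (@le_trans _ _ (C ^+ 2 * (m%:R * (eps' * (1 + D) * (C * b n))))).
  apply: ler_wpM2l; first by rewrite exprn_ge0// ltW.
  apply: (le_trans step2); apply: ler_wpM2l => //; apply: (le_trans step3).
  rewrite -mulrDr -mulrA; apply: ler_wpM2l; first exact: ltW.
  apply: (@le_trans _ _ ((1 + D) * a M)).
    by rewrite mulrDl mul1r lerD2l aDn// (leq_trans _ nm).
  by apply: ler_wpM2l => //; rewrite addr_ge0// ltW.
rewrite le_eqVlt; apply/orP; left; apply/eqP; rewrite /eps'; field.
have D1 : 1 + D != 0 by rewrite gt_eqF// ltr_wpDl// ltW.
by rewrite D1 (gt_eqF C0) pnatr_eq0 -lt0n m0.
Unshelve. all: by end_near. Qed.

End Skeleton.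

(** * Laws of i.i.d. sequences and Spitzer's recursion *)

Section SequenceLaw.
Context {R : realType}.

(** These boxes form a pi-system generating the product sigma-algebra, so the law of a sequence is
    determined by finitely many coordinates at a time. *)
Definition cylinders : set (set (nat -> R)) :=
  [set A | exists n (B : nat -> set R), (forall i, measurable (B i)) /\
     A = [set e | forall i, (i < n)%N -> B i (e i)]].

Definition seqspace : measurableType (sigma_display cylinders) :=
  g_sigma_algebraType cylinders.

Lemma measurable_coord i : measurable_fun setT (fun e : seqspace => e i).
Proof.
move=> _ B mB; rewrite setTI; apply: sub_sigma_algebra.
exists i.+1, (fun j => if j == i then B else setT); split.
  by move=> j; case: ifP.
apply/seteqP; split => e /=.
  by move=> Bei j _; case: eqP => // ->.
by move=> /(_ i (ltnSn i)); rewrite eqxx.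
Qed.

Lemma setI_closed_cylinders : setI_closed cylinders.
Proof.
move=> _ _ [n [B [mB ->]]] [m [C [mC ->]]].
exists (maxn n m), (fun i => (if (i < n)%N then B i else setT) `&`
  (if (i < m)%N then C i else setT)); split.
  by move=> i; apply: measurableI; case: ifP.
apply/seteqP; split => e /=.
  by move=> [H1 H2] i _; split; case: ifP => //; [exact: H1|exact: H2].
move=> H; split => i im.
  by have [] := H i (leq_trans im (leq_maxl _ _)); rewrite im.
by have [_] := H i (leq_trans im (leq_maxr _ _)); rewrite im.
Qed.

Lemma measurable_seqmap d (T : measurableType d) (Y : nat -> T -> R) :
  (forall i, measurable_fun setT (Y i)) ->
  measurable_fun setT (fun w => (fun i => Y i w) : seqspace).
Proof.
move=> mY; apply: (@measurability _ _ T seqspace setT _ cylinders) => // _ [_ [n [B [mB ->]]] <-].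
rewrite setTI (_ : _ @^-1` _ = \bigcap_(i in [set i | (i < n)%N]) (Y i @^-1` B i)).
  apply: bigcap_measurableType => i _.
  by rewrite -[X in measurable X]setTI; exact: mY.
by apply/seteqP; split.
Qed.

(** The pi-lambda theorem for laws on sequences. It lives on two different probability spaces so
    that it covers both a permutation of the increments and the passage to an independent copy. *)
Lemma law_unique d1 d2 (T1 : measurableType d1) (T2 : measurableType d2)
    (m1 : {measure set T1 -> \bar R}) (m2 : {measure set T2 -> \bar R})
    (Y1 : nat -> T1 -> R) (Y2 : nat -> T2 -> R) (F : seqspace -> \bar R) :
  (forall i, measurable_fun setT (Y1 i)) ->
  (forall i, measurable_fun setT (Y2 i)) ->
  (m1 setT < +oo)%E ->
  (forall n (B : nat -> set R), (forall i, measurable (B i)) ->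
    m1 [set w | forall i, (i < n)%N -> B i (Y1 i w)] =
    m2 [set w | forall i, (i < n)%N -> B i (Y2 i w)]) ->
  measurable_fun setT F -> (forall e, 0 <= F e)%E ->
  (\int[m1]_w F (fun i => Y1 i w) = \int[m2]_w F (fun i => Y2 i w))%E.
Proof.
move=> mY1 mY2 m1oo m12 mF F0.
have p1 := measurable_seqmap mY1; have p2 := measurable_seqmap mY2.
pose mix1 := isMeasurableFun.Build _ _ _ seqspace _ p1.
pose q1 : {mfun T1 >-> seqspace} := HB.pack (fun w => Y1^~ w : seqspace) mix1.
pose mix2 := isMeasurableFun.Build _ _ _ seqspace _ p2.
pose q2 : {mfun T2 >-> seqspace} := HB.pack (fun w => Y2^~ w : seqspace) mix2.
transitivity (\int[pushforward m1 q1]_e F e)%E.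
  by rewrite ge0_integral_pushforward// => e _; exact: F0.
transitivity (\int[pushforward m2 q2]_e F e)%E; last first.
  by rewrite ge0_integral_pushforward// => e _; exact: F0.
apply: eq_measure_integral => A mA _.
apply: (@measure_unique _ _ seqspace cylinders (fun=> setT) erefl
  setI_closed_cylinders _ _ (pushforward m1 q1) (pushforward m2 q2)) => //.
- by move=> i; exists 0%N, (fun=> setT); split => //; apply/seteqP; split.
- by rewrite bigcup_const.
- by move=> _ [n [B [mB ->]]]; exact: m12.
Qed.

End SequenceLaw.
Arguments seqspace R : clear implicits.

Section Functionals.
Context {R : realType}.
Implicit Types (e : nat -> R) (i k m n : nat).

Definition psum i k e : R := \sum_(0 <= j < k) e (i + j)%N.

(** Unfolded at the first increment, this is the minimum of 0 and of the partial sums of [e] from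
    index [i] over at most [k] steps. The recursive form exhibits the projection [min x 0] on which
    the algebra below rests. *)
Fixpoint lmin i k e : R :=
  if k is k'.+1 then Num.min (e i + lmin i.+1 k' e) 0 else 0.

(** Puts the increments [i - 1], ..., 0 in front of a path whose minimum is [z]. *)
Fixpoint lift_min i (z : R) e : R :=
  if i is i'.+1 then lift_min i' (Num.min (e i' + z) 0) e else z.

Lemma psumSl i k e : psum i k.+1 e = e i + psum i.+1 k e.
Proof.
rewrite /psum big_nat_recl// addn0; congr (_ + _).
by apply: eq_bigr => j _; rewrite addSnnS.
Qed.

Lemma psumSr i k e : psum i k.+1 e = psum i k e + e (i + k)%N.
Proof. by rewrite /psum big_nat_recr. Qed.

Lemma psum0 i e : psum i 0 e = 0.
Proof. by rewrite /psum big_nil. Qed.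

Lemma lift_min_lmin i k e : lift_min i (lmin i k e) e = lmin 0 (i + k) e.
Proof. by elim: i k => [//|i IH] k; rewrite addSnnS -(IH k.+1). Qed.

Lemma lmin_le0 i k e : lmin i k e <= 0.
Proof. by case: k => //= k; rewrite ge_min lexx orbT. Qed.

Lemma eq_psum i k i' e e' : (forall j, (j < k)%N -> e (i + j)%N = e' (i' + j)%N) ->
  psum i k e = psum i' k e'.
Proof. by move=> ee; apply: eq_big_nat => j /andP[_ jk]; exact: ee. Qed.

Lemma eq_lmin i k i' e e' : (forall j, (j < k)%N -> e (i + j)%N = e' (i' + j)%N) ->
  lmin i k e = lmin i' k e'.
Proof.
elim: k i i' => [//|k IH] i i' ee /=.
have := ee 0%N isT; rewrite !addn0 => ->; congr (Num.min (_ + _) _).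
by apply: IH => j jk; rewrite !addSnnS; exact: ee.
Qed.

Lemma eq_lift_min i z e e' : (forall j, (j < i)%N -> e j = e' j) ->
  lift_min i z e = lift_min i z e'.
Proof.
elim: i z => [//|i IH] z ee /=; rewrite ee//.
by apply: IH => j ji; apply: ee; exact: ltnW.
Qed.

Lemma measurable_psum i k : measurable_fun setT (psum i k : seqspace R -> R).
Proof.
elim: k => [|k IH].
  rewrite (_ : psum i 0 = cst 0); first exact: measurable_cst.
  by apply/funext => e; rewrite psum0.
rewrite (_ : psum i k.+1 = fun e => psum i k e + e (i + k)%N); last first.
  by apply/funext => e; rewrite psumSr.
by apply: measurable_funD => //; exact: measurable_coord.
Qed.

Lemma measurable_min0 d (T : measurableType d) (f : T -> R) :
  measurable_fun setT f -> measurable_fun setT (fun x => Num.min (f x) 0).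
Proof. by move=> mf; apply: measurable_minr => //; exact: measurable_cst. Qed.

Lemma measurable_lmin i k : measurable_fun setT (lmin i k : seqspace R -> R).
Proof.
elim: k i => [|k IH] i /=; first exact: measurable_cst.
apply: measurable_min0; apply: measurable_funD => //.
exact: measurable_coord.
Qed.

Lemma measurable_lift_min i (z : seqspace R -> R) : measurable_fun setT z ->
  measurable_fun setT (fun e : seqspace R => lift_min i (z e) e).
Proof.
elim: i z => [//|i IH] z mz /=.
apply: (IH (fun e => Num.min (e i + z e) 0)); apply: measurable_min0.
by apply: measurable_funD => //; exact: measurable_coord.
Qed.

End Functionals.

Section IID.
Context {d : measure_display} {T : measurableType d} {R : realType}.
Variable P : probability T R.

(** Quantifying over injective reindexings makes exchangeability immediate, which the cyclic
    permutations below require. *)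
Definition iid (xi : nat -> T -> R) :=
  (forall i, measurable_fun setT (xi i)) /\
  (forall s : nat -> nat, injective s ->
   forall n (B : nat -> set R), (forall i, measurable (B i)) ->
   P [set w | forall i, (i < n)%N -> B i (xi (s i) w)] =
   (\prod_(0 <= i < n) P (xi 0%N @^-1` B i))%E).

Variables (xi : nat -> T -> R) (xi_iid : iid xi).

Lemma iid_cylinder n (B : nat -> set R) : (forall i, measurable (B i)) ->
  P [set w | forall i, (i < n)%N -> B i (xi i w)] =
  (\prod_(0 <= i < n) P (xi 0%N @^-1` B i))%E.
Proof. by have [_ pxi] := xi_iid; exact: (pxi id). Qed.

Lemma measurable_cylinder n (B : nat -> set R) : (forall i, measurable (B i)) ->
  measurable [set w | forall i, (i < n)%N -> B i (xi i w)].
Proof.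
move=> mB; have [mxi _] := xi_iid.
rewrite (_ : mkset _ = \bigcap_(i in [set i | (i < n)%N]) (xi i @^-1` B i)).
  apply: bigcap_measurableType => i _.
  by rewrite -[X in measurable X]setTI; exact: mxi.
by apply/seteqP; split.
Qed.

Lemma iid_rearrange (s : nat -> nat) (F : seqspace R -> \bar R) :
  injective s -> measurable_fun setT F -> (forall e, 0 <= F e)%E ->
  (\int[P]_w F (fun i => xi (s i) w) = \int[P]_w F (fun i => xi i w))%E.
Proof.
move=> injs mF F0; have [mxi pxi] := xi_iid.
apply: (@law_unique _ _ _ _ _ P P (fun i => xi (s i)) xi F) => //.
- by rewrite (le_lt_trans (probability_le1 _ _))// ltry.
- by move=> n B mB; apply: (etrans (pxi s injs n B mB)); exact/esym/iid_cylinder.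
Qed.

(** Increments from index [k] on may be drawn from an independent copy, with their numbering
    restarted at 0. Both sequences have the same cylinder probabilities, and Tonelli separates the
    two copies. *)
Lemma iid_split k (F : seqspace R -> \bar R) :
  measurable_fun setT F -> (forall e, 0 <= F e)%E ->
  (\int[P]_w F (fun i => xi i w) = \int[P]_w \int[P]_w'
     F (fun i => if (i < k)%N then xi i w else xi (i - k)%N w'))%E.
Proof.
move=> mF F0; have [mxi pxi] := xi_iid.
pose eta i (p : T * T) := if (i < k)%N then xi i p.1 else xi (i - k)%N p.2.
have meta i : measurable_fun setT (eta i).
  rewrite /eta; case: (i < k)%N.
    exact: (measurableT_comp (mxi _) measurable_fst).
  exact: (measurableT_comp (mxi _) measurable_snd).
transitivity (\int[P \x P]_p F (fun i => eta i p))%E; last first.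
  rewrite (fubini_tonelli1 (m1 := P) (m2 := P) (fun p => F (fun i => eta i p)))//.
  exact: (measurableT_comp mF (measurable_seqmap meta)).
apply: (@law_unique _ _ _ _ _ P (P \x P)%E xi eta F) => //.
  by rewrite (le_lt_trans (probability_le1 _ _))// ltry.
move=> n B mB.
apply: (etrans (iid_cylinder _ mB)).
have -> : [set p : T * T | forall i, (i < n)%N -> B i (eta i p)] =
   [set w | forall i, (i < minn k n)%N -> B i (xi i w)] `*`
   [set w | forall i, (i < n - k)%N -> B (i + k)%N (xi i w)].
  apply/seteqP; split => [[w w'] H|[w w'] /= [H1 H2] i iN] /=.
    split=> i.
      by rewrite leq_min => /andP[ik iN]; have := H i iN; rewrite /eta/= ik.
    move=> ik; have := H (i + k)%N; rewrite /eta [(i + k < k)%N]ltnNge leq_addl/= addnK.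
    by apply; rewrite addnC -ltn_subRL.
  rewrite /eta/=; case: ltnP => ik; first by apply: H1; rewrite leq_min ik.
  by have := H2 (i - k)%N; rewrite subnK//; apply; rewrite ltn_sub2r// (leq_ltn_trans ik).
set A := [set w | _]; set A' := [set w | _].
have mA : measurable A by exact: measurable_cylinder.
have mA' : measurable A' by exact: (@measurable_cylinder _ (fun i => B (i + k)%N)).
apply: (etrans _ (esym (product_measure1E P P mA mA'))).
have mBk i : measurable (B (i + k)%N) by [].
apply: (etrans _ (esym (f_equal2 (fun x y => x * y)%E
  (iid_cylinder (minn k n) mB) (iid_cylinder (n - k) mBk)))) => /=.
have [nk|kn] := leqP n k.
  by rewrite (eqP nk) [X in (_ * X)%E]big_nil mule1.
rewrite (@big_cat_nat _ _ _ k)//=; last exact: ltnW.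
by rewrite -{2}[k]add0n big_addn.
Qed.

End IID.

(** * Spitzer's recursion from the Rota-Baxter identity *)

Section Spitzer.
Context {d : measure_display} {T : measurableType d} {R : realType}.
Variable P : probability T R.
Variables (xi : nat -> T -> R) (xi_iid : iid P xi).

Section Expectation.
Variables (g : R -> R) (mg : measurable_fun setT g) (g01 : forall y, 0 <= g y <= 1).

Definition Eg (F : (nat -> R) -> R) : R :=
  fine (\int[P]_w (g (F (fun i => xi i w)))%:E)%E.

Let mxi (F : seqspace R -> R) : measurable_fun setT F ->
  measurable_fun setT (fun w => (g (F (fun i => xi i w)))%:E).
Proof.
move=> mF; apply/measurable_EFinP; apply: (measurableT_comp mg).
apply: (measurableT_comp mF); apply: measurable_seqmap; exact: (proj1 xi_iid).
Qed.

Let int01 (F : seqspace R -> R) : measurable_fun setT F ->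
  (\int[P]_w (g (F (fun i => xi i w)))%:E)%E \is a fin_num.
Proof.
move=> mF; rewrite ge0_fin_numE; last first.
  by apply: integral_ge0 => w _; rewrite lee_fin; case/andP: (g01 (F (fun i => xi i w))).
apply: (@le_lt_trans _ _ (\int[P]_w 1%:E)%E); last first.
  by rewrite integral_cst//= mul1e (le_lt_trans (probability_le1 P measurableT))// ltry.
apply: ge0_le_integral => //.
- by move=> w _; rewrite lee_fin; case/andP: (g01 (F (fun i => xi i w))).
- exact: mxi.
- by move=> w _; rewrite lee_fin; case/andP: (g01 (F (fun i => xi i w))).
Qed.

Lemma Eg_add (F1 F2 F3 F4 : seqspace R -> R) :
  measurable_fun setT F1 -> measurable_fun setT F2 ->
  measurable_fun setT F3 -> measurable_fun setT F4 ->
  (forall e, g (F1 e) + g (F2 e) = g (F3 e) + g (F4 e)) ->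
  Eg F1 + Eg F2 = Eg F3 + Eg F4.
Proof.
move=> m1 m2 m3 m4 FE; rewrite /Eg -!fineD//; try exact: int01.
have g0 y : (0%:E <= (g y)%:E)%E by rewrite lee_fin; case/andP: (g01 y).
congr fine; rewrite -!ge0_integralD//; try exact: mxi.
by apply: eq_integral => w _; rewrite -!EFinD FE.
Qed.

Lemma Eg_rearrange (s : nat -> nat) (F F' : seqspace R -> R) :
  injective s -> measurable_fun setT F ->
  (forall e, F' e = F (fun i => e (s i))) -> Eg F' = Eg F.
Proof.
move=> injs mF FF'; rewrite /Eg; congr fine.
under eq_integral do rewrite FF'.
apply: (iid_rearrange xi_iid (F := fun e => (g (F e))%:E)) => //.
  by apply/measurable_EFinP; exact: (measurableT_comp mg).
by move=> e; rewrite lee_fin; case/andP: (g01 (F e)).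
Qed.

(** The three ways of combining a sum of [k] increments with the minimum of a later stretch, each
    preceded by [i] further increments: projecting before adding, after adding, or both. [block] is
    the summand of the recursion, while [cross] telescopes and [cycle] is a rearranged [block]. *)
Let block i k m e := lift_min i (Num.min (psum i k e) 0 + lmin (i + k) m e) e : R.
Let cross i k m e := lift_min i (Num.min (psum i k e + lmin (i + k) m e) 0) e : R.
Let cycle i k m e :=
  lift_min i (Num.min (Num.min (psum i k e) 0 + (e (i + k)%N + lmin (i + k).+1 m e)) 0) e : R.

Let mblock i k m : measurable_fun setT (block i k m : seqspace R -> R).
Proof.
apply: (@measurable_lift_min R i (fun e => Num.min (psum i k e) 0 + lmin (i + k) m e)).
apply: measurable_funD; last exact: measurable_lmin.
by apply: measurable_min0; exact: measurable_psum.
Qed.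

Let mcross i k m : measurable_fun setT (cross i k m : seqspace R -> R).
Proof.
apply: (@measurable_lift_min R i (fun e => Num.min (psum i k e + lmin (i + k) m e) 0)).
apply: measurable_min0; apply: measurable_funD; last exact: measurable_lmin.
exact: measurable_psum.
Qed.

Let mcycle i k m : measurable_fun setT (cycle i k m : seqspace R -> R).
Proof.
apply: (@measurable_lift_min R i (fun e => Num.min (Num.min (psum i k e) 0 +
  (e (i + k)%N + lmin (i + k).+1 m e)) 0)).
apply: measurable_min0; apply: measurable_funD.
  by apply: measurable_min0; exact: measurable_psum.
apply: measurable_funD; [exact: measurable_coord|exact: measurable_lmin].
Qed.

(* The Rota-Baxter identity of the projection x |-> min x 0. *)
Let Eg_rota_baxter i k m :
  Eg (block i k m.+1) + Eg (cross i k.+1 m) = Eg (cycle i k m) + Eg (cross i k m.+1).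
Proof.
apply: Eg_add; [exact: mblock|exact: mcross|exact: mcycle|exact: mcross|].
(* In each of the four sign cases the two unordered pairs of arguments of [lift_min] coincide, not
   merely their sums. The identity therefore survives [lift_min] and an arbitrary [g]. *)
move=> e; rewrite /block /cross /cycle psumSr addnS /=.
set x := psum i k e; set y := e _ + lmin _ _ _.
rewrite -[x + _ + _]addrA -/y.
have [x0|x0] := leP x 0; have [y0|y0] := leP y 0.
- have xy : x + y <= 0 by lra.
  by rewrite (min_l xy).
- by rewrite !addr0 (min_l x0) [LHS]addrC.
- by rewrite !add0r (min_l y0).
- have xy : 0 <= x + y by lra.
  by rewrite !add0r !addr0 (min_r xy) (min_r (ltW y0)) (min_r (ltW x0)).
Qed.

(* The increments i, ..., i + k are permuted cyclically. *)
Let Eg_cycle i k m : Eg (block i.+1 k m) = Eg (cycle i k m).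
Proof.
pose s j := if (i <= j < i + k)%N then j.+1 else if j == (i + k)%N then i else j.
apply: (@Eg_rearrange s).
- by rewrite /s => a b; do ![case: ifP]; lia.
- exact: mcycle.
- move=> e; rewrite /block /cycle /=.
  rewrite (_ : s (i + k)%N = i); last by rewrite /s eqxx; case: ifP => //; lia.
  rewrite (@eq_psum _ i.+1 k i e (fun j => e (s j))); last first.
    by move=> j jk; congr e; rewrite /s ifT; lia.
  rewrite (@eq_lmin _ (i + k).+1 m (i + k).+1 (fun j => e (s j)) e); last first.
    by move=> j jm; congr e; rewrite /s; do ![case: ifP]; lia.
  rewrite (@eq_lift_min _ i _ (fun j => e (s j)) e); last first.
    by move=> j ji; congr e; rewrite /s; do ![case: ifP]; lia.
  by rewrite addrCA addSn.
Qed.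

(** Induction on [n] for all [i], moving one increment into the prefix. The Rota-Baxter identity and
    a cyclic shift turn [block i k] into [block i.+1 k] plus a difference of [cross] terms. Their
    telescoped sum leaves the missing copy of the minimum at one end and the missing last block at
    the other. *)
Let Eg_spitzer n i : n%:R * Eg (lmin 0 (i + n)) = \sum_(1 <= k < n.+1) Eg (block i k (n - k)).
Proof.
elim: n i => [|n IH] i; first by rewrite mul0r big_geq.
rewrite big_nat_recr//= subnn.
have -> : \sum_(1 <= k < n.+1) Eg (block i k (n.+1 - k)) =
    \sum_(1 <= k < n.+1) (Eg (block i.+1 k (n - k)) +
      (Eg (cross i k (n.+1 - k)) - Eg (cross i k.+1 (n.+1 - k.+1)))).
  apply: eq_big_nat => k /andP[k1 kn].
  by rewrite Eg_cycle subSS subSn// addrA -Eg_rota_baxter addrK.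
rewrite big_split/= -IH.
have -> : \sum_(1 <= k < n.+1) (Eg (cross i k (n.+1 - k)) - Eg (cross i k.+1 (n.+1 - k.+1)))
    = Eg (cross i 1 n) - Eg (cross i n.+1 0).
  rewrite -[LHS]opprK -sumrN.
  under eq_bigr do rewrite opprB.
  rewrite (telescope_sumr (fun k => Eg (cross i k (n.+1 - k))))//.
  by rewrite subnn subn1 opprB.
have -> : cross i 1 n = lmin 0 (i + n.+1).
  apply/funext => e; rewrite /cross psumSl psum0 addr0 addn1 -lift_min_lmin.
  by [].
have -> : cross i n.+1 0 = block i n.+1 0.
  by apply/funext => e; rewrite /cross /block /= !addr0.
by rewrite -addSnnS -[n.+1%:R]natr1 mulrDl mul1r; ring.
Qed.

Lemma spitzer_expectation n : n%:R * Eg (lmin 0 n) =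
  \sum_(1 <= k < n.+1) Eg (fun e => Num.min (psum 0 k e) 0 + lmin k (n - k) e).
Proof. by have := Eg_spitzer n 0. Qed.

End Expectation.
End Spitzer.

Section LimitBounds.
Context {R : realType} {I : Type} (F : set_system I) {FF : ProperFilter F}.

Lemma cvg_le_cst (f : I -> R) (l c : R) : f @ F --> l ->
  (\forall t \near F, f t <= c) -> l <= c.
Proof.
move=> fl fc; rewrite -(cvg_lim (@Rhausdorff R) fl); apply: limr_le => //.
by apply/cvg_ex; exists l.
Qed.

Lemma cvg_ge_cst (f : I -> R) (l c : R) : f @ F --> l ->
  (\forall t \near F, c <= f t) -> c <= l.
Proof.
move=> fl fc; rewrite -(cvg_lim (@Rhausdorff R) fl); apply: limr_ge => //.
by apply/cvg_ex; exists l.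
Qed.

End LimitBounds.

Section BoundedExpectation.
Context {d : measure_display} {T : measurableType d} {R : realType}.
Variable P : probability T R.

Lemma bounded_integrable (U : T -> R) (C : R) : measurable_fun setT U ->
  (forall w, `|U w| <= C) -> P.-integrable setT (EFin \o U).
Proof.
move=> mU UC; apply: measurable_bounded_integrable => //.
  by rewrite (le_lt_trans (probability_le1 P measurableT))// ltry.
by exists C; split; [exact: num_real|move=> y Cy w _; exact: le_trans (UC w) (ltW Cy)].
Qed.

Lemma le_Rintegral_bounded (U V : T -> R) (C : R) :
  measurable_fun setT U -> measurable_fun setT V ->
  (forall w, `|U w| <= C) -> (forall w, `|V w| <= C) ->
  (forall w, U w <= V w) -> \int[P]_w U w <= \int[P]_w V w.
Proof.
by move=> mU mV UC VC UV; apply: le_Rintegral => //; exact: bounded_integrable.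
Qed.

Lemma Rintegral_bounded_cvg (U_ : nat -> T -> R) (U : T -> R) (C : R) :
  (forall n, measurable_fun setT (U_ n)) -> measurable_fun setT U ->
  (\forall n \near \oo, forall w, `|U_ n w| <= C) ->
  (forall w, U_ n w @[n --> \oo] --> U w) ->
  \int[P]_w U_ n w @[n --> \oo] --> \int[P]_w U w.
Proof.
move=> mU_ mU /near_infty_ex[N UC] UU.
have UCl w : `|U w| <= C.
  have : `|U_ n w| @[n --> \oo] --> `|U w| by exact: cvg_norm.
  move=> /cvg_le_cst; apply => //; exists N => // n /= Nn; exact: UC.
have iU : P.-integrable setT (EFin \o U) by exact: bounded_integrable UCl.
rewrite -(cvg_shiftn N).
apply: fine_cvg; rewrite fineK; last exact: integrable_fin_num.
have iC : P.-integrable setT (cst C%:E).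
  by apply: (@bounded_integrable (cst C) `|C|).
have m_ n : measurable_fun setT (fun w => (U_ (n + N)%N w)%:E).
  by apply/measurable_EFinP.
have m0 : measurable_fun setT (fun w => (U w)%:E) by apply/measurable_EFinP.
have cU : \forall w \ae P, setT w -> (U_ (n + N)%N w)%:E @[n --> \oo] --> (U w)%:E.
  apply: aeW => w _; apply: cvg_EFin; first by near=> n.
  by rewrite (cvg_shiftn N (fun n => U_ n w)); exact: UU.
have bU : \forall w \ae P, forall n, setT w ->
    (`|(U_ (n + N)%N w)%:E| <= cst C%:E w)%E.
  by apply: aeW => w n _; rewrite lee_fin UC// leq_addl.
by have [] := dominated_convergence measurableT m_ m0 cU iC bU.
Unshelve. all: by end_near. Qed.

Lemma Rintegral_if (b : T -> bool) : measurable [set w | b w] ->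
  \int[P]_w (if b w then 1 else 0) = fine (P [set w | b w]).
Proof.
move=> mb; rewrite /Rintegral; congr fine.
rewrite -[[set w | b w] in RHS]setIT -(integral_indic P measurableT mb); apply: eq_integral => w _.
rewrite indicE; case: ifPn => bw; first by rewrite mem_set.
by rewrite memNset// => /= ; apply/negP.
Qed.

Lemma fine_probability_le (A B : set T) : measurable A -> measurable B ->
  A `<=` B -> fine (P A) <= fine (P B).
Proof.
move=> mA mB AB; apply: fine_le; try exact: fin_num_measure.
by apply: le_measure => //; rewrite inE.
Qed.

Lemma measurable_ge (Y : T -> R) (y : R) : measurable_fun setT Y ->
  measurable [set w | y <= Y w].
Proof.
move=> mY; rewrite -[X in measurable X]setTI.
by have := mY measurableT `[y, +oo[%classic (measurable_itv _);
  rewrite (_ : _ @^-1` _ = [set w | y <= Y w])//; apply/seteqP; split => w /=;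
  rewrite in_itv/= andbT.
Qed.

Lemma prob_ge_ge0 (Y : T -> R) y : 0 <= prob_ge P Y y.
Proof. exact: fine_ge0. Qed.

Lemma prob_ge_le1 (Y : T -> R) y : measurable_fun setT Y -> prob_ge P Y y <= 1.
Proof.
move=> mY; rewrite -lee_fin fineK; last first.
  by apply: fin_num_measure; exact: measurable_ge.
by apply: probability_le1; exact: measurable_ge.
Qed.

Lemma prob_ge_nonincreasing (Y : T -> R) y z : measurable_fun setT Y ->
  y <= z -> prob_ge P Y z <= prob_ge P Y y.
Proof.
move=> mY yz; apply: fine_probability_le; try exact: measurable_ge.
by move=> w /=; exact: le_trans.
Qed.

Lemma measurable_prob_ge (Y : T -> R) : measurable_fun setT Y ->
  measurable_fun setT (prob_ge P Y).
Proof.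
by move=> mY; apply: nonincreasing_measurable => // y z; exact: prob_ge_nonincreasing.
Qed.

End BoundedExpectation.

(** * Survival probabilities of an i.i.d. walk *)

Section Survival.
Context {d : measure_display} {T : measurableType d} {R : realType}.
Variable P : probability T R.
Variables (xi : nat -> T -> R) (xi_iid : iid P xi).

Let S k w := psum 0 k (fun i => xi i w).
Let Z k w := lmin 0 k (fun i => xi i w).

Let mS k : measurable_fun setT (S k).
Proof.
apply: (measurableT_comp (measurable_psum 0 k)).
by apply: measurable_seqmap; case: xi_iid.
Qed.

Let mZ k : measurable_fun setT (Z k).
Proof.
apply: (measurableT_comp (measurable_lmin 0 k)).
by apply: measurable_seqmap; case: xi_iid.
Qed.

Let Z0 k w : Z k w <= 0. Proof. exact: lmin_le0. Qed.

Definition spitzer_kernel (x : R) k j : R :=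
  \int[P]_w (if - x <= Z j w then prob_ge P (S k) (- x - Z j w) else 0).

Lemma measurable_if_ge (x : R) (Y : T -> R) (h : R -> R) :
  measurable_fun setT Y -> measurable_fun setT h ->
  measurable_fun setT (fun w => if x <= Y w then h (Y w) else 0).
Proof.
move=> mY mh; apply: measurable_fun_ifT => //.
- apply: (measurable_fun_bool true) => /=.
  rewrite setTI (_ : _ @^-1` _ = [set w | x <= Y w])//; exact: measurable_ge.
- exact: (measurableT_comp mh mY).
Qed.

(** The recursion for the indicator of [[-x, +oo[]. A sum [min(S, 0) + z] is at least [-x] exactly
    when [z >= -x] and [S >= -x - z]; independence of the two stretches then integrates [S] out
    first. *)
Lemma spitzer_survival (x : R) n :
  n%:R * fine (P [set w | - x <= Z n w]) =
  \sum_(1 <= k < n.+1) spitzer_kernel x k (n - k)%N.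
Proof.
pose g (y : R) : R := if - x <= y then 1 else 0.
have mg : measurable_fun setT g.
  apply: nondecreasing_measurable => // y z yz; rewrite /g.
  case: ifPn => [xy|_]; first by rewrite (le_trans xy yz).
  by case: ifP.
have g01 y : 0 <= g y <= 1 by rewrite /g; case: ifP; rewrite ?lexx ler01.
have := spitzer_expectation xi_iid mg g01 n.
rewrite {1}/Eg -/(Rintegral _ _ _) Rintegral_if; last exact: (measurable_ge _ (mZ n)).
move=> ->; apply: eq_big_nat => k /andP[k1 kn].
rewrite /Eg /spitzer_kernel; congr fine.
pose F e : R := Num.min (psum 0 k e) 0 + lmin k (n - k) e.
have mF : measurable_fun setT (F : seqspace R -> R).
  apply: measurable_funD; last exact: measurable_lmin.
  by apply: measurable_min0; exact: measurable_psum.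
rewrite (iid_split xi_iid k (F := fun e => (g (F e))%:E)); last 2 first.
- by apply/measurable_EFinP; exact: (measurableT_comp mg).
- by move=> e; rewrite lee_fin; case/andP: (g01 (F e)).
transitivity (\int[P]_w \int[P]_w' (g (Num.min (S k w) 0 + Z (n - k) w'))%:E)%E.
  apply: eq_integral => w _; apply: eq_integral => w' _; congr (g (_ + _))%:E.
    by congr (Num.min _ 0); apply: eq_psum => j jk; rewrite !add0n jk.
  by apply: eq_lmin => j jn; rewrite ltnNge leq_addr/= addKn.
rewrite (@fubini_tonelli _ _ _ _ _ P P
  (fun p => (g (Num.min (S k p.1) 0 + Z (n - k) p.2))%:E)); last 2 first.
- apply/measurable_EFinP; apply: (measurableT_comp mg); apply: measurable_funD.
    by apply: measurable_min0; exact: (measurableT_comp (mS k) measurable_fst).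
  exact: (measurableT_comp (mZ _) measurable_snd).
- by move=> p; rewrite lee_fin; case/andP: (g01 (Num.min (S k p.1) 0 + Z (n - k) p.2)).
apply: eq_integral => w' _ /=.
case: ifPn => [xz|xz].
  rewrite /prob_ge -Rintegral_if; last exact: (measurable_ge _ (mS k)).
  rewrite /Rintegral fineK.
    apply: eq_integral => w _; congr (_%:E); rewrite /g lerBlDr.
    congr (if _ then _ else _); case: (leP (S k w) 0) => [//|s0].
    by rewrite add0r xz; apply/esym/(le_trans xz); rewrite lerDr ltW.
  apply: integrable_fin_num => //; apply: (@bounded_integrable _ _ _ P _ 1).
    apply: measurable_fun_ifT => //; apply: (measurable_fun_bool true) => /=.
    rewrite setTI (_ : _ @^-1` _ = [set w | - x - Z (n - k) w' <= S k w])//.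
    exact: (measurable_ge _ (mS k)).
  by move=> w; case: ifP; rewrite ?normr1 ?normr0 ?ler01.
rewrite integral0_eq// => w _; rewrite /g ifF//; apply/negbTE.
by move: xz; rewrite -!ltNge; apply: le_lt_trans; rewrite gerDr ge_min lexx orbT.
Qed.

End Survival.

Section SurvivalAsymptotics.
Context {d : measure_display} {T : measurableType d} {R : realType}.
Variable P : probability T R.
Variables (xi : nat -> T -> R) (xi_iid : iid P xi).

Let S k w := psum 0 k (fun i => xi i w).
Let Z k w := lmin 0 k (fun i => xi i w).

Lemma measurable_walk k : measurable_fun setT (S k).
Proof.
apply: (measurableT_comp (measurable_psum 0 k)).
by apply: measurable_seqmap; case: xi_iid.
Qed.

Lemma measurable_walk_min k : measurable_fun setT (Z k).
Proof.
apply: (measurableT_comp (measurable_lmin 0 k)).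
by apply: measurable_seqmap; case: xi_iid.
Qed.

Let mS := measurable_walk. Let mZ := measurable_walk_min.
Let Z0 k w : Z k w <= 0. Proof. exact: lmin_le0. Qed.

Definition walk_trunc_moment (alpha x : R) j : R :=
  \int[P]_w (if - x <= Z j w then expR (alpha * Z j w) else 0).

Lemma expR_trunc_bound (alpha x z : R) : 0 <= alpha -> z <= 0 ->
  `|if - x <= z then expR (alpha * z) else 0| <= 1.
Proof.
move=> a0 z0; case: ifP => _; last by rewrite normr0.
by rewrite ger0_norm ?expR_ge0// -expR0 ler_expR mulr_ge0_le0.
Qed.

(** The limit of the kernel for a fixed [j] follows by dominated convergence: on [Z_j >= -x] the
    level [-x - Z_j] lies in [[-x, 0]], so the tail at [-x], divided by the tail at 0, dominates for
    large [k]. *)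
Lemma iid_survival_asymptotics (g alpha x : R) : 0 <= x -> 0 <= alpha ->
  let a := complete0 (fun n => prob_ge P (S n) 0 / n%:R) in
  (\forall n \near \oo, 0 < a n) ->
  (a n / a n.+1) @[n --> \oo] --> expR g ->
  conv_tail_negligible a ->
  (forall y, prob_ge P (S n) y / prob_ge P (S n) 0 @[n --> \oo]
     --> expR (- (alpha * y))) ->
  exists V : R,
    [series expR (g * j%:R) * (expR (alpha * x) * walk_trunc_moment alpha x j)]_j
      @ \oo --> V /\
    fine (P [set w | - x <= Z n w]) / a n @[n --> \oo] --> V.
Proof.
move=> x0 alpha0 a a_gt0 ag atail pratio.
pose f n := fine (P [set w | - x <= Z n w]).
pose h k := prob_ge P (S k) (- x).
pose p k := prob_ge P (S k) 0.
have kap k : (0 < k)%N -> k%:R * a k = p k.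
  rewrite /a /complete0 /p => k0; rewrite ifF; last by case: k k0.
  by rewrite mulrC divfK// pnatr_eq0 -lt0n.
have p_gt0 : \forall n \near \oo, (0 < n)%N /\ 0 < p n.
  have n0 := nbhs_infty_gt 0; apply: filterS2 a_gt0 n0 => n an n0; split=> //.
  by rewrite -kap// mulr_gt0// ltr0n.
apply: (@spitzer_asymptotics _ a f h _ (spitzer_kernel P xi x) g) => //.
- move=> n; rewrite fine_ge0//=; apply: (prob_ge_le1 P (- x) (mZ n)).
- by move=> k; exact: prob_ge_ge0.
- move=> k j; apply/andP; split.
    apply: Rintegral_ge0 => w _; case: ifP => // _; exact: prob_ge_ge0.
  rewrite /f -(Rintegral_if P (measurable_ge _ (mZ j))).
  have mi : measurable_fun setT (fun w => if - x <= Z j w then 1 else 0 : R).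
    exact: (@measurable_if_ge _ _ _ (- x) (Z j) (cst 1)).
  have b1 w : `|(if - x <= Z j w then 1 else 0 : R)| <= 1.
    by case: ifP; rewrite ?normr1 ?normr0.
  rewrite -RintegralZl//; last exact: bounded_integrable b1.
  have hZ w : - x <= - x - Z j w by rewrite lerDl oppr_ge0.
  apply: (@le_Rintegral_bounded _ _ _ P _ _ 1).
  + apply: (@measurable_if_ge _ _ _ (- x) (Z j) ( fun z => prob_ge P (S k) (- x - z))) => //.
    apply: (measurableT_comp (measurable_prob_ge P (mS k))).
    by apply: measurable_funB.
  + by apply: measurable_funM.
  + move=> w; case: ifP => _; last by rewrite normr0.
    by rewrite ger0_norm ?prob_ge_ge0// (prob_ge_le1 P _ (mS k)).
  + move=> w; rewrite normrM -[leRHS]mulr1 ler_pM//.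
    by rewrite ger0_norm ?prob_ge_ge0// (prob_ge_le1 P _ (mS k)).
  + move=> w; case: ifP => _; last by rewrite mulr0.
    by rewrite mulr1; exact: (prob_ge_nonincreasing P (mS k) (hZ w)).
- exists (expR (- (alpha * - x)) + 1).
  have : \forall n \near \oo, h n / p n <= expR (- (alpha * - x)) + 1.
    by move/cvgr_le: (pratio (- x)) => /(_ (_ + 1)); apply; rewrite ltrDl.
  apply: filterS2 p_gt0 => n [n0 pn].
  by rewrite kap// ler_pdivrMr.
- move=> j.
  have mif k : measurable_fun setT
      (fun w => if - x <= Z j w then prob_ge P (S k) (- x - Z j w) / p k else 0).
    apply: (@measurable_if_ge _ _ _ (- x) (Z j) ( fun z => prob_ge P (S k) (- x - z) / p k)) => //.
    apply: measurable_funM => //.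
    apply: (measurableT_comp (measurable_prob_ge P (mS k))).
    by apply: measurable_funB.
  have lim_eq : expR (alpha * x) * walk_trunc_moment alpha x j =
      \int[P]_w (if - x <= Z j w then expR (- (alpha * (- x - Z j w))) else 0).
    rewrite -RintegralZl//; last first.
      apply: (@bounded_integrable _ _ _ P _ 1) => [|w]; last exact: expR_trunc_bound.
      apply: (@measurable_if_ge _ _ _ (- x) (Z j) ( fun z => expR (alpha * z))) => //.
      by apply: measurableT_comp => //; exact: measurable_funM.
    apply: eq_Rintegral => w _; case: ifP => _; last by rewrite mulr0.
    by rewrite -expRD; congr expR; ring.
  rewrite lim_eq.
  have conv : \int[P]_w (if - x <= Z j w then prob_ge P (S k) (- x - Z j w) / p k else 0)
      @[k --> \oo] -->
      \int[P]_w (if - x <= Z j w then expR (- (alpha * (- x - Z j w))) else 0).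
    apply: (@Rintegral_bounded_cvg _ _ _ _ _ _ (expR (- (alpha * - x)) + 1)) => //.
    + apply: (@measurable_if_ge _ _ _ (- x) (Z j) ( fun z => expR (- (alpha * (- x - z))))) => //.
      apply: measurableT_comp => //; apply: measurable_funN.
      by apply: measurable_funM => //; exact: measurable_funB.
    + have : \forall n \near \oo, h n / p n <= expR (- (alpha * - x)) + 1.
        by move/cvgr_le: (pratio (- x)) => /(_ (_ + 1)); apply; rewrite ltrDl.
      apply: filterS2 p_gt0 => n [n0 pn] hp w.
      case: ifP => _; last by rewrite normr0 addr_ge0// expR_ge0.
      rewrite ger0_norm; last by rewrite divr_ge0 ?prob_ge_ge0// ltW.
      apply: le_trans hp; rewrite ler_pM2r ?invr_gt0//.
      by apply: (prob_ge_nonincreasing P (mS n)); rewrite lerDl oppr_ge0.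
    + move=> w; case: ifP => _; [exact: pratio|exact: cvg_cst].
  apply: cvg_trans conv; apply: near_eq_cvg.
  apply: filterS p_gt0 => k [k0 pk].
  rewrite kap// /spitzer_kernel -RintegralZr//.
    by apply: eq_Rintegral => w _; case: ifP => //; rewrite mul0r.
  apply: (@bounded_integrable _ _ _ P _ 1).
    apply: (@measurable_if_ge _ _ _ (- x) (Z j) ( fun z => prob_ge P (S k) (- x - z))) => //.
    apply: (measurableT_comp (measurable_prob_ge P (mS k))).
    by apply: measurable_funB.
  move=> w; case: ifP => _; last by rewrite normr0.
  by rewrite ger0_norm ?prob_ge_ge0// (prob_ge_le1 P _ (mS k)).
- by move=> n; exact: spitzer_survival.
Qed.

End SurvivalAsymptotics.

(** * Random walks *)

Section TruncMoment.
Context {d : measure_display} {T : measurableType d} {R : realType}.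
Variable P : probability T R.
Variables (alpha x : R).
Hypothesis alpha0 : 0 <= alpha.

Definition trunc_moment (N : T -> R) : R :=
  \int[P]_w (if - x <= N w then expR (alpha * N w) else 0).

Lemma measurable_trunc (N : T -> R) : measurable_fun setT N ->
  measurable_fun setT (fun w => if - x <= N w then expR (alpha * N w) else 0).
Proof.
move=> mN; apply: (@measurable_if_ge _ _ _ (- x) N (fun z => expR (alpha * z))) => //.
by apply: measurableT_comp => //; exact: mulrl_measurable.
Qed.

Lemma le_trunc_moment (N N' : T -> R) : measurable_fun setT N ->
  measurable_fun setT N' -> (forall w, N' w <= 0) -> (forall w, N w <= N' w) ->
  trunc_moment N <= trunc_moment N'.
Proof.
move=> mN mN' N'0 NN'; apply: (@le_Rintegral_bounded _ _ _ P _ _ 1).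
- exact: measurable_trunc.
- exact: measurable_trunc.
- by move=> w; apply: expR_trunc_bound => //; exact: le_trans (NN' w) (N'0 w).
- by move=> w; exact: expR_trunc_bound.
- move=> w; case: ifPn => [xN|_]; last by case: ifP => // _; exact: expR_ge0.
  by rewrite (le_trans xN (NN' w)) ler_expR ler_wpM2l.
Qed.

Lemma trunc_moment_ge0 (N : T -> R) : 0 <= trunc_moment N.
Proof. by apply: Rintegral_ge0 => w _; case: ifP => // _; exact: expR_ge0. Qed.

Lemma trunc_moment_le1 (N : T -> R) : measurable_fun setT N ->
  (forall w, N w <= 0) -> trunc_moment N <= 1.
Proof.
move=> mN N0.
have -> : 1 = \int[P]_w (1 : R).
  rewrite Rintegral_cst// mul1r.
  by rewrite [X in fine X](_ : _ = 1%E)//; exact: probability_setT.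
apply: (@le_Rintegral_bounded _ _ _ P _ (cst 1) 1) => //.
- exact: measurable_trunc.
- by move=> w; exact: expR_trunc_bound.
- by move=> w; rewrite normr1.
- move=> w; rewrite (le_trans (ler_norm _))//; exact: expR_trunc_bound.
Qed.

Lemma trunc_exp_momentE (N : T -> R) : measurable_fun setT N ->
  (forall w, N w <= 0) -> trunc_exp_moment P alpha x N = (trunc_moment N)%:E.
Proof.
move=> mN N0; rewrite /trunc_exp_moment unlock /trunc_moment /Rintegral fineK; last first.
  apply: integrable_fin_num => //; apply: (@bounded_integrable _ _ _ P _ 1).
    exact: measurable_trunc.
  by move=> w; exact: expR_trunc_bound.
apply: eq_integral => w _ /=; rewrite indicE; congr (_%:E).
have [xN|xN] := leP (- x) _.
  by rewrite mem_set ?mulr1//= ler0_norm// lerNl.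
by rewrite memNset ?mulr0//= ler0_norm//; apply/negP; rewrite -ltNge ltrNr.
Qed.

(** The truncation jumps at [-x]. Approximation from above is what makes it harmless: [N >= -x]
    passes to every large [l], while the strict [N < -x] passes to large [l] by the last
    hypothesis. *)
Lemma trunc_moment_cvg (N_ : nat -> T -> R) (N : T -> R) :
  (forall l, measurable_fun setT (N_ l)) -> measurable_fun setT N ->
  (forall l w, N_ l w <= 0) -> (\forall l \near \oo, forall w, N w <= N_ l w) ->
  (forall w y, N w < y -> \forall l \near \oo, N_ l w < y) ->
  trunc_moment (N_ l) @[l --> \oo] --> trunc_moment N.
Proof.
move=> mN_ mN N_0 /near_infty_ex[l0 NN] lim.
apply: (@Rintegral_bounded_cvg _ _ _ _ _ _ 1).
- by move=> l; exact: measurable_trunc.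
- exact: measurable_trunc.
- by apply: nearW => l w; exact: expR_trunc_bound.
- move=> w; case: ifPn => [xN|]; last first.
    rewrite -ltNge => Nx; apply: cvg_near_cst.
    by apply: filterS (lim w _ Nx) => l; rewrite ltNge => /negbTE ->.
  have cN : N_ l w @[l --> \oo] --> N w.
    apply/cvgrPdist_le => e e0.
    have := lim w (N w + e); rewrite ltrDl => /(_ e0)/near_infty_ex[l1 H].
    apply/near_infty_ex; exists (l0 + l1)%N => l ll.
    have l0l : (l0 <= l)%N by exact: leq_trans (leq_addr _ _) ll.
    have l1l : (l1 <= l)%N by exact: leq_trans (leq_addl _ _) ll.
    by rewrite distrC ger0_norm ?subr_ge0 ?NN// lerBlDl ltW ?H.
  have c : expR (alpha * N_ l w) @[l --> \oo] --> expR (alpha * N w).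
    apply: continuous_cvg; first exact: continuous_expR.
    exact: cvgMr.
  apply: cvg_trans c; apply: near_eq_cvg; apply/near_infty_ex; exists l0 => l ll.
  by rewrite (le_trans xN (NN l ll w)).
Qed.

End TruncMoment.

Section EquivMul.
Context {R : realType} {I : Type} (F : set_system I) {FF : Filter F}.

Lemma equiv_mul_cvg (a b : I -> R) (V : \bar R) (v : R) : V = v%:E ->
  (\forall t \near F, 0 < b t) -> a t / b t @[t --> F] --> v ->
  equiv_mul F a V b.
Proof.
move=> -> b0 ab; split => //=; rewrite eqe.
have [v0|v0] := eqVneq v 0.
  apply/eqoP => e e0 /=; rewrite v0 in ab.
  move/cvgrPdist_le : ab => /(_ e e0); apply: filterS2 b0 => t bt.
  rewrite sub0r normrN normrM normfV ler_pdivrMr// normr_gt0 gt_eqF//.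
have c : (v^-1 * (a t / b t)) @[t --> F] --> (1 : R).
  rewrite -(mulVf v0); exact: cvgMr.
apply: cvg_trans c; apply: near_eq_cvg; apply: filterS b0 => t bt.
by field; rewrite v0 gt_eqF.
Qed.

End EquivMul.

Section WalkPaths.
Context {R : realType}.
Implicit Types u : nat -> R.

Lemma psum_increments u k : u 0%N = 0 ->
  psum 0 k (fun i => u i.+1 - u i) = u k.
Proof.
move=> u0; rewrite /psum (eq_bigr (fun i => u i.+1 - u i)); last by move=> i _; rewrite add0n.
by rewrite telescope_sumr// u0 subr0.
Qed.

Lemma le_lmin_increments u i k y : y <= lmin i k (fun j => u j.+1 - u j) <->
  y <= 0 /\ forall l, (l <= k)%N -> y <= u (i + l)%N - u i.
Proof.
elim: k i y => [|k IH] i y /=.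
  split=> [y0|[]//]; split=> // l; rewrite leqn0 => /eqP ->.
  by rewrite addn0 subrr.
rewrite le_min; split.
  move=> /andP[]; rewrite -lerBlDl => /IH[_ H] y0; split => // -[|l] lk.
    by rewrite addn0 subrr.
  by have := H l lk; rewrite addSnnS; lra.
move=> [y0 H]; rewrite y0 andbT -lerBlDl; apply/IH; split.
  by have := H 1%N isT; rewrite addn1; lra.
by move=> l lk; have := H l.+1 lk; rewrite addSnnS; lra.
Qed.

Lemma le_bigmin_nat0 u k y : u 0%N = 0 ->
  y <= \big[Num.min/u 0%N]_(0 <= l < k.+1) u l <->
  forall l, (l <= k)%N -> y <= u l.
Proof.
move=> u0; rewrite big_mkord; split=> [/bigmin_geP[_ H] l lk|H].
  exact: (H (Ordinal (lk : (l < k.+1)%N)) isT).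
by apply/bigmin_geP; split => [|[l lk] _]; apply: H.
Qed.

Lemma lmin_increments u k : u 0%N = 0 ->
  lmin 0 k (fun i => u i.+1 - u i) = \big[Num.min/u 0%N]_(0 <= l < k.+1) u l.
Proof.
move=> u0; apply/eqP; rewrite eq_le; apply/andP; split.
  apply/(le_bigmin_nat0 _ _ u0) => l lk.
  have [_ /(_ l lk)] := iffLR (le_lmin_increments u 0 k _) (lexx _).
  by rewrite u0 subr0 add0n.
apply/le_lmin_increments.
have H := iffLR (le_bigmin_nat0 k _ u0) (lexx _).
split; first by rewrite -[leRHS]u0; exact: (H 0%N isT).
by move=> l lk; rewrite add0n [X in _ - X]u0 subr0; exact: H.
Qed.

End WalkPaths.

Section RandomWalk.
Context {d : measure_display} {T : measurableType d} {R : realType}.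
Variable P : probability T R.
Variables (X : nat -> {RV P >-> R}) (Xrw : random_walk X).

Let xi n w := X n.+1 w - X n w.

Lemma random_walk_iid : iid P xi.
Proof.
have [X0 indep law] := Xrw.
have mxi i : measurable_fun setT (xi i) by apply: measurable_funB.
split => // s injs n B mB.
pose ss := map s (iota 0 n).
(* Independence is stated for sets indexed by the increments themselves; [B'] carries the sets along
   [s]. *)
pose B' j := B (index j ss).
have iss i : (i < n)%N -> index (s i) ss = i.
  by move=> ilt; rewrite /ss index_map// -{1}[i](add0n) -(nth_iota 0 0 ilt) index_uniq ?size_iota ?iota_uniq.
rewrite (_ : mkset _ = \bigcap_(j in [set` ss]) (xi j @^-1` B' j)); last first.
  apply/seteqP; split => w /=.
    move=> H j /= /mapP[i]; rewrite mem_iota add0n /= => ilt ->.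
    by rewrite /B' iss//; exact: H.
  move=> H i ilt; have := H (s i); rewrite /B' /= iss//; apply.
  by apply: map_f; rewrite mem_iota.
have uss : uniq ss by rewrite map_inj_uniq// iota_uniq.
have mB' i : measurable (B' i) by exact: mB.
rewrite indep//.
rewrite big_map /index_iota subn0 big_seq [RHS]big_seq; apply: eq_bigr => i.
rewrite mem_iota add0n /= => ilt; rewrite /B' iss//.
rewrite law//.
Qed.

Lemma walk_psum k w : psum 0 k (fun i => xi i w) = X k w.
Proof.
by have [X0 _ _] := Xrw; rewrite /xi (psum_increments (u := fun i => X i w)).
Qed.

Lemma walk_lmin k w : lmin 0 k (fun i => xi i w) = running_min (fun n => X n) k w.
Proof.
by have [X0 _ _] := Xrw; rewrite /xi (lmin_increments (u := fun i => X i w)).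
Qed.

Lemma le_running_min x k w :
  - x <= running_min (fun n => X n) k w <-> forall l, (l <= k)%N -> - x <= X l w.
Proof.
have [X0 _ _] := Xrw; rewrite /running_min.
by rewrite (le_bigmin_nat0 (u := fun i => X i w)).
Qed.

(** Exit times start at 1 whereas the minimum includes time 0; since the walk starts at 0 and
    [0 <= x], time 0 is harmless. *)
Lemma lt_exit_time_rw x n w : 0 <= x ->
  (n%:R%:E < exit_time_rw (fun n => X n) x w)%E = (- x <= lmin 0 n (fun i => xi i w)).
Proof.
move=> x0; rewrite walk_lmin; apply/idP/idP.
  move=> nv; apply/le_running_min => l ln; rewrite leNgt; apply/negP => Xl.
  have : (exit_time_rw (fun n => X n) x w <= l%:R%:E)%E.
    apply: ereal_inf_lbound; exists l => //; split => //.
    rewrite lt0n; apply/eqP => l0; move: Xl; rewrite l0.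
    by have [X0 _ _] := Xrw; rewrite X0 ltNge oppr_le0 x0.
  by move=> /(lt_le_trans nv); rewrite lte_fin ltr_nat ltnNge ln.
move=> /le_running_min H.
apply: (@lt_le_trans _ _ n.+1%:R%:E); first by rewrite lte_fin ltr_nat.
apply/ereal_infP => _ [m [m1 Xm] <-]; rewrite lee_fin ler_nat ltnNge.
by apply/negP => mn; move: Xm; rewrite ltNge H.
Qed.

(** A nonnegative integer-valued time is the number of integers below it. This rewrites the constant
    of the case [gamma = alpha = 0] as the general series. *)
Lemma exit_time_rw_series x w : 0 <= x ->
  exit_time_rw (fun n => X n) x w =
  (\sum_(0 <= n <oo) (if - x <= lmin 0 n (fun i => xi i w) then 1 else 0)%:E)%E.
Proof.
move=> x0; pose b n := - x <= lmin 0 n (fun i => xi i w).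
have bP n : b n <-> forall l, (l <= n)%N -> - x <= X l w.
  by rewrite /b walk_lmin; exact: le_running_min.
have [H|nH] := pselect (forall n, b n); last first.
  have [m /negP bm] := iffRL (existsNP b) nH.
  have ex : exists n, ~~ b n by exists m.
  pose N := ex_minn ex.
  have [bN Nmin] : ~~ b N /\ forall n, ~~ b n -> (N <= n)%N.
    by rewrite /N; case: ex_minnP.
  rewrite (nneseries_split 0 N); last by move=> k _; rewrite lee_fin; case: ifP.
  rewrite add0n (eq_big_nat _ _ (F2 := fun=> 1%:E)); last first.
    move=> i /andP[_ iN]; have : b i by apply: contraTT iN => /Nmin; rewrite -leqNgt.
    by rewrite /b => ->.
  rewrite eseries0 ?adde0; last first.
    move=> i Ni _; rewrite ifF//; apply/negbTE; move: bN; apply: contra.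
    move=> bi; apply/bP => l lN; apply: (iffLR (bP i) bi).
    exact: leq_trans Ni.
  rewrite sumEFin sumr_const_nat subn0.
  apply/eqP; rewrite eq_le; apply/andP; split; last first.
    case: N bN Nmin => [|N'] bN Nmin.
      apply/ereal_infP => _ [k [k1 _] <-]; by rewrite lee_fin.
    have : (N'%:R%:E < exit_time_rw (fun n => X n) x w)%E.
      rewrite lt_exit_time_rw//; apply/negPn/negP => /Nmin; by rewrite ltnn.
    move=> NE; apply/ereal_infP => _ [k [k1 Xk] <-].
    rewrite lee_fin ler_nat -(@ltr_nat R) -lte_fin (lt_le_trans NE)//.
    by apply: ereal_inf_lbound; exists k.
  move: bN; rewrite /b -lt_exit_time_rw//; first last.
  by rewrite -leNgt.
rewrite (_ : exit_time_rw _ _ _ = +oo%E); last first.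
  rewrite /exit_time_rw (_ : [set _ | _ in _] = set0) ?ereal_inf0//.
  apply/seteqP; split => // y [k [k1 Xk] _].
  by move: Xk; rewrite ltNge (iffLR (bP k) (H k) k).
apply/esym/cvg_lim => //; rewrite (_ : (fun n => _) = (fun n => n%:R%:E)).
  by apply/cvgenyP.
apply/funext => n; rewrite (eq_bigr (fun=> 1%:E)); last first.
  by move=> i _; have := H i; rewrite /b => ->.
by rewrite sumEFin sumr_const_nat subn0.
Qed.

End RandomWalk.

Section RandomWalkTheorem.
Context {d : measure_display} {T : measurableType d} {R : realType}.
Variable P : probability T R.

Lemma near_complete0 (b : nat -> R) (Q : nat -> R -> Prop) :
  (\forall n \near \oo, Q n (complete0 b n)) -> \forall n \near \oo, Q n (b n).
Proof.
have n0 := nbhs_infty_gt 0 => H; near=> n.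
have n0' : (0 < n)%N by near: n.
have : Q n (complete0 b n) by near: n.
by rewrite /complete0 ifF//; apply/eqP => n00; rewrite n00 in n0'.
Unshelve. all: by end_near. Qed.

Lemma tail_ratio (p : nat -> R -> R) (alpha : R) :
  (forall y, p n 0 / p n y @[n --> \oo] --> expR (alpha * y)) ->
  forall y, p n y / p n 0 @[n --> \oo] --> expR (- (alpha * y)).
Proof.
move=> H y; rewrite expRN.
apply: cvg_trans (cvgV (lt0r_neq0 (expR_gt0 (alpha * y))) (H y)).
by apply: near_eq_cvg; near=> n; rewrite /= invf_div.
Unshelve. all: by end_near. Qed.

Section Walk.
Variables (X : nat -> {RV P >-> R}) (Xrw : random_walk X).

Let xi n w := X n.+1 w - X n w.
Let xi_iid := random_walk_iid Xrw.

Lemma walk_psum_fun k : (fun w => psum 0 k (fun i => xi i w)) = X k.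
Proof. by apply/funext => w; exact: walk_psum. Qed.

Lemma random_walk_survival_asymptotics (gamma alpha x : R) :
  0 <= x -> 0 <= alpha ->
  let a := complete0 (fun n => prob_ge P (X n) 0 / n%:R) in
  (\forall n \near \oo, 0 < a n) ->
  (a n / a n.+1) @[n --> \oo] --> expR gamma ->
  conv_tail_negligible a ->
  (forall y, prob_ge P (X n) y / prob_ge P (X n) 0 @[n --> \oo]
     --> expR (- (alpha * y))) ->
  exists V : R,
    [series expR (gamma * j%:R) *
       (expR (alpha * x) * walk_trunc_moment P xi alpha x j)]_j @ \oo --> V /\
    fine (P [set w | - x <= lmin 0 n (fun i => xi i w)]) / a n @[n --> \oo] --> V.
Proof.
move=> x0 a0 a a1 a2 a3 a4.
have aE : a = complete0 (fun n => prob_ge P (fun w => psum 0 n (fun i => xi i w)) 0 / n%:R).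
  by apply/funext => n; rewrite /a /complete0 walk_psum_fun.
rewrite aE in a1 a2 a3 *; apply: (iid_survival_asymptotics xi_iid) => // y.
by under eq_fun do rewrite !walk_psum_fun; exact: a4.
Qed.

Lemma trunc_exp_moment_walk alpha x k : 0 <= alpha ->
  trunc_exp_moment P alpha x (running_min (fun n => X n) k) =
  (walk_trunc_moment P xi alpha x k)%:E.
Proof.
move=> alpha0.
rewrite (_ : running_min _ k = fun w => lmin 0 k (fun i => xi i w)); last first.
  by apply/funext => w; rewrite -walk_lmin.
apply: trunc_exp_momentE => //; first exact: (measurable_walk_min xi_iid).
by move=> w; exact: lmin_le0.
Qed.

Lemma expectation_exit_time_rw x : 0 <= x ->
  (\int[P]_w exit_time_rw (fun n => X n) x w =
   \sum_(0 <= k <oo) (walk_trunc_moment P xi 0 x k)%:E)%E.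
Proof.
move=> x0.
have mb n : measurable [set w | - x <= lmin 0 n (fun i => xi i w)].
  by apply: measurable_ge; exact: (measurable_walk_min xi_iid).
under eq_integral => w _ do rewrite (exit_time_rw_series Xrw w x0).
rewrite integral_nneseries//; last 2 first.
- move=> n; apply/measurable_EFinP.
  exact: (@measurable_if_ge _ _ _ (- x) _ (cst 1) (measurable_walk_min xi_iid n) _).
- by move=> n w _; rewrite lee_fin; case: ifP.
apply: eq_eseriesr => n _; rewrite /walk_trunc_moment.
under [in RHS]eq_Rintegral do rewrite mul0r expR0.
rewrite /Rintegral fineK//; apply: integrable_fin_num => //.
apply: (@bounded_integrable _ _ _ P _ 1).
  exact: (@measurable_if_ge _ _ _ (- x) _ (cst 1) (measurable_walk_min xi_iid n) _).
by move=> w; case: ifP; rewrite ?normr1 ?normr0.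
Qed.

(** Both clauses of [V_rw] are the same series: at [gamma = alpha = 0] its terms are the survival
    probabilities, which add up to the mean exit time. *)
Lemma V_rw_series gamma alpha x V : 0 <= x -> 0 <= alpha ->
  [series expR (gamma * j%:R) *
     (expR (alpha * x) * walk_trunc_moment P xi alpha x j)]_j @ \oo --> V ->
  V_rw P gamma alpha (fun n => X n) x = V%:E.
Proof.
move=> x0 alpha0 sV.
have key : (\sum_(0 <= k <oo) ((expR (gamma * k%:R))%:E *
     (walk_trunc_moment P xi alpha x k)%:E))%E = (expR (- (alpha * x)) * V)%:E.
  apply/cvg_lim => //.
  rewrite (_ : (fun n => _) = EFin \o (fun n => expR (- (alpha * x)) *
     [series expR (gamma * j%:R) *
     (expR (alpha * x) * walk_trunc_moment P xi alpha x j)]_j n)).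
    by apply: cvg_EFin; [near=> n|apply: cvgMr].
  apply/funext => n /=; rewrite /series /= mulr_sumr -sumEFin.
  apply: eq_bigr => j _; rewrite -EFinM; congr (_%:E).
  by rewrite [RHS]mulrCA; congr (_ * _); rewrite mulrA -expRD addNr expR0 mul1r.
rewrite /V_rw; case: ifPn => [/andP[/eqP g0 /eqP a0]|_].
  rewrite expectation_exit_time_rw//; move: key; rewrite a0 g0.
  rewrite mul0r oppr0 expR0 mul1r => <-.
  by apply: eq_eseriesr => n _; rewrite mul0r expR0 mul1e.
under eq_eseriesr do rewrite trunc_exp_moment_walk//.
by rewrite key -EFinM mulrA -expRD addrN expR0 mul1r.
Unshelve. all: by end_near. Qed.

Lemma random_walk_exit_asymptotics (gamma alpha x : R) : 0 <= alpha ->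
  tail_conditions P gamma alpha (fun n => X n) -> 0 <= x ->
  equiv_mul \oo
    (fun n : nat => fine (P [set w | (n%:R%:E < exit_time_rw (fun n => X n) x w)%E]))
    (V_rw P gamma alpha (fun n => X n) x)
    (fun n : nat => prob_ge P (X n) 0 / n%:R).
Proof.
move=> alpha0 [Ss ratio] x0.
have [_ a_gt0 ag _] := Ss; have atail := Ss_conv_tail_negligible Ss.
have ratio' := tail_ratio (p := fun n => prob_ge P (X n)) ratio.
have [V [sV fV]] := random_walk_survival_asymptotics x0 alpha0 a_gt0 ag atail ratio'.
apply: (equiv_mul_cvg (v := V)).
- exact: V_rw_series.
- exact: (near_complete0 (Q := fun _ y => 0 < y) a_gt0).
- apply: cvg_trans fV; apply: near_eq_cvg.
  apply: (near_complete0 (b := fun n => prob_ge P (X n) 0 / n%:R) (Q := fun n y => _ / complete0 _ n = _ / y)).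
  near=> n; congr (fine (P _) / _); apply/seteqP.
  by split=> w /=; rewrite lt_exit_time_rw.
Unshelve. all: by end_near. Qed.

End Walk.
End RandomWalkTheorem.

(** * Lévy processes at fractional times *)

Section LevyBasics.
Context {d : measure_display} {T : measurableType d} {R : realType}.
Variable P : probability T R.
Variables (X : R -> {RV P >-> R}) (XL : levy_process X).

Lemma levy_skeleton (h : R) : 0 <= h ->
  random_walk (fun k : nat => X (k%:R * h) : {RV P >-> R}).
Proof.
move=> h0; have [X0 indep stat _ _] := XL; split => [w||n].
- by rewrite mul0r X0.
- apply: (indep (fun k => k%:R * h)); first by rewrite mul0r.
  by move=> i; rewrite ler_wpM2r// ler_nat.
- move=> B mB.
  rewrite (_ : n.+1%:R * h = n%:R * h + h); last by rewrite -natr1 mulrDl mul1r.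
  rewrite stat ?mulr_ge0// (_ : 1 * h = 0 + h); last by rewrite mul1r add0r.
  by rewrite mul0r stat// add0r.
Qed.

Lemma levy_indep2 (s t : R) (A B : set R) : 0 <= s -> 0 <= t ->
  measurable A -> measurable B ->
  P ((X s @^-1` A) `&` ((fun w => X (s + t) w - X s w) @^-1` B)) =
  (P (X s @^-1` A) * P (X t @^-1` B))%E.
Proof.
move=> s0 t0 mA mB; have [X0 indep stat _ _] := XL.
pose tt (i : nat) := if i is j.+1 then (if j is 0%N then s else s + t) else 0.
have tt_le i : tt i <= tt i.+1.
  by case: i => [|[|i]] //=; rewrite lerDl.
have := indep tt (lexx _) tt_le [:: 0%N; 1%N] (fun i => if i is 0%N then A else B) isT.
move=> /(_ ltac:(by case)).
rewrite !big_cons big_nil mule1 /=.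
rewrite (_ : _ @^-1` A = X s @^-1` A); last first.
  by apply/seteqP; split => w /=; rewrite X0 subr0.
rewrite stat// => <-; congr (P _).
apply/seteqP; split => w /=.
  move=> [Aw Bw] i /=; rewrite !inE => /orP[|] /eqP -> //=.
  by rewrite /tt X0 subr0.
move=> H; split; last exact: (H 1%N).
by have := H 0%N; rewrite /= /tt X0 subr0; apply.
Qed.

(** The law of [(X_s, X_(s+t) - X_s)] is the product of the laws of [X_s] and [X_t], by uniqueness
    of the product measure on rectangles. *)
Lemma levy_conv (s t : R) (g : R -> \bar R) : 0 <= s -> 0 <= t ->
  measurable_fun setT g -> (forall y, 0 <= g y)%E ->
  (\int[P]_w g (X (s + t) w) = \int[P]_w \int[P]_w' g (X s w + X t w')%R)%E.
Proof.
move=> s0 t0 mg g0.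
have mp : measurable_fun setT (fun w => (X s w, X (s + t) w - X s w)).
  by apply: measurable_fun_pair => //; exact: measurable_funB.
pose mix := isMeasurableFun.Build _ _ _ _ _ mp.
pose q : {mfun T >-> (R * R)%type} := HB.pack (fun w => (X s w, X (s + t) w - X s w)) mix.
have mG : measurable_fun setT (fun p : R * R => g (p.1 + p.2)).
  apply: (measurableT_comp mg); apply: measurable_funD; exact: measurable_fst || exact: measurable_snd.
transitivity (\int[pushforward P q]_p g (p.1 + p.2)%R)%E.
  rewrite ge0_integral_pushforward// preimage_setT.
  by apply: eq_integral => w _ /=; rewrite [X s w + _]addrC subrK.
transitivity (\int[(distribution P (X s) \x distribution P (X t))%E]_p g (p.1 + p.2)%R)%E.
  apply/esym; apply: eq_measure_integral => A mA _.
  apply: (product_measure_unique (m' := pushforward P q)) => // B C mB mC.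
  exact: levy_indep2.
rewrite fubini_tonelli1//.
rewrite ge0_integral_distribution//; last 2 first.
- exact: measurable_fun_fubini_tonelli_F.
- by move=> y; apply: integral_ge0 => z _; exact: g0.
apply: eq_integral => w _ /=; rewrite /fubini_F ge0_integral_distribution//.
apply: (measurableT_comp mg); apply: (@measurable_funD _ _ _ _ (cst (X s w)) id).
  exact: measurable_cst.
exact: measurable_id.
Qed.

Lemma levy_prob_conv (s t y : R) : 0 <= s -> 0 <= t ->
  prob_ge P (X (s + t)) y = \int[P]_w prob_ge P (X s) (y - X t w).
Proof.
move=> s0 t0.
pose g (z : R) : \bar R := (if y <= z then 1 else 0)%:E.
have mg : measurable_fun setT g.
  apply/measurable_EFinP; apply: nondecreasing_measurable => // a b ab.
  case: ifPn => [ya|_]; first by rewrite (le_trans ya ab).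
  by case: ifP.
have g0 z : (0 <= g z)%E by rewrite lee_fin; case: ifP.
have mge z u : measurable [set w | z <= X u w] by exact: measurable_ge.
rewrite {1}/prob_ge -(@Rintegral_if _ _ _ P (fun w => y <= X (s + t) w) (mge y (s + t))).
rewrite /Rintegral; congr fine.
have := levy_conv t0 s0 mg g0; rewrite addrC /g => ->.
apply: eq_integral => w _; rewrite fineK; last exact: fin_num_measure.
rewrite -[X in P X]setIT -integral_indic//; apply: eq_integral => w' _.
rewrite indicE; case: ifPn => bw.
  by rewrite mem_set//= lerBlDr addrC.
by rewrite memNset//= lerBlDr addrC; exact/negP.
Qed.

(** Keeps only the paths above [y - z] at time [s] whose later increment is at least [z]. *)
Lemma levy_prob_ge_split (s t y z : R) : 0 <= s -> 0 <= t ->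
  prob_ge P (X s) (y - z) * prob_ge P (X t) z <= prob_ge P (X (s + t)) y.
Proof.
move=> s0 t0; rewrite /prob_ge.
have m1 : measurable `[y - z, +oo[%classic by exact: measurable_itv.
have m2 : measurable `[z, +oo[%classic by exact: measurable_itv.
have := levy_indep2 s0 t0 m1 m2.
rewrite (_ : X s @^-1` _ = [set w | y - z <= X s w]); last first.
  by apply/seteqP; split => w /=; rewrite in_itv/= andbT.
rewrite (_ : X t @^-1` _ = [set w | z <= X t w]); last first.
  by apply/seteqP; split => w /=; rewrite in_itv/= andbT.
move=> /(congr1 fine); rewrite fineM ?fin_num_measure//; try exact: measurable_ge.
move=> <-; apply: fine_probability_le.
- apply: measurableI; first exact: measurable_ge.
  rewrite -[X in measurable X]setTI.
  by apply: measurable_funB => //.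
- exact: measurable_ge.
- by move=> w /= [] ; rewrite in_itv/= andbT; lra.
Qed.

End LevyBasics.

(** * Fatou's lemma for limits that may have infinite integral *)

Section Fatou.
Context {d : measure_display} {T : measurableType d} {R : realType}.
Variable P : probability T R.

Lemma lt_integral_truncated (f : T -> R) (c : R) :
  measurable_fun setT f -> (forall w, 0 <= f w) ->
  (c%:E < \int[P]_w (f w)%:E)%E ->
  exists M : nat, c < \int[P]_w Num.min (f w) M%:R.
Proof.
move=> mf f0 cf.
have mm (n : nat) : measurable_fun setT (fun w => Num.min (f w) n%:R).
  by apply: measurable_minr => //; exact: measurable_cst.
have := @cvg_monotone_convergence _ _ _ P setT measurableT
  (fun n w => (Num.min (f w) n%:R)%:E).
rewrite (_ : (fun x => limn _) = (fun w => (f w)%:E)); last first.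
  apply/funext => w; apply/cvg_lim => //.
  apply: cvg_near_cst; exists (Num.truncn (f w)).+1 => // n /= wn.
  rewrite min_l// ltW// (lt_le_trans (truncnS_gt _))// ler_nat//.
move=> H.
have {}H : (\int[P]_w (Num.min (f w) n%:R)%:E)%E @[n --> \oo] --> (\int[P]_w (f w)%:E)%E.
  apply: H => //.
  - by move=> n; apply/measurable_EFinP.
  - by move=> n w _; rewrite lee_fin le_min f0/=.
  - move=> w _ n m nm; rewrite lee_fin le_min ge_min lexx/=.
    by rewrite ge_min ler_nat nm orbT.
have : \forall n \near \oo, (c%:E < \int[P]_w (Num.min (f w) n%:R)%:E)%E.
  exact: (H _ (open_ereal_gt' cf)).
move=> /near_infty_ex[M HM]; exists M.
have := HM M (leqnn _); rewrite -[X in (_ < X)%E]fineK ?lte_fin//.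
apply: integrable_fin_num => //; apply: (@bounded_integrable _ _ _ P _ M%:R) => // w.
by rewrite ger0_norm ?le_min ?f0//= ge_min lexx orbT.
Qed.

(** Since the integral of [f] may be infinite, [f] is first truncated so that its integral still
    exceeds [c]. The minima of [f_ n] with the truncation are then bounded and converge. *)
Lemma fatou_lower (f_ : nat -> T -> R) (f : T -> R) (c : R) :
  (forall n, measurable_fun setT (f_ n)) -> measurable_fun setT f ->
  (forall n w, 0 <= f_ n w) -> (forall w, 0 <= f w) ->
  (forall n, P.-integrable setT (EFin \o f_ n)) ->
  (forall w c, c < f w -> \forall n \near \oo, c <= f_ n w) ->
  (c%:E < \int[P]_w (f w)%:E)%E -> \forall n \near \oo, c <= \int[P]_w f_ n w.
Proof.
move=> mf_ mf f_0 f0 if_ lim_inf /(lt_integral_truncated mf f0)[M cM].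
pose tr w := Num.min (f w) M%:R.
have mtr : measurable_fun setT tr.
  by apply: measurable_minr => //; exact: measurable_cst.
have tr0 w : 0 <= tr w by rewrite le_min f0 /=.
have mg n : measurable_fun setT (fun w => Num.min (f_ n w) (tr w)).
  by apply: measurable_minr.
have gb n w : `|Num.min (f_ n w) (tr w)| <= M%:R.
  rewrite ger0_norm; last by rewrite le_min f_0 tr0.
  by rewrite ge_min /tr ge_min lexx !orbT.
have conv : \int[P]_w Num.min (f_ n w) (tr w) @[n --> \oo] --> \int[P]_w tr w.
  apply: (@Rintegral_bounded_cvg _ _ _ _ _ _ M%:R) => // [|w].
    by near=> n.
  apply/cvgrPdist_le => e e0.
  have /lim_inf : tr w - e < f w.
    by rewrite ltrBlDr (le_lt_trans (_ : _ <= f w)) ?ltrDl// /tr ge_min lexx.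
  apply: filterS => n ten; case: (leP (f_ n w) (tr w)) => H.
    by rewrite ger0_norm ?subr_ge0//; lra.
  by rewrite subrr normr0 ltW.
move/cvgr_ge : conv => /(_ _ cM); apply: filterS => n /le_trans; apply.
apply: le_Rintegral => //; first exact: bounded_integrable (gb n).
by move=> w _; rewrite ge_min lexx.
Unshelve. all: by end_near. Qed.

End Fatou.

Section RealBounds.
Context {R : realType}.

Lemma ereal_le_of_lt (a : \bar R) (r : R) :
  (forall c : R, (c%:E < a)%E -> c <= r) -> (a <= r%:E)%E.
Proof.
case: a => [a| |] H; last exact: leNye.
  rewrite lee_fin leNgt; apply/negP => ra.
  by have := H ((a + r) / 2); rewrite lte_fin; lra.
by have := H (r + 1) (ltry _); rewrite gerDl ler10.
Qed.

Lemma expR_small_step (a e : R) : 0 <= a -> 0 < e ->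
  exists2 eta : R, 0 < eta & expR (a * eta) <= 1 + e.
Proof.
move=> a0 e0; have l0 : 0 < ln (1 + e) by rewrite ln_gt0 ?ltrDl.
have a1 : 0 < a + 1 by rewrite ltr_wpDl.
exists (ln (1 + e) / (a + 1)); first by rewrite divr_gt0.
rewrite -[leRHS]lnK ?ler_expR; last by rewrite posrE addr_gt0.
rewrite mulrA ler_pdivrMr// mulrC ler_wpM2l ?(ltW l0)//; lra.
Qed.

End RealBounds.

Section PositiveInterval.
Context {d : measure_display} {T : measurableType d} {R : realType}.
Variable P : probability T R.

(** Countably many intervals of length [eta] cover the line, so they cannot all be negligible. *)
Lemma positive_interval (Y : T -> R) (eta : R) : measurable_fun setT Y -> 0 < eta ->
  exists z : R, 0 < fine (P [set w | z <= Y w < z + eta]).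
Proof.
move=> mY eta0; apply: contrapT => /forallNP H.
have mI z : measurable [set w | z <= Y w < z + eta].
  rewrite -[X in measurable X]setTI.
  have := mY measurableT `[z, z + eta[%classic (measurable_itv _).
  by rewrite (_ : _ @^-1` _ = [set w | z <= Y w < z + eta]).
have nI z : P.-negligible [set w | z <= Y w < z + eta].
  apply/negligibleP => //; apply/eqP; rewrite -[X in X == _]fineK ?fin_num_measure//.
  rewrite eqe; apply/eqP/le_anti; rewrite fine_ge0// andbT leNgt.
  exact/negP/H.
have : P.-negligible [set: T].
  apply: (@negligibleS _ _ _ P (\bigcup_n [set w | n%:R * eta <= Y w < n%:R * eta + eta] `|`
      \bigcup_n [set w | - n.+1%:R * eta <= Y w < - n.+1%:R * eta + eta])).
    move=> w _; have /andP := real_floor_itv (num_real (Y w / eta)).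
    rewrite ler_pdivlMr// ltr_pdivrMr// intrD mulrDl mul1r => fl.
    case E : (Num.floor (Y w / eta)) fl => [n|n] fl; [left|right]; exists n => //=.
      exact/andP.
    by move: fl; rewrite NegzE mulrNz => fl; exact/andP.
  by apply: negligibleU; apply: negligible_bigcup => n; exact: nI.
move=> [A [mA PA0 TA]].
have : P setT = 0%E.
  by apply/eqP; rewrite eq_le measure_ge0 andbT -PA0 le_measure ?inE.
by rewrite probability_setT => /eqP; rewrite onee_eq0.
Qed.

End PositiveInterval.


(** * The exponential moment and the tails at non-integer times *)

Section FractionalTimes.
Context {d : measure_display} {T : measurableType d} {R : realType}.
Variable P : probability T R.
Variables (X : R -> {RV P >-> R}) (XL : levy_process X) (gamma alpha : R).
Hypothesis alpha0 : 0 <= alpha.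

Let p n := prob_ge P (X n%:R) 0.
Let u n s y := prob_ge P (X (n%:R + s)) y / p n.

Hypothesis p_gt0 : \forall n \near \oo, 0 < p n.
Hypothesis p_ratio : p n / p n.+1 @[n --> \oo] --> expR gamma.
Hypothesis y_ratio : forall y, prob_ge P (X n%:R) y / p n @[n --> \oo] -->
  expR (- (alpha * y)).

Definition exp_moment t : \bar R := (\int[P]_w (expR (alpha * X t w))%:E)%E.
Local Notation phi := exp_moment.

Let mexp t : measurable_fun setT (fun w => expR (alpha * X t w)).
Proof. by apply: measurableT_comp => //; exact: measurable_funM. Qed.

Lemma exp_moment_ge0 t : (0 <= phi t)%E.
Proof. by apply: integral_ge0 => w _; rewrite lee_fin expR_ge0. Qed.

Lemma exp_momentD s t : 0 <= s -> 0 <= t -> phi (s + t) = (phi s * phi t)%E.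
Proof.
move=> s0 t0; rewrite /phi.
have mg : measurable_fun setT (fun z : R => (expR (alpha * z))%:E).
  by apply/measurable_EFinP; apply: measurableT_comp => //; exact: mulrl_measurable.
have g0 (z : R) : (0 <= (expR (alpha * z))%:E)%E by rewrite lee_fin expR_ge0.
have mE t' : measurable_fun setT (fun w => (expR (alpha * X t' w))%:E).
  exact/measurable_EFinP.
rewrite (levy_conv XL s0 t0 mg g0).
rewrite -(ge0_integralZr P measurableT (mE s) (fun w _ => g0 _) (exp_moment_ge0 t)).
apply: eq_integral => w _.
rewrite -(ge0_integralZl P measurableT (mE t) (fun w _ => g0 _) (g0 _)).
by apply: eq_integral => w' _; rewrite -EFinM -expRD mulrDr.
Qed.

Let mprob n y (Y : T -> R) : measurable_fun setT Y ->
  measurable_fun setT (fun w => prob_ge P (X n) (y - Y w)).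
Proof.
move=> mY; apply: (measurableT_comp (measurable_prob_ge P _)) => //.
exact: measurable_funB.
Qed.

Let iprob n y (Y : T -> R) c : measurable_fun setT Y ->
  P.-integrable setT (EFin \o (fun w => prob_ge P (X n) (y - Y w) / c)).
Proof.
move=> mY; apply: (@bounded_integrable _ _ _ P _ `|c^-1|).
  by apply: measurable_funM => //; exact: mprob.
move=> w; rewrite normrM ler_piMl//.
by rewrite ger0_norm ?prob_ge_ge0// prob_ge_le1.
Qed.

(** Conditioning on an increment of length [s] makes [u n s y] the mean of the tail of [X_n] at the
    level [y - X_s], divided by [p n]. The integrand tends to [e^(-alpha (y - X_s))], and Fatou's
    lemma applies even while the exponential moment may be infinite. *)
Lemma fractional_lower s y c : 0 <= s ->
  (c%:E < (expR (- (alpha * y)))%:E * phi s)%E -> \forall n \near \oo, c <= u n s y.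
Proof.
move=> s0 cs.
have eqE : ((expR (- (alpha * y)))%:E * phi s)%E =
    (\int[P]_w (expR (- (alpha * (y - X s w))))%:E)%E.
  rewrite /phi -(ge0_integralZl P measurableT (f := fun w => (expR (alpha * X s w))%:E)).
  - by apply: eq_integral => w _; rewrite -EFinM -expRD; congr (expR _)%:E; ring.
  - by apply/measurable_EFinP.
  - by move=> w' _; rewrite lee_fin expR_ge0.
  - by rewrite lee_fin expR_ge0.
rewrite eqE in cs.
have := @fatou_lower _ _ _ P (fun n w => prob_ge P (X n%:R) (y - X s w) / p n) _ c.
move=> /(_ _ _ _ _ _ _ _ cs) H.
have {}H : \forall n \near \oo, c <= \int[P]_w (prob_ge P (X n%:R) (y - X s w) / p n).
  apply: H.
  - by move=> n; apply: measurable_funM => //; exact: mprob.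
  - apply: measurableT_comp => //; apply: measurable_funN.
    by apply: measurable_funM => //; exact: measurable_funB.
  - by move=> n w; rewrite divr_ge0 ?prob_ge_ge0.
  - by move=> w; exact: expR_ge0.
  - by move=> n; exact: iprob.
  - by move=> w c' cw; move/cvgr_ge: (@y_ratio (y - X s w)); exact.
apply: filterS H => n; rewrite /u (levy_prob_conv XL _ (ler0n _ n) s0).
have i1 : P.-integrable setT (EFin \o (fun w => prob_ge P (X n%:R) (y - X s w))).
  have := iprob n%:R y 1 (measurable_funPT (X s)).
  by apply: eq_integrable => // w _ /=; rewrite divr1.
by rewrite RintegralZr.
Qed.

Let p_step : p n.+1 / p n @[n --> \oo] --> expR (- gamma).
Proof.
rewrite expRN; apply: cvg_trans (cvgV (lt0r_neq0 (expR_gt0 gamma)) p_ratio).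
by apply: near_eq_cvg; near=> n; rewrite /= invf_div.
Unshelve. all: by end_near. Qed.

Lemma integer_step y : u n 1 y @[n --> \oo] --> expR (- (alpha * y)) * expR (- gamma).
Proof.
have c1 : prob_ge P (X n.+1%:R) y / p n.+1 @[n --> \oo] --> expR (- (alpha * y)).
  have := @y_ratio y; rewrite -(cvg_shiftn 1).
  by under eq_fun do rewrite addn1.
apply: cvg_trans (cvgM c1 p_step); apply: near_eq_cvg.
have /near_infty_ex[N HN] := p_gt0.
apply/near_infty_ex; exists N => n Nn /=.
rewrite /u natr1 mulrA divfK// gt_eqF// HN//; exact: leqW.
Qed.

Lemma chernoff n : ((p n)%:E <= phi n%:R)%E.
Proof.
have mge : measurable [set w | 0 <= X n%:R w] by exact: measurable_ge.
rewrite /p /prob_ge -Rintegral_if// /Rintegral fineK; last first.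
  apply: integrable_fin_num => //; apply: (@bounded_integrable _ _ _ P _ 1).
    exact: (@measurable_if_ge _ _ _ 0 (X n%:R) (cst 1)).
  by move=> w; case: ifP; rewrite ?normr1 ?normr0.
apply: ge0_le_integral => //.
- by move=> w _; rewrite lee_fin; case: ifP.
- apply/measurable_EFinP; exact: (@measurable_if_ge _ _ _ 0 (X n%:R) (cst 1)).
- by apply/measurable_EFinP.
- move=> w _; rewrite lee_fin; case: ifP => [X0|_]; last exact: expR_ge0.
  by rewrite -[leLHS]expR0 ler_expR; exact: mulr_ge0.
Qed.

(** Fatou's lemma at [s = 1] against the known limit of [u n 1 0] gives the upper bound. If the
    moment [q] were smaller than [e^(-gamma)], Chernoff's bound [p n <= q^n] would contradict the
    ratio of successive [p n], which allows no geometric decay with a ratio [rho < e^(-gamma)]. *)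
Lemma exp_moment1 : phi 1 = (expR (- gamma))%:E.
Proof.
have le1 : (phi 1 <= (expR (- gamma))%:E)%E.
  apply: ereal_le_of_lt => c c1.
  have := fractional_lower (y := 0) (c := c) ler01.
  rewrite mulr0 oppr0 expR0 mul1e => /(_ c1).
  have := @integer_step 0; rewrite mulr0 oppr0 expR0 mul1r => /cvg_ge_cst; exact.
apply/eqP; rewrite eq_le le1/= leNgt; apply/negP => lt1.
have fphi : phi 1 \is a fin_num.
  by rewrite ge0_fin_numE ?exp_moment_ge0// (lt_trans lt1)// ltry.
pose q := fine (phi 1).
have q1 : phi 1 = q%:E by rewrite fineK.
have q_ge0 : 0 <= q by rewrite fine_ge0// exp_moment_ge0.
have phiX n : phi n.+1%:R = (q ^+ n.+1)%:E.
  elim: n => [|n IH]; first by rewrite expr1 q1.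
  rewrite -natr1 exp_momentD// IH q1 -EFinM.
  by rewrite -exprSr.
have pq n : p n.+1 <= q ^+ n.+1 by rewrite -lee_fin -phiX; exact: chernoff.
have lt_q : q < expR (- gamma) by rewrite -lte_fin -q1.
pose rho := (q + expR (- gamma)) / 2.
have qrho : q < rho by rewrite /rho; lra.
have rho0 : 0 < rho by exact: le_lt_trans qrho.
have rhog : rho < expR (- gamma) by rewrite /rho; lra.
have /near_infty_ex[N HN] : \forall n \near \oo, 0 < p n /\ rho <= p n.+1 / p n.
  have H : \forall n \near \oo, rho <= p n.+1 / p n.
    by move/cvgr_ge: p_step; exact.
  by apply: filterS2 p_gt0 H.
have pge k : p N * rho ^+ k <= p (N + k)%N.
  elim: k => [|k IH]; first by rewrite expr0 mulr1 addn0.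
  have [p0 ] := HN (N + k)%N (leq_addr _ _).
  rewrite ler_pdivlMr// addnS => /(le_trans _); apply.
  by rewrite exprSr mulrA mulrC ler_wpM2l// ltW.
have [pN0 _] := HN N (leqnn _).
have z : (q / rho) ^+ k.+1 @[k --> \oo] --> (0 : R).
  rewrite (cvg_shiftS (fun k => (q / rho) ^+ k)); apply: cvg_expr.
  rewrite ger0_norm; last by rewrite divr_ge0// ltW.
  by rewrite ltr_pdivrMr// mul1r.
have bound k : p N <= q ^+ N * (q / rho) ^+ k.+1.
  have hk : p N * rho ^+ k.+1 <= q ^+ (N + k.+1).
    by apply: le_trans (pge k.+1) _; rewrite addnS; exact: pq.
  by rewrite expr_div_n mulrA -exprD ler_pdivlMr ?exprn_gt0.
have zq : q ^+ N * (q / rho) ^+ k.+1 @[k --> \oo] --> q ^+ N * (0 : R) by exact: cvgMr.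
rewrite mulr0 in zq; have H := cvg_ge_cst (c := p N) zq.
have : p N <= 0 by apply: H; near=> k; exact: bound.
by rewrite leNgt pN0.
Unshelve. all: by end_near. Qed.

(** The two moments are nonnegative and their product is positive and finite, so neither can be
    infinite. *)
Lemma exp_moment_split s r : 0 <= s -> 0 <= r -> s + r = 1 ->
  phi s \is a fin_num /\ fine (phi s) * fine (phi r) = expR (- gamma).
Proof.
move=> s0 r0 sr1.
have E : (phi s * phi r = (expR (- gamma))%:E)%E.
  by rewrite -exp_momentD// sr1 exp_moment1.
have fin_l a b : (0 <= a)%E -> (0 <= b)%E -> (a * b = (expR (- gamma))%:E)%E ->
    a \is a fin_num.
  move=> a0 b0 ab; rewrite ge0_fin_numE// ltNge leye_eq; apply/negP => /eqP aoo.
  have b_gt0 : (0 < b)%E.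
    rewrite lt_neqAle b0 andbT; apply/eqP => b00; move: ab.
    by rewrite -b00 mule0 => -[] /esym/eqP; rewrite gt_eqF// expR_gt0.
  by move: ab; rewrite aoo gt0_mulye.
have fs := fin_l _ _ (exp_moment_ge0 s) (exp_moment_ge0 r) E.
have fr : phi r \is a fin_num.
  by apply: (fin_l _ _ (exp_moment_ge0 r) (exp_moment_ge0 s)); rewrite muleC.
split => //; apply: EFin_inj; rewrite -E EFinM !fineK//.
Qed.

(* Fatou's lemma already bounds the complement of [b] from below, so the total
   mass at time n + 1 forces the bound from above on [b]. *)
Let fractional_upper_aux s r y z eta c e : 0 <= s -> 0 <= r -> s + r = 1 ->
  0 < e ->
  let b w := z <= X r w < z + eta in
  c = expR (- (alpha * y)) * fine (phi s) * expR (alpha * eta) ->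
  \forall n \near \oo,
    fine (P [set w | b w]) * u n s y <= c * fine (P [set w | b w]) + 2 * e.
Proof.
move=> s0 r0 sr e0 b cE.
have [fs fsr] := exp_moment_split s0 r0 sr.
have [fr _] := exp_moment_split r0 s0 (etrans (addrC r s) sr).
set pi_ := fine (P _); set fis := fine (phi s) in cE fsr *.
have fis0 : 0 <= fis by rewrite fine_ge0// exp_moment_ge0.
(* With this level, [X_r >= z] gives [y1 - X_r <= y], so on [b] the integrand [A n] is at least
   [u n s y]. *)
pose y1 := y + z.
have mb : measurable [set w | b w].
  rewrite -[X in measurable X]setTI.
  have := measurable_funPT (X r) measurableT `[z, z + eta[%classic (measurable_itv _).
  by rewrite (_ : _ @^-1` _ = [set w | b w]).
have mbf : measurable_fun setT b by apply: (measurable_fun_bool true); rewrite setTI.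
pose A n w := prob_ge P (X (n%:R + s)) (y1 - X r w) / p n.
have A0 n w : 0 <= A n w by rewrite divr_ge0 ?prob_ge_ge0.
have mA n : measurable_fun setT (A n) by apply: measurable_funM => //; exact: mprob.
have AC n w : `|A n w| <= `|(p n)^-1|.
  by rewrite normrM ler_piMl// ger0_norm ?prob_ge_ge0// prob_ge_le1.
pose A1 n w := if b w then 0 else A n w.
have mA1 n : measurable_fun setT (A1 n) by exact: measurable_fun_ifT.
have A1C n w : `|A1 n w| <= `|(p n)^-1|.
  by rewrite /A1; case: ifP => // _; rewrite normr0.
pose f w := if b w then 0 else expR (- (alpha * (y1 - X r w))) * fis.
have mexpr : measurable_fun setT (fun w => expR (- (alpha * (y1 - X r w))) * fis).
  apply: measurable_funM => //; apply: measurableT_comp => //.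
  by apply: measurable_funN; apply: measurable_funM => //; exact: measurable_funB.
have mf : measurable_fun setT f by exact: measurable_fun_ifT.
have f0 w : 0 <= f w by rewrite /f; case: ifP => // _; rewrite mulr_ge0// expR_ge0.
pose g w := if b w then expR (- (alpha * (y1 - X r w))) * fis else 0.
have mg : measurable_fun setT g by exact: measurable_fun_ifT.
have g0 w : 0 <= g w by rewrite /g; case: ifP => // _; rewrite mulr_ge0// expR_ge0.
(* The limit of [u n 1 y1]. By the identity of the exponential moments it is also the integral of
   the pointwise limits, which splits into [f] off [b] and [g] on [b]. *)
pose total := expR (- (alpha * y1)) * expR (- gamma).
have totalE : (total%:E = \int[P]_w (f w)%:E + \int[P]_w (g w)%:E)%E.
  rewrite -ge0_integralD//; last 4 first.
  - by move=> w _; rewrite lee_fin.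
  - by apply/measurable_EFinP.
  - by move=> w _; rewrite lee_fin.
  - by apply/measurable_EFinP.
  transitivity (\int[P]_w ((expR (- (alpha * y1)) * fis)%:E * (expR (alpha * X r w))%:E))%E.
    rewrite (@ge0_integralZl _ _ _ P _ measurableT (fun w => (expR (alpha * X r w))%:E)).
    - by rewrite -/(exp_moment r) -(fineK fr) -EFinM /total -fsr; congr (_%:E); ring.
    - by apply/measurable_EFinP.
    - by move=> w _; rewrite lee_fin expR_ge0.
    - by rewrite lee_fin mulr_ge0// expR_ge0.
  apply: eq_integral => w _; rewrite -EFinM -EFinD; congr (_%:E).
  rewrite /f /g mulrAC -expRD; case: ifP => _; rewrite ?add0r ?addr0;
    by congr (expR _ * _); ring.
have gle : (\int[P]_w (g w)%:E <= (c * pi_)%:E)%E.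
  rewrite /pi_ -(Rintegral_if P mb) EFinM.
  have mi : measurable_fun setT (fun w => (if b w then 1 else 0 : R)).
    exact: measurable_fun_ifT.
  have i1 : P.-integrable setT (EFin \o (fun w => if b w then 1 else 0 : R)).
    apply: (@bounded_integrable _ _ _ P _ 1) => // w.
    by case: ifP; rewrite ?normr1 ?normr0.
  have c0 : 0 <= c by rewrite cE !mulr_ge0// expR_ge0.
  rewrite /Rintegral fineK; last exact: integrable_fin_num.
  have mi' : measurable_fun setT (fun w => (if b w then 1 else 0 : R)%:E).
    exact/measurable_EFinP.
  have i0 w : (0 <= (if b w then 1 else 0 : R)%:E)%E by rewrite lee_fin; case: ifP.
  have c0' : (0 <= c%:E)%E by rewrite lee_fin.
  rewrite -(ge0_integralZl P measurableT mi' (fun w _ => i0 w) c0').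
  apply: ge0_le_integral => //.
  - by move=> w _; rewrite lee_fin.
  - by apply/measurable_EFinP.
  - by apply/measurable_EFinP; apply: measurable_funM.
  - move=> w _; rewrite lee_fin /g; case: ifP => [|_]; last by rewrite mulr0.
    rewrite /b => /andP[_ Xz]; rewrite mulr1 cE mulrAC ler_wpM2r// -expRD ler_expR /y1.
    rewrite -subr_ge0 [X in 0 <= X](_ : _ = alpha * (z + eta - X r w)); last by ring.
    by rewrite mulr_ge0// subr_ge0 ltW.
have lowB : \forall n \near \oo, total - c * pi_ - e <= \int[P]_w A1 n w.
  apply: (@fatou_lower _ _ _ P A1 f) => //.
  - by move=> n w; rewrite /A1; case: ifP.
  - by move=> n; exact: bounded_integrable (A1C n).
  - move=> w c'; rewrite /f /A1; case: ifP => _ cw.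
      by near=> n; exact: ltW.
    apply: (fractional_lower s0); rewrite -(fineK fs) -EFinM lte_fin; exact: cw.
  - have gf : (\int[P]_w (g w)%:E)%E \is a fin_num.
      rewrite ge0_fin_numE; last by apply: integral_ge0 => w _; rewrite lee_fin.
      exact: le_lt_trans gle (ltry _).
    have : (\int[P]_w (f w)%:E = total%:E - \int[P]_w (g w)%:E)%E.
      by rewrite totalE addeK.
    move=> ->; rewrite -(fineK gf) -EFinB lte_fin.
    have : fine (\int[P]_w (g w)%:E) <= c * pi_ by rewrite -lee_fin fineK.
    by move=> H; lra.
have upA : \forall n \near \oo, u n 1 y1 <= total + e.
  by move/cvgr_le: (@integer_step y1) => /(_ (total + e)); apply; rewrite ltrDl.
near=> n.
have lB : total - c * pi_ - e <= \int[P]_w A1 n w by near: n.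
have uA : u n 1 y1 <= total + e by near: n.
suff : pi_ * u n s y + \int[P]_w A1 n w <= u n 1 y1.
  by move: lB uA => ? ? ?; lra.
have p0 : 0 <= p n by exact: prob_ge_ge0.
have -> : u n 1 y1 = \int[P]_w A n w.
  have ns : 0 <= n%:R + s by rewrite addr_ge0.
  have tE : n%:R + 1 = n%:R + s + r by rewrite -addrA sr.
  rewrite /u tE (levy_prob_conv XL y1 ns r0) -RintegralZr//.
  have := @iprob (n%:R + s) y1 (X r) 1 (measurable_funPT (X r)).
  by apply: eq_integrable => // w _ /=; rewrite divr1.
have mi : measurable_fun setT (fun w => (if b w then 1 else 0) * u n s y : R).
  by apply: measurable_funM => //; exact: measurable_fun_ifT.
have iC w : `|(if b w then 1 else 0) * u n s y : R| <= `|u n s y|.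
  by rewrite normrM ler_piMl//; case: ifP; rewrite ?normr1 ?normr0.
rewrite /pi_ -(Rintegral_if P mb) -RintegralZr//; last first.
  apply: (@bounded_integrable _ _ _ P _ 1); first exact: measurable_fun_ifT.
  by move=> w; case: ifP; rewrite ?normr1 ?normr0.
rewrite -RintegralD//; last 2 first.
- exact: bounded_integrable iC.
- exact: bounded_integrable (A1C n).
apply: le_Rintegral => //.
- apply: (@bounded_integrable _ _ _ P _ (`|u n s y| + `|(p n)^-1|)).
    exact: measurable_funD.
  by move=> w; rewrite (le_trans (ler_normD _ _))// lerD.
- exact: bounded_integrable (AC n).
- move=> w _; rewrite /A1; case: ifPn => [/andP[zX _]|_]; last by rewrite mul0r add0r.
  rewrite mul1r addr0 /u /A ler_wpM2r ?invr_ge0//.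
  by apply: prob_ge_nonincreasing => //; rewrite /y1; lra.
Unshelve. all: by end_near. Qed.

Lemma fractional_upper s r y e : 0 <= s -> 0 <= r -> s + r = 1 -> 0 < e ->
  \forall n \near \oo, u n s y <= expR (- (alpha * y)) * fine (phi s) + e.
Proof.
move=> s0 r0 sr e0.
set L := expR _ * _.
have L0 : 0 <= L by rewrite mulr_ge0 ?expR_ge0// fine_ge0// exp_moment_ge0.
have L1 : 0 < L + 1 by rewrite ltr_wpDl.
have [eta eta0 etae] := expR_small_step alpha0 (divr_gt0 (divr_gt0 e0 (ltr0n _ 2)) L1).
have [z Pz] := positive_interval P (measurable_funPT (X r)) eta0.
set pi_ := fine _ in Pz.
(* After division by [pi_] the error [2 * e'] becomes [e / 2]; the other half pays for the width
   [eta] of the interval. *)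
have e'0 : 0 < e * pi_ / 4 by rewrite divr_gt0// mulr_gt0.
have := @fractional_upper_aux s r y z eta _ _ s0 r0 sr e'0 erefl.
apply: filterS => n; rewrite -/pi_ -/L => H.
rewrite -(ler_pM2l Pz) (le_trans H)//.
have : L * expR (alpha * eta) <= L + e / 2.
  apply: (@le_trans _ _ (L * (1 + e / 2 / (L + 1)))); first exact: ler_wpM2l.
  rewrite mulrDr mulr1 lerD2l mulrA ler_pdivrMr//.
  by rewrite mulrC ler_wpM2l ?divr_ge0 ?(ltW e0)// lerDl.
move=> /(ler_wpM2r (ltW Pz)); set a := L * _ * _ => ha.
have -> : pi_ * (L + e) = (L + e / 2) * pi_ + 2 * (e * pi_ / 4) by field.
by rewrite lerD2r.
Qed.

Lemma fractional_cvg s y : 0 <= s -> s <= 1 ->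
  u n s y @[n --> \oo] --> expR (- (alpha * y)) * fine (phi s).
Proof.
move=> s0 s1.
have r0 : 0 <= 1 - s by rewrite subr_ge0.
have sr : s + (1 - s) = 1 by ring.
have [fs _] := exp_moment_split s0 r0 sr.
apply/cvgrPdist_le => e e0.
have up := @fractional_upper s _ y e s0 r0 sr e0.
have lo : \forall n \near \oo, expR (- (alpha * y)) * fine (phi s) - e <= u n s y.
  apply: fractional_lower => //.
  by rewrite -(fineK fs) -EFinM lte_fin ltrBlDr ltrDl.
apply: filterS2 lo up => n lo up.
by rewrite ler_norml; apply/andP; split; lra.
Qed.

(** The moment at [1 / m] is the nonnegative [m]-th root of the moment at 1, and its powers give the
    other multiples. These are the only times that a grid of mesh [1 / m] requires. *)
Lemma exp_moment_rational (m j : nat) : (0 < m)%N -> (j <= m)%N ->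
  fine (phi (j%:R / m%:R)) = expR (- (gamma * (j%:R / m%:R))).
Proof.
move=> m0 jm; have m0R : m%:R != 0 :> R by rewrite pnatr_eq0 -lt0n.
have h0 : 0 <= m%:R^-1 :> R by rewrite invr_ge0.
have h1 : m%:R^-1 <= 1 :> R by rewrite invf_le1 ?ltr0n// ler1n.
have h1' : 0 <= 1 - m%:R^-1 :> R by rewrite subr_ge0.
have [fh _] := exp_moment_split h0 h1' (subrKC _ _).
have q0 : 0 <= fine (phi m%:R^-1) by rewrite fine_ge0// exp_moment_ge0.
have phi0 : phi 0 = 1%:E.
  rewrite /exp_moment; have [X0 _ _ _ _] := XL.
  under eq_integral do rewrite X0 mulr0 expR0.
  by rewrite integral_cst// mul1e; exact: probability_setT.
have phiX k : phi (k%:R / m%:R) = (fine (phi m%:R^-1) ^+ k)%:E.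
  elim: k => [|k IH]; first by rewrite mul0r phi0 expr0.
  rewrite -natr1 mulrDl mul1r exp_momentD ?divr_ge0//.
  by rewrite IH -[X in (_ * X)%E](fineK fh) -EFinM -exprSr.
have qE : fine (phi m%:R^-1) = expR (- (gamma / m%:R)).
  have qm : fine (phi m%:R^-1) ^+ m = expR (- (gamma / m%:R)) ^+ m.
    apply: EFin_inj; rewrite -phiX divff// exp_moment1 -expRM_natl.
    by congr (expR _)%:E; field.
  by apply/eqP; rewrite -(eqrXn2 m0)// ?expR_ge0//; apply/eqP.
by rewrite phiX /= qE -expRM_natl; congr expR; ring.
Qed.

End FractionalTimes.

Section Residues.
Context {R : realType}.

Lemma cvg_residues (v : nat -> R) (l : R) (m : nat) : (0 < m)%N ->
  (forall j, (j < m)%N -> v (n * m + j)%N @[n --> \oo] --> l) ->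
  v k @[k --> \oo] --> l.
Proof.
move=> m0 H; apply/cvgrPdist_le => e e0.
have : \forall n \near \oo, forall j : 'I_m, `|l - v (n * m + j)%N| <= e.
  apply: filter_forall => j; move/cvgrPdist_le: (@H j (ltn_ord j)); exact.
move=> /(near_infty_divn m0); apply: filterS => k /(_ (Ordinal (ltn_pmod k m0))) /=.
by rewrite -divn_eq.
Qed.

Lemma cvg_natS_ratio : (n%:R / n.+1%:R) @[n --> \oo] --> (1 : R).
Proof.
have : (1 - harmonic n) @[n --> \oo] --> (1 - 0 : R).
  by apply: cvgB; [exact: cvg_cst|exact: cvg_harmonic].
rewrite subr0 => c; apply: (cvg_trans _ c); apply: near_eq_cvg; near=> n => /=.
by rewrite -[n.+1%:R]natr1; field; rewrite natr1 pnatr_eq0.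
Unshelve. all: by end_near. Qed.

End Residues.

(** * The hypotheses of the walk case, verified for the skeleton of mesh 1/m *)

Section SkeletonAsymptotics.
Context {d : measure_display} {T : measurableType d} {R : realType}.
Variable P : probability T R.
Variables (X : R -> {RV P >-> R}) (XL : levy_process X) (gamma alpha : R).
Hypothesis alpha0 : 0 <= alpha.
Hypothesis tails : tail_conditions P gamma alpha (fun n => X n%:R).

Let p n := prob_ge P (X n%:R) 0.

Lemma p_gt0 : \forall n \near \oo, 0 < p n.
Proof.
have [[_ a0 _ _] _] := tails.
have a1 : \forall n \near \oo, 0 < p n / n%:R :> R.
  exact: (near_complete0 (Q := fun _ y => 0 < y) a0).
have n0 := nbhs_infty_gt 0.
by apply: filterS2 a1 n0 => n + n0 /=; rewrite pmulr_lgt0// invr_gt0 ltr0n.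
Qed.

Lemma p_ratio : p n / p n.+1 @[n --> \oo] --> expR gamma.
Proof.
have [[_ a0 ag _] _] := tails.
rewrite -[expR gamma]mulr1; apply: cvg_trans (cvgM ag (@cvg_natS_ratio R)); apply: near_eq_cvg.
have /near_infty_ex[N HN] := p_gt0.
apply/near_infty_ex; exists N.+1 => -[//|n] Nn /=; rewrite /complete0/=.
have pn : p n.+2 != 0 by rewrite gt_eqF// HN//; exact: leqW (ltnW _).
rewrite -/(p n.+1) -/(p n.+2).
have n1 : n.+1%:R != 0 :> R by rewrite pnatr_eq0.
have n2 : n.+2%:R != 0 :> R by rewrite pnatr_eq0.
by move: n1 n2; move: (n.+1%:R : R) (n.+2%:R : R) => x y x0 y0; field; rewrite pn x0 y0.
Qed.

Lemma y_ratio y : prob_ge P (X n%:R) y / p n @[n --> \oo] --> expR (- (alpha * y)).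
Proof. by have [_ r] := tails; apply: (tail_ratio (p := fun n => prob_ge P (X n%:R)) r). Qed.

Section Mesh.
Variables (m : nat) (m0 : (0 < m)%N).

Let m0R : m%:R != 0 :> R. Proof. by rewrite pnatr_eq0 -lt0n. Qed.
Let h : R := m%:R^-1.
Let h0 : 0 <= h. Proof. by rewrite invr_ge0. Qed.

Definition skeleton (k : nat) : {RV P >-> R} := X (k%:R * h).
Let Y := skeleton.
Let G k y := prob_ge P (Y k) y.
Let E k : R := expR (- (gamma * ((k %% m)%:R / m%:R))).
Let a := complete0 (fun k => G k 0 / k%:R).

Lemma skeleton_random_walk : random_walk Y.
Proof. exact: levy_skeleton. Qed.

Lemma skeletonE n j : Y (n * m + j)%N = X (n%:R + j%:R / m%:R).
Proof.
rewrite /Y /skeleton; congr X.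
by rewrite natrD natrM mulrDl -mulrA divff// mulr1.
Qed.

Let fractional j y : (j <= m)%N ->
  G (n * m + j)%N y / p n @[n --> \oo] -->
  expR (- (alpha * y)) * expR (- (gamma * (j%:R / m%:R))).
Proof.
move=> jm; rewrite -(exp_moment_rational XL alpha0 p_gt0 p_ratio y_ratio m0 jm).
under eq_fun do rewrite /G skeletonE.
apply: (fractional_cvg XL alpha0 p_gt0 p_ratio y_ratio).
  by rewrite divr_ge0.
by rewrite ler_pdivrMr ?ltr0n// mul1r ler_nat.
Qed.

(** Along each residue class modulo [m] the fractional part of the time is constant, and there are
    finitely many classes. *)
Lemma skeleton_prob_cvg y :
  G k y / (p (k %/ m)%N * E k) @[k --> \oo] --> expR (- (alpha * y)).
Proof.
apply: (cvg_residues m0) => j jm.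
have Ej : E j = expR (- (gamma * (j%:R / m%:R))) by rewrite /E modn_small.
rewrite -[expR (- (alpha * y))](mulfK (lt0r_neq0 (expR_gt0 (- (gamma * (j%:R / m%:R)))))).
apply: cvg_trans (cvgM (@fractional j y (ltnW jm)) (cvg_cst _)); apply: near_eq_cvg; near=> n => /=.
by rewrite divnMDl// divn_small// addn0 -Ej /E modnMDl invfM -mulrA.
Unshelve. all: by end_near. Qed.

Let pm_gt0 : \forall k \near \oo, 0 < p (k %/ m)%N.
Proof. exact: (near_infty_divn m0 p_gt0). Qed.

Let E_gt0 k : 0 < E k. Proof. exact: expR_gt0. Qed.

Lemma skeleton_prob_gt0 : \forall k \near \oo, 0 < G k 0.
Proof.
have half : expR (- (alpha * 0)) > 2^-1 :> R.
  by rewrite mulr0 oppr0 expR0 invf_lt1// ltr1n.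
move/cvgr_ge: (@skeleton_prob_cvg 0) => /(_ _ half).
apply: filterS2 pm_gt0 => k pk; rewrite ler_pdivlMr ?mulr_gt0// => H.
by apply: lt_le_trans H; rewrite !mulr_gt0// invr_gt0.
Qed.

Lemma skeleton_level_ratio y : G k y / G k 0 @[k --> \oo] --> expR (- (alpha * y)).
Proof.
have c0 := @skeleton_prob_cvg 0; rewrite mulr0 oppr0 expR0 in c0.
rewrite -[expR _]mulr1 -invr1.
apply: cvg_trans (cvgM (@skeleton_prob_cvg y) (cvgV (oner_neq0 _) c0)); apply: near_eq_cvg; near=> k => /=.
have pk : p (k %/ m)%N * E k != 0.
  by rewrite mulf_neq0 ?gt_eqF//; near: k.
rewrite invf_div mulrA divfK//.
Unshelve. all: by end_near. Qed.

Lemma skeleton_time_ratio : G k 0 / G k.+1 0 @[k --> \oo] --> expR (gamma / m%:R).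
Proof.
apply: (cvg_residues m0) => j jm.
have e0 i : expR (- (gamma * (i%:R / m%:R))) != 0 :> R by rewrite gt_eqF// expR_gt0.
(* The limit at fractional times includes the endpoint [j = m], so the step from [m - 1] to [m]
   crosses an integer without a separate case. *)
have c1 := @fractional j 0 (ltnW jm); have c2 := @fractional j.+1 0 jm.
rewrite mulr0 oppr0 expR0 mul1r in c1; rewrite mulr0 oppr0 expR0 mul1r in c2.
have -> : expR (gamma / m%:R) = expR (- (gamma * (j%:R / m%:R))) *
    (expR (- (gamma * (j.+1%:R / m%:R))))^-1.
  by rewrite -expRN opprK -expRD -[j.+1%:R]natr1; congr expR; ring.
apply: cvg_trans (cvgM c1 (cvgV (e0 _) c2)); apply: near_eq_cvg; near=> n => /=.
have pn : p n != 0 by rewrite gt_eqF//; near: n; exact: p_gt0.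
by rewrite addnS invf_div mulrA divfK.
Unshelve. all: by end_near. Qed.

Let aE k : (0 < k)%N -> a k = G k 0 / k%:R.
Proof. by case: k. Qed.

Let a_gt0 : \forall k \near \oo, 0 < a k.
Proof.
have k0 := nbhs_infty_gt 0.
apply: filterS2 skeleton_prob_gt0 k0 => k Gk k0.
by rewrite aE// divr_gt0// ltr0n.
Qed.

Let a_ratio : a k / a k.+1 @[k --> \oo] --> expR (gamma / m%:R).
Proof.
rewrite -[expR _]mulr1 -[X in _ * X]invr1.
apply: cvg_trans (cvgM skeleton_time_ratio (cvgV (oner_neq0 _) (@cvg_natS_ratio R))).
apply: near_eq_cvg; near=> k => /=.
have k0 : (0 < k)%N by near: k; exact: nbhs_infty_gt.
have /andP[G1 G2] : (0 < G k 0) && (0 < a k.+1).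
  apply/andP; split; near: k; first exact: skeleton_prob_gt0.
  have /near_infty_ex[N HN] := a_gt0.
  by apply/near_infty_ex; exists N => k Nk; apply: HN; exact: leqW.
rewrite !aE// in G2 *; have {}G2 : G k.+1 0 != 0.
  by apply: contraTneq G2 => ->; rewrite mul0r ltxx.
have k1 : k.+1%:R != 0 :> R by rewrite pnatr_eq0.
have k2 : k%:R != 0 :> R by rewrite pnatr_eq0 -lt0n.
by move: k1 k2; move: (k.+1%:R : R) (k%:R : R) => y z y0 z0; field; rewrite G2 y0 z0.
Unshelve. all: by end_near. Qed.

Let a_tail : conv_tail_negligible a.
Proof.
have [Ss _] := tails; have [b0 b_gt0 bg _] := Ss.
have btail := Ss_conv_tail_negligible Ss.
set b := complete0 _ in b0 b_gt0 bg btail.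
have bE n : (0 < n)%N -> b n = p n / n%:R by case: n.
pose Em := expR (`|gamma|) : R.
have E_le k : E k <= Em.
  rewrite ler_expR (le_trans (ler_norm _))// normrN normrM.
  rewrite ler_piMr// ger0_norm ?divr_ge0// ler_pdivrMr ?ltr0n// mul1r ler_nat.
  by rewrite ltnW// ltn_pmod.
have E_ge k : Em^-1 <= E k.
  rewrite -expRN ler_expR lerN2 (le_trans (ler_norm _))// normrM.
  rewrite ler_piMr// ger0_norm ?divr_ge0// ler_pdivrMr ?ltr0n// mul1r ler_nat.
  by rewrite ltnW// ltn_pmod.
have Em0 : 0 < Em by exact: expR_gt0.
(* [2 * Em] compares the tail at step [k] with [p (k %/ m)], and [2 * m] compares the denominators:
   [k < (k %/ m + 1) * m <= 2 * m * (k %/ m)] once the quotient is positive. *)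
pose C := 2 * Em * (2 * m%:R).
have c0 := @skeleton_prob_cvg 0; rewrite mulr0 oppr0 expR0 in c0.
have up : \forall k \near \oo, G k 0 / (p (k %/ m)%N * E k) <= 2.
  by move/cvgr_le: c0; apply; rewrite ltr1n.
have lo : \forall k \near \oo, 2^-1 <= G k 0 / (p (k %/ m)%N * E k).
  by move/cvgr_ge: c0; apply; rewrite invf_lt1// ltr1n.
have km0 := near_infty_divn m0 (nbhs_infty_gt 0).
have C0 : 0 < C by rewrite !mulr_gt0// ltr0n.
have Gle k : 0 < p (k %/ m)%N -> G k 0 / (p (k %/ m)%N * E k) <= 2 ->
    G k 0 <= 2 * Em * p (k %/ m)%N.
  move=> pk; rewrite ler_pdivrMr ?mulr_gt0// => /le_trans; apply.
  rewrite -mulrA ler_pM2l// mulrC.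
  by apply: ler_wpM2r; [exact: ltW|exact: E_le].
have Gge k : 0 < p (k %/ m)%N -> 2^-1 <= G k 0 / (p (k %/ m)%N * E k) ->
    p (k %/ m)%N <= 2 * Em * G k 0.
  move=> pk; rewrite ler_pdivlMr ?mulr_gt0// => H.
  have : 2^-1 * (p (k %/ m)%N * Em^-1) <= G k 0.
    apply: le_trans H; rewrite ler_wpM2l ?invr_ge0//.
    by rewrite ler_wpM2l// ltW.
  rewrite mulrA ler_pdivrMr// ler_pdivrMl// mulrA => /le_trans; apply.
  by rewrite mulrAC.
apply: (conv_tail_negligible_skeleton (a := b) (m := m) (C := C) (g := gamma)) => //.
- by case=> [|k]; rewrite /a /complete0//= divr_ge0// prob_ge_ge0.
- near=> k.
  have n0 : (0 < k %/ m)%N by near: k; exact: km0.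
  have k0 : (0 < k)%N by rewrite (leq_trans n0)// leq_div.
  have pk : 0 < p (k %/ m)%N by near: k.
  have Gk : G k 0 <= 2 * Em * p (k %/ m)%N by apply: Gle => //; near: k.
  rewrite aE// bE//.
  apply: (@le_trans _ _ (2 * Em * (p (k %/ m)%N / (k %/ m)%:R))).
    rewrite mulrA; apply: ler_pM => //; first exact: prob_ge_ge0.
    by rewrite lef_pV2 ?posrE ?ltr0n// ler_nat leq_div.
  apply: ler_wpM2r; first by rewrite divr_ge0// ltW.
  rewrite /C ler_peMr//; first by rewrite mulr_ge0// ltW.
  by rewrite -natrM ler1n muln_gt0.
- near=> k.
  have n0 : (0 < k %/ m)%N by near: k; exact: km0.
  have k0 : (0 < k)%N by rewrite (leq_trans n0)// leq_div.
  have pk : 0 < p (k %/ m)%N by near: k.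
  have Gk : p (k %/ m)%N <= 2 * Em * G k 0 by apply: Gge => //; near: k.
  rewrite aE// bE//.
  apply: (@le_trans _ _ (2 * Em * G k 0 / (k %/ m)%:R)).
    by apply: ler_wpM2r.
  rewrite /C -[leRHS]mulrA -[leLHS]mulrA; apply: ler_wpM2l.
    by rewrite mulr_ge0// ltW.
  rewrite mulrCA; apply: ler_wpM2l; first exact: prob_ge_ge0.
  rewrite ler_pdivlMr ?ltr0n// mulrC ler_pdivrMr ?ltr0n//.
  rewrite -!natrM ler_nat.
  have := ltn_ceil k m0; move: (k %/ m)%N n0 => q.
  by clear; nia.
Unshelve. all: by end_near. Qed.

Lemma skeleton_survival x : 0 <= x -> exists U : R,
  [series expR (gamma / m%:R * j%:R) * (expR (alpha * x) *
     walk_trunc_moment P (fun n w => skeleton n.+1 w - skeleton n w) alpha x j)]_j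
    @ \oo --> U /\
  fine (P [set w | - x <= lmin 0 k (fun n => skeleton n.+1 w - skeleton n w)])
    / (prob_ge P (skeleton k) 0 / k%:R) @[k --> \oo] --> U.
Proof.
move=> x0.
have [U [sU fU]] := random_walk_survival_asymptotics skeleton_random_walk x0 alpha0
  a_gt0 a_ratio a_tail skeleton_level_ratio.
exists U; split => //; apply: cvg_trans fU; apply: near_eq_cvg; near=> k.
by rewrite -(aE (k := k))//; near: k; exact: nbhs_infty_gt.
Unshelve. all: by end_near. Qed.

End Mesh.
End SkeletonAsymptotics.

(** * Càdlàg paths and running infima *)

Section Paths.
Context {d : measure_display} {T : measurableType d} {R : realType}.
Variable P : probability T R.
Variables (X : R -> {RV P >-> R}) (XL : levy_process X).

Lemma dyadic_between (s u : R) : 0 <= s -> s < u ->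
  exists l j : nat, s < j%:R / (2 ^ l)%:R < u.
Proof.
move=> s0 su.
pose l := Num.truncn (u - s)^-1.
have l2 : (u - s)^-1 < (2 ^ l)%:R.
  by rewrite (lt_le_trans (truncnS_gt _))// ler_nat ltn_expl.
have p0 : 0 < (2 ^ l)%:R :> R by rewrite ltr0n expn_gt0.
exists l, (Num.truncn (s * (2 ^ l)%:R)).+1.
rewrite ltr_pdivlMr// truncnS_gt/= ltr_pdivrMr//.
have us : 0 < u - s by rewrite subr_gt0.
have t_le : (Num.truncn (s * (2 ^ l)%:R))%:R <= s * (2 ^ l)%:R.
  by rewrite truncn_le// mulr_ge0// ltW.
rewrite -natr1 -(subrK s u) mulrDl addrC.
apply: ltr_leD => //; move: l2; rewrite -[ltLHS]mul1r ltr_pdivrMr//.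
by rewrite mulrC.
Qed.

(** A value below [y] at time [s] persists, by right continuity, on an interval to the right of [s],
    which contains dyadic times below [u]. *)
Lemma ge_on_dyadics (y u : R) w :
  (forall l j : nat, j%:R / (2 ^ l)%:R < u -> y <= X (j%:R / (2 ^ l)%:R) w) ->
  forall s, 0 <= s -> s < u -> y <= X s w.
Proof.
move=> H s s0 su; rewrite leNgt; apply/negP => Xy.
have [_ _ _ rc _] := XL.
have /cvgr_lt /(_ y Xy) : X v w @[v --> s^'+] --> X s w by exact: rc.
rewrite near_withinE => /nbhs_ballP[e /= e0 He].
have se : s < Num.min u (s + e) by rewrite lt_min su ltrDl.
have [l [j /andP[sj]]] := dyadic_between s0 se.
rewrite lt_min => /andP[ju je].
have inb : ball s e (j%:R / (2 ^ l)%:R).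
  by rewrite /ball /= ltr0_norm ?subr_lt0// opprB ltrBlDr addrC.
by have := He _ inb sj; rewrite /= ltNge H.
Qed.

(** The margin beyond [t] reflects that a path may go below [-x] immediately after [t], in which
    case the infimum equals [t]. Countably many dyadic conditions also give measurability. *)
Lemma lt_exit_timeP (t x : R) w : 0 <= t ->
  (t%:E < exit_time (fun t => X t) x w)%E <->
  exists n : nat, forall l j : nat, j%:R / (2 ^ l)%:R < t + n.+1%:R^-1 ->
    - x <= X (j%:R / (2 ^ l)%:R) w.
Proof.
move=> t0; split.
  move=> tt; have [n tn] : exists n : nat,
      ((t + n.+1%:R^-1)%:E <= exit_time (fun t => X t) x w)%E.
    case: (exit_time _ _ _) tt => [r| |]//; last by exists 0%N; rewrite leey.
    rewrite lte_fin => tr; exists (Num.truncn (r - t)^-1).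
    have rt : 0 < r - t by rewrite subr_gt0.
    rewrite lee_fin -lerBrDl -[leRHS]invrK lef_pV2 ?posrE ?invr_gt0 ?ltr0n//.
    exact/ltW/truncnS_gt.
  exists n => l j jt; rewrite leNgt; apply/negP => Xl.
  have : (exit_time (fun t => X t) x w <= (j%:R / (2 ^ l)%:R)%:E)%E.
    by apply: ereal_inf_lbound; exists (j%:R / (2 ^ l)%:R) => //; rewrite /= divr_ge0.
  by rewrite leNgt (lt_le_trans _ tn)// lte_fin.
move=> [n /ge_on_dyadics H].
apply: (@lt_le_trans _ _ (t + n.+1%:R^-1)%:E); first by rewrite lte_fin ltrDl invr_gt0.
apply/ereal_infP => _ [s [s0 Xs] <-]; rewrite lee_fin leNgt; apply/negP => sn.
by move: Xs; rewrite ltNge H.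
Qed.

Lemma exit_time_gt_ge (t x s : R) w : (t%:E < exit_time (fun t => X t) x w)%E ->
  0 <= s -> s <= t -> - x <= X s w.
Proof.
move=> tt s0 st; rewrite leNgt; apply/negP => Xs.
have : (exit_time (fun t => X t) x w <= s%:E)%E by apply: ereal_inf_lbound; exists s.
by rewrite leNgt (le_lt_trans _ tt)// lee_fin.
Qed.

Lemma exit_time_ge (u x : R) w : (forall s, 0 <= s -> s < u -> - x <= X s w) ->
  (u%:E <= exit_time (fun t => X t) x w)%E.
Proof.
move=> H; apply/ereal_infP => _ [s [s0 Xs] <-].
by rewrite lee_fin leNgt; apply/negP => su; move: Xs; rewrite ltNge H.
Qed.

Lemma measurable_dyadic_ge (y u : R) :
  measurable [set w | forall l j : nat, j%:R / (2 ^ l)%:R < u -> y <= X (j%:R / (2 ^ l)%:R) w].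
Proof.
rewrite (_ : mkset _ = \bigcap_l \bigcap_(j in [set j : nat | j%:R / (2 ^ l)%:R < u])
   [set w | y <= X (j%:R / (2 ^ l)%:R) w]).
  apply: bigcapT_measurable => l; apply: bigcap_measurableType => j _.
  exact: measurable_ge.
by apply/seteqP; split => w H l; [move=> _ j /= ju|move=> j ju]; exact: H.
Qed.

Lemma measurable_lt_exit_time (t x : R) : 0 <= t ->
  measurable [set w | (t%:E < exit_time (fun t => X t) x w)%E].
Proof.
move=> t0; rewrite (_ : mkset _ = \bigcup_n [set w | forall l j : nat,
    j%:R / (2 ^ l)%:R < t + n.+1%:R^-1 -> - x <= X (j%:R / (2 ^ l)%:R) w]).
  by apply: bigcupT_measurable => n; exact: measurable_dyadic_ge.
apply/seteqP; split => w /=.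
  by move=> /(lt_exit_timeP _ _ t0)[n H]; exists n.
by move=> [n _ H]; apply/(lt_exit_timeP _ _ t0); exists n.
Qed.

(** Each time has a neighbourhood on which the path is bounded below, by right continuity on one
    side and the left limit on the other; compactness of [[0, t]] does the rest. Without this bound
    [inf] would only return a conventional value. *)
Lemma path_lower_bound (t : R) w : has_lbound [set X s w | s in `[0, t]].
Proof.
have [_ _ _ rc ll] := XL.
have /compact_near_coveringP cov := @segment_compact R 0 t.
have := cov R (pinfty_nbhs R) (fun M v => 0 <= v -> - M <= X v w) _.
move=> /(_ _)[].
  move=> s /=; rewrite in_itv/= => /andP[s0 st].
  have right : \forall v \near s, s < v -> X s w - 1 <= X v w.
    by apply: (@cvgr_ge _ _ s^'+ _ (fun v => X v w) (X s w) (rc w s s0)); rewrite ltrBlDr ltrDl.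
  have [l left] : exists l : R, \forall v \near s, 0 <= v -> v < s -> l <= X v w.
    have [s00|s00] := eqVneq s 0.
      by exists 0; apply: (@nearW _ (nbhs s)) => v v0; rewrite s00 ltNge v0.
    have [l Xl] := ll w s ltac:(by rewrite lt_neqAle eq_sym s00).
    exists (l - 1).
    have : \forall v \near s, v < s -> l - 1 <= X v w.
      by apply: (@cvgr_ge _ _ s^'- _ (fun v => X v w) l Xl); rewrite ltrBlDr ltrDl.
    by apply: filterS => v H _; exact: H.
  pose M := Num.max (- (X s w - 1)) (Num.max (- l) (- X s w)).
  exists ([set v | 0 <= v -> - M <= X v w], [set M' | M <= M']); last first.
    by move=> [v M'] /= [H MM] v0; rewrite (le_trans _ (H v0))// lerN2.
  split => /=; last exact: nbhs_pinfty_ge (num_real _).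
  apply: filterS2 left right => v lv rv v0; rewrite lerNl /M !le_max !lerN2.
  have [vs|sv|->] := ltgtP v s.
  - by rewrite (lv v0 vs) !orbT.
  - by rewrite (rv sv).
  - by rewrite lexx !orbT.
move=> M [_ HM]; exists (- (M + 1)) => _ [s /= sI <-].
apply: (HM (M + 1) _ s) => //; first by rewrite ltrDl.
by move: sI; rewrite in_itv/= => /andP[].
Qed.

End Paths.

Section RunningInf.
Context {d : measure_display} {T : measurableType d} {R : realType}.
Variable P : probability T R.
Variables (X : R -> {RV P >-> R}) (XL : levy_process X).

Let N t w := running_inf (fun t => X t) t w.
Let X0 w : X 0 w = 0. Proof. by have [X0 _ _ _ _] := XL. Qed.

Lemma le_running_inf (y t : R) w : 0 <= t ->
  y <= N t w <-> forall s, 0 <= s -> s <= t -> y <= X s w.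
Proof.
move=> t0; split=> [yN s s0 st|H].
  apply: (le_trans yN); apply: ge_inf; first exact: path_lower_bound.
  by exists s => //=; rewrite in_itv/= s0.
apply: lb_le_inf.
  by exists (X 0 w), 0 => //=; rewrite in_itv/= lexx.
by move=> _ [s /= + <-]; rewrite in_itv/= => /andP[s0 st]; exact: H.
Qed.

Lemma running_inf_le0 t w : 0 <= t -> N t w <= 0.
Proof.
by move=> t0; rewrite -(X0 w); apply: (iffLR (le_running_inf _ _ t0) (lexx _)).
Qed.

Lemma running_inf_nonincreasing s t w : 0 <= s -> s <= t -> N t w <= N s w.
Proof.
move=> s0 st; apply/le_running_inf => // u u0 us.
apply: (iffLR (le_running_inf _ _ _) (lexx (N t w))) => //; first exact: le_trans st.
exact: le_trans st.
Qed.

(** Time [t] needs its own condition: right continuity reaches from dyadic times only the times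
    strictly before [t]. *)
Lemma le_running_inf_dyadic (y t : R) w : 0 <= t -> y <= N t w <->
  (forall l j : nat, j%:R / (2 ^ l)%:R < t -> y <= X (j%:R / (2 ^ l)%:R) w) /\ y <= X t w.
Proof.
move=> t0; rewrite le_running_inf//; split=> [H|[/(ge_on_dyadics XL) H1 H2] s s0].
  split=> [l j jt|]; last exact: H.
  by apply: H; [rewrite divr_ge0|exact: ltW].
by rewrite le_eqVlt => /predU1P[->//|st]; exact: H1.
Qed.

Lemma measurable_running_inf t : 0 <= t -> measurable_fun setT (N t).
Proof.
move=> t0; apply: (measurability (@RGenCInfty.G R)) => [|/= _ [_] [y] -> <-].
  exact: RGenCInfty.measurableE.
rewrite setTI (_ : _ @^-1` _ = [set w | forall l j : nat,
    j%:R / (2 ^ l)%:R < t -> y <= X (j%:R / (2 ^ l)%:R) w] `&` [set w | y <= X t w]).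
  by apply: measurableI; [exact: measurable_dyadic_ge|exact: measurable_ge].
apply/seteqP; split => w /=; rewrite in_itv/= andbT.
  by move=> /(le_running_inf_dyadic _ _ t0).
by move=> H; apply/(le_running_inf_dyadic _ _ t0).
Qed.

Lemma running_inf_exit_time (x t : R) w : (t%:E < exit_time (fun t => X t) x w)%E ->
  0 <= t -> - x <= N t w.
Proof.
by move=> tt t0; apply/le_running_inf => // s s0 st; exact: exit_time_gt_ge tt _ _.
Qed.

Let S l := skeleton X (2 ^ l).
Let Z l j w := running_min (fun k => S l k) j w.

Let pow2_gt0 l : (0 < 2 ^ l)%N. Proof. by rewrite expn_gt0. Qed.
Let pow2R_gt0 l : 0 < (2 ^ l)%:R :> R. Proof. by rewrite ltr0n. Qed.

Lemma le_skeleton_min (y : R) l j w : y <= Z l j w <->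
  forall i, (i <= j)%N -> y <= X (i%:R / (2 ^ l)%:R) w.
Proof.
rewrite /Z /running_min (le_bigmin_nat0 (u := fun i => S l i w))//.
by rewrite /S /skeleton mul0r.
Qed.

Lemma running_inf_le_skeleton_min l j w : N (j%:R / (2 ^ l)%:R) w <= Z l j w.
Proof.
apply/le_skeleton_min => i ij.
have j0 : 0 <= j%:R / (2 ^ l)%:R :> R by rewrite divr_ge0.
apply: (iffLR (le_running_inf _ _ j0) (lexx _)); first by rewrite divr_ge0.
by rewrite ler_pM2r ?invr_gt0// ler_nat.
Qed.

Lemma skeleton_min_le0 l j w : Z l j w <= 0.
Proof.
have := iffLR (le_skeleton_min _ l j w) (lexx _) 0%N (leq0n _).
by rewrite mul0r X0.
Qed.

Lemma dyadic_refine i l k : (i <= l)%N ->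
  (k * 2 ^ (l - i))%:R / (2 ^ l)%:R = k%:R / (2 ^ i)%:R :> R.
Proof.
move=> il; rewrite -{2}(subnKC il) expnD !natrM.
have := pow2R_gt0 i; have := pow2R_gt0 (l - i).
by move: (2 ^ (l - i))%:R (2 ^ i)%:R => a b a0 b0; field; rewrite !gt_eqF.
Qed.

Lemma skeleton_min_refine i l k j w : (i <= l)%N -> (k * 2 ^ (l - i) <= j)%N ->
  Z l j w <= Z i k w.
Proof.
move=> il kj; apply/le_skeleton_min => a ak; rewrite -(dyadic_refine a il).
apply: (iffLR (le_skeleton_min _ l j w) (lexx _)).
by rewrite (leq_trans _ kj)// leq_mul2r ak orbT.
Qed.

(** A running infimum below [y] is witnessed at some dyadic time or at the endpoint, itself dyadic
    here, and this time belongs to all finer grids. *)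
Lemma skeleton_min_near (i k : nat) (y : R) w : N (k%:R / (2 ^ i)%:R) w < y ->
  \forall l \near \oo, Z l (k * 2 ^ (l - i))%N w < y.
Proof.
have t0 : 0 <= k%:R / (2 ^ i)%:R :> R by rewrite divr_ge0.
rewrite ltNge => /negP /(contra_not (iffRL (le_running_inf_dyadic _ _ t0))) H.
have [l0 [j0 [jt Xy]]] : exists l0 j0 : nat,
    j0%:R / (2 ^ l0)%:R <= k%:R / (2 ^ i)%:R :> R /\ X (j0%:R / (2 ^ l0)%:R) w < y.
  apply: contrapT => /forallNP nE; apply: H; split=> [l j jt|].
    rewrite leNgt; apply/negP => Xy; apply: (nE l); exists j; split => //.
    exact: ltW.
  rewrite leNgt; apply/negP => Xy; apply: (nE i); exists k; split => //.
apply/near_infty_ex; exists (l0 + i)%N => l ll.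
have l0l : (l0 <= l)%N by exact: leq_trans (leq_addr _ _) ll.
have il : (i <= l)%N by exact: leq_trans (leq_addl _ _) ll.
apply: le_lt_trans Xy; rewrite -(dyadic_refine j0 l0l).
apply: (iffLR (le_skeleton_min _ l _ w) (lexx _)).
have p0 : 0 < ((2 ^ l)%:R)^-1 :> R by rewrite invr_gt0.
by rewrite -(ler_nat R) -(ler_pM2r p0) !dyadic_refine.
Qed.

Lemma measurable_skeleton_min l j : measurable_fun setT (Z l j).
Proof.
have rw : random_walk (S l) by exact: skeleton_random_walk.
rewrite (_ : Z l j = fun w => lmin 0 j (fun n => S l n.+1 w - S l n w)).
  exact: (measurable_walk_min (random_walk_iid rw)).
by apply/funext => w; rewrite (walk_lmin rw).
Qed.

End RunningInf.

(** * Passage to the limit along dyadic skeletons *)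

Section SumBlocks.
Context {R : realType}.

Lemma mesh_cvg0 : (2 ^ l)%:R^-1 @[l --> \oo] --> (0 : R).
Proof.
rewrite (_ : (fun l => _) = fun l => 2^-1 ^+ l); last first.
  by apply/funext => l; rewrite natrX exprVn.
by apply: cvg_expr; rewrite ger0_norm ?invr_ge0// invf_lt1// ltr1n.
Qed.

Lemma ler_sum_blocks (F G : nat -> R) (m n b : nat) : (0 < b)%N -> (m <= n)%N ->
  (forall j, (m * b <= j < n * b)%N -> F j <= G (j %/ b)%N) ->
  \sum_(m * b <= j < n * b) F j <= b%:R * \sum_(m <= k < n) G k.
Proof.
move=> b0 mn FG.
have -> : b%:R * \sum_(m <= k < n) G k = \sum_(m * b <= j < n * b) G (j %/ b)%N.
  have mbn : (m * b <= n * b)%N by rewrite leq_mul2r mn orbT.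
  have := sum_divn G n b0.
  rewrite (@big_cat_nat _ _ _ (m * b))//= sum_divn//.
  rewrite [in RHS](@big_cat_nat _ _ _ m)//= mulrDr.
  by move/addrI.
by apply: ler_sum_nat => j jb; exact: FG.
Qed.

Lemma series_nonneg_le_limit (F : nat -> R) (s : R) (n : nat) : (forall j, 0 <= F j) ->
  [series F j]_j @ \oo --> s -> \sum_(0 <= j < n) F j <= s.
Proof.
move=> F0 Fs; apply: (cvg_ge_cst Fs); exists n => // k /= nk.
by rewrite /series /= (@big_cat_nat _ _ _ n 0 k)//= lerDl sumr_ge0.
Qed.

End SumBlocks.

(** * Upper bound on the mesh sums as the mesh is refined *)

Section UpperLimit.
Context {R : realType}.
Variables (gamma : R) (Q : nat -> nat -> R) (q : R -> R) (s : nat -> R) (W : R).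
Let h (l : nat) : R := ((2 ^ l)%:R)^-1.
Let t l (j : nat) : R := j%:R * h l.
Hypothesis gamma0 : 0 <= gamma.
Hypothesis Q0 : forall l j, 0 <= Q l j.
Hypothesis Q_refine : forall i l k j, (i <= l)%N -> (k * 2 ^ (l - i) <= j)%N -> Q l j <= Q i k.
Hypothesis Q_cvg : forall i k, Q l (k * 2 ^ (l - i))%N @[l --> \oo] --> q (t i k).
Hypothesis q0 : q 0 <= 1.
Hypothesis s_sum : forall l, [series h l * (expR (gamma * t l j) * Q l j)]_j @ \oo --> s l.
Hypothesis W_ge0 : 0 <= W.
Hypothesis W_sum : forall l K,
  \sum_(1 <= k < K) h l * (expR (gamma * t l k.+1) * q (t l k)) <= expR (2 * (gamma * h l)) * W.

Let h_gt0 l : 0 < h l. Proof. by rewrite invr_gt0 ltr0n expn_gt0. Qed.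

Let h_refine i l : (i <= l)%N -> (2 ^ (l - i))%:R * h l = h i.
Proof.
move=> il; by rewrite /h -{2}(subnK il) expnD natrM invfM mulrA divff ?mul1r//.
Qed.

Let t_block i l j : (i <= l)%N -> t l j <= t i (j %/ 2 ^ (l - i)).+1.
Proof.
move=> il; rewrite /t -(h_refine il) mulrA -natrM ler_pM2r// ler_nat ltnW// ltn_ceil//.
by rewrite expn_gt0.
Qed.

Let term_ge0 l j : 0 <= h l * (expR (gamma * t l j) * Q l j).
Proof. by rewrite !mulr_ge0 ?expR_ge0// ltW. Qed.

Let block_le i l m n : (i <= l)%N -> (m <= n)%N ->
  \sum_(m * 2 ^ (l - i) <= j < n * 2 ^ (l - i)) h l * (expR (gamma * t l j) * Q l j) <=
  \sum_(m <= k < n) h i * (expR (gamma * t i k.+1) * Q l (k * 2 ^ (l - i))%N).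
Proof.
move=> il mn.
have b0 : (0 < 2 ^ (l - i))%N by rewrite expn_gt0.
apply: le_trans (ler_sum_blocks (G := fun k => h l * (expR (gamma * t i k.+1) *
   Q l (k * 2 ^ (l - i))%N)) b0 mn _) _.
  move=> j _; apply: ler_wpM2l; first exact: ltW.
  apply: ler_pM; [exact: expR_ge0|exact: Q0| |].
    by rewrite ler_expR ler_wpM2l// t_block.
  by apply: Q_refine => //; rewrite subnn expn0 muln1 leq_divM.
rewrite mulr_sumr; apply: ler_sum => k _.
by rewrite mulrA h_refine.
Qed.

(** The tails of all series [s l] are dominated at once by the tail of the series of mesh 1. On the
    remaining bounded range the sums of mesh [l] are compared with those of a fixed mesh [i], whose
    finitely many terms converge as [l] grows. *)
Lemma upper_limit (e : R) (L : nat) : 0 < e -> exists2 l, (L <= l)%N & s l <= W + e.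
Proof.
move=> e0.
have e4 : 0 < e / 4 by rewrite divr_gt0.
(* Grouping by unit blocks moves the weight to the right end of the block, which costs the factor
   [expR gamma]. *)
have [J HJ] : exists J : nat, expR gamma * (s 0%N -
    \sum_(0 <= j < J) h 0 * (expR (gamma * t 0 j) * Q 0 j)) <= e / 4.
  have c : expR gamma * (s 0%N - [series h 0 * (expR (gamma * t 0 j) * Q 0 j)]_j n)
      @[n --> \oo] --> expR gamma * (s 0%N - s 0%N).
    by apply: cvgMr; apply: cvgB; [exact: cvg_cst|exact: s_sum].
  rewrite subrr mulr0 in c.
  by move/cvgr_le : c => /(_ _ e4)/near_infty_ex[J HJ]; exists J; exact: HJ.
have tail l M : (J <= M)%N ->
    \sum_(J * 2 ^ l <= j < M * 2 ^ l) h l * (expR (gamma * t l j) * Q l j) <= e / 4.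
  move=> JM; have := @block_le 0 l J M (leq0n _) JM; rewrite subn0 => /le_trans; apply.
  apply: le_trans HJ.
  apply: (@le_trans _ _ (expR gamma * \sum_(J <= k < M) h 0 * (expR (gamma * t 0 k) * Q 0 k))).
    rewrite mulr_sumr; apply: ler_sum => k _.
    rewrite [leRHS]mulrCA; apply: ler_wpM2l; first exact: ltW.
    rewrite [leRHS]mulrA -expRD.
    have -> : gamma + gamma * t 0 k = gamma * t 0 k.+1.
      by rewrite /t /h expn0 invr1 !mulr1 -natr1 mulrDr mulr1 addrC.
    apply: ler_wpM2l; first exact: expR_ge0.
    by apply: Q_refine => //; rewrite subn0.
  apply: ler_wpM2l; first exact: expR_ge0.
  rewrite lerBrDl -big_cat_nat//=.
  by apply: series_nonneg_le_limit => // j; exact: term_ge0.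
have sl l : s l <= \sum_(0 <= j < J * 2 ^ l) h l * (expR (gamma * t l j) * Q l j) + e / 4.
  apply: (cvg_le_cst (s_sum (l := l))); exists J => // M /= JM.
  have p2 : (0 < 2 ^ l)%N by rewrite expn_gt0.
  apply: (@le_trans _ _ (\sum_(0 <= j < M * 2 ^ l) h l * (expR (gamma * t l j) * Q l j))).
    apply: ler_sum_nat_subrange => [//||j]; last exact: term_ge0.
    by rewrite leq_pmulr.
  rewrite (@big_cat_nat _ _ _ (J * 2 ^ l))//=; last by rewrite leq_mul2r JM orbT.
  by rewrite lerD2l; exact: tail.
(* The first summand is the cell [k = 0], where only [q 0 <= 1] is available; the second bounds all
   the later cells through [W_sum]. *)
have [i Hi] : exists i, h i * expR (gamma * h i) + expR (2 * (gamma * h i)) * W <= W + e / 4.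
  have h0 : h i @[i --> \oo] --> (0 : R) by exact: mesh_cvg0.
  have c : h i * expR (gamma * h i) + expR (2 * (gamma * h i)) * W @[i --> \oo] -->
      0 * expR (gamma * 0) + expR (2 * (gamma * 0)) * W.
    apply: cvgD; [apply: cvgM => //|apply: cvgMl].
      by apply: continuous_cvg; [exact: continuous_expR|exact: cvgMr].
    apply: continuous_cvg; [exact: continuous_expR|].
    by apply: cvgMr; exact: cvgMr.
  rewrite mul0r add0r mulr0 mulr0 expR0 mul1r in c.
  have : W < W + e / 4 by rewrite ltrDl.
  by move/cvgr_le: c => /[apply]/near_infty_ex[i Hi]; exists i; exact: Hi.
have c : \sum_(0 <= k < J * 2 ^ i) h i * (expR (gamma * t i k.+1) * Q l (k * 2 ^ (l - i))%N)
    @[l --> \oo] --> \sum_(0 <= k < J * 2 ^ i) h i * (expR (gamma * t i k.+1) * q (t i k)).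
  apply: cvg_big; first exact: add_continuous.
  by move=> k _; apply: cvgMr; apply: cvgMr; exact: Q_cvg.
have qW : \sum_(0 <= k < J * 2 ^ i) h i * (expR (gamma * t i k.+1) * q (t i k)) <= W + e / 4.
  apply: le_trans Hi.
  case: (J * 2 ^ i)%N => [|K].
    by rewrite big_nil addr_ge0// mulr_ge0 ?expR_ge0// ltW.
  rewrite big_ltn//=; apply: lerD; last exact: W_sum.
  rewrite /t mul0r mul1r; apply: ler_wpM2l; first exact: ltW.
  by rewrite ler_piMr// expR_ge0.
have : W + e / 4 < W + e / 2 by rewrite ltrD2l; lra.
move=> /(le_lt_trans qW); move/cvgr_le: c => /[apply]/near_infty_ex[l0 Hl].
exists (maxn l0 (maxn i L)); first by rewrite !leq_max leqnn !orbT.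
set l := maxn _ _.
have l0l : (l0 <= l)%N by rewrite leq_maxl.
have il : (i <= l)%N by rewrite /l !leq_max leqnn orbT.
apply: (le_trans (sl l)).
have := @block_le i l 0 (J * 2 ^ i) il (leq0n _).
rewrite mul0n -mulnA -expnD subnKC// => H.
have := le_trans H (Hl _ l0l); lra.
Qed.

End UpperLimit.

(** * A lower bound on survival that is uniform in the mesh *)

Section LowerBound.
Context {d : measure_display} {T : measurableType d} {R : realType}.
Variable P : probability T R.
Variables (X : R -> {RV P >-> R}) (XL : levy_process X) (gamma alpha x : R).
Hypothesis gamma0 : 0 <= gamma.
Hypothesis alpha0 : 0 <= alpha.
Hypothesis x0 : 0 <= x.

Let h (l : nat) : R := ((2 ^ l)%:R)^-1.
Let N t w := running_inf (fun t => X t) t w.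
Let S l := skeleton X (2 ^ l).
Let Z l j w := running_min (fun k => S l k) j w.
Let q t := trunc_moment P alpha x (N t).
Let Q l j := trunc_moment P alpha x (Z l j).

Let h_gt0 l : 0 < h l. Proof. by rewrite invr_gt0 ltr0n expn_gt0. Qed.
Let t_ge0 l (j : nat) : 0 <= j%:R * h l. Proof. by rewrite mulr_ge0// ltW. Qed.
Let mZ l j : measurable_fun setT (Z l j). Proof. exact: measurable_skeleton_min. Qed.
Let mN t : 0 <= t -> measurable_fun setT (N t). Proof. exact: measurable_running_inf. Qed.
Let Z_le0 l j w : Z l j w <= 0. Proof. exact: skeleton_min_le0. Qed.

Lemma h_refine i l : (i <= l)%N -> (2 ^ (l - i))%:R * h l = h i.
Proof.
by move=> il; rewrite /h -{2}(subnK il) expnD natrM invfM mulrA divff ?mul1r// pnatr_eq0 expn_eq0.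
Qed.

Let K l k j := \int[P]_w (if - x <= Z l j w then prob_ge P (S l k) (- x - Z l j w) else 0).

Lemma skeleton_spitzer l n : n%:R * fine (P [set w | - x <= Z l n w]) =
  \sum_(1 <= k < n.+1) K l k (n - k)%N.
Proof.
have rw : random_walk (S l) by exact: skeleton_random_walk.
have ZE j w : lmin 0 j (fun n => S l n.+1 w - S l n w) = Z l j w by exact: walk_lmin.
rewrite (_ : [set w | _] = [set w | - x <= lmin 0 n (fun n => S l n.+1 w - S l n w)]); last first.
  by apply/seteqP; split => w /=; rewrite ZE.
rewrite (spitzer_survival (random_walk_iid rw)); apply: eq_bigr => k _.
by apply: eq_Rintegral => w _; rewrite ZE (walk_psum_fun rw).
Qed.

Lemma ler_sum_reflect (F : nat -> nat -> R) n M : (M <= n)%N -> (forall k j, 0 <= F k j) ->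
  \sum_(0 <= j < M) F (n - j)%N j <= \sum_(1 <= k < n.+1) F k (n - k)%N.
Proof.
move=> Mn F0.
apply: le_trans (ler_sum_nat_subrange (m := (n - M).+1) (n := n.+1) _ _ _) => //.
rewrite [leRHS]big_nat_rev/= -{1}[(n - M).+1]add0n big_addn.
rewrite (_ : (n.+1 - (n - M).+1 = M)%N); last by rewrite subSS subKn.
apply: ler_sum_nat => j /andP[_ jM].
by rewrite le_eqVlt; apply/orP; left; apply/eqP; congr (F _ _); lia.
Qed.

Let K_ge0 l k j : 0 <= K l k j.
Proof. by apply: Rintegral_ge0 => w _; case: ifP => // _; exact: prob_ge_ge0. Qed.

Section Survival.
(** The exponent [i] fixes a coarse grid, while the finer exponent [l] will tend to infinity. The
    number [theta], close to 1, absorbs four losses: the shift of the level by [2 * delta], the mesh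
    of the weight, a short jump, and the convergence of the coarse tails. *)
Variables (k i J : nat) (theta delta c : R).
Hypothesis theta0 : 0 <= theta.
Hypothesis c0 : 0 <= c.
Hypothesis theta_delta : theta <= expR (- (2 * alpha * delta)).
Hypothesis theta_mesh : theta <= expR (- (gamma * h i)).
Hypothesis theta_jump : forall r, 0 <= r -> r <= h i -> theta <= prob_ge P (X r) (- delta).
Hypothesis theta_level : forall (b : nat) y, (b <= J * 2 ^ i)%N -> - x <= y -> y <= 0 ->
  theta * (expR (- (alpha * (y + 2 * delta))) * expR (gamma * (b%:R * h i)) *
    prob_ge P (S i k) 0) <= prob_ge P (S i (k - b)%N) (y + delta).
Hypothesis c_le : forall l, c <= expR (gamma * h l) *
  \sum_(0 <= j < J * 2 ^ l) h l * (expR (gamma * (j%:R * h l)) * q (j%:R * h l)).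
Hypothesis Jk : (J * 2 ^ i < k)%N.

(** The remaining time on the fine grid, rounded down to the coarse grid: [b] coarse steps are
    removed and a remainder [r] of at most one coarse step is left. *)
Let step_time l j : (i <= l)%N -> (j < J * 2 ^ l)%N ->
  let b := (j %/ 2 ^ (l - i)).+1 in
  [/\ (b <= J * 2 ^ i)%N, j%:R * h l <= b%:R * h i &
   exists r, [/\ 0 <= r, r <= h i &
     (k * 2 ^ (l - i) - j)%:R * h l = (k - b)%:R * h i + r]].
Proof.
move=> il jJ b; set p2 := (2 ^ (l - i))%N.
have p20 : (0 < p2)%N by rewrite expn_gt0.
have bJ : (b <= J * 2 ^ i)%N.
  by rewrite /b ltn_divLR// -mulnA -expnD subnKC.
have jb : (j <= b * p2)%N by rewrite ltnW// ltn_ceil.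
have bj : (b * p2 <= j + p2)%N by rewrite /b mulSn addnC leq_add2r leq_divM.
have hE : h i = p2%:R * h l by rewrite h_refine.
have bk : (b <= k)%N by exact: leq_trans bJ (ltnW Jk).
have jk : (j <= k * p2)%N by rewrite (leq_trans jb)// leq_mul2r bk orbT.
split => //; first by rewrite hE mulrA -natrM ler_pM2r// ler_nat.
exists ((b * p2 - j)%:R * h l); split.
- by rewrite mulr_ge0// ltW.
- by rewrite hE ler_pM2r// ler_nat leq_subLR.
- rewrite hE mulrA -mulrDl -natrM -natrD; congr (_%:R * _).
  rewrite mulnBl; move: jb jk; have : (b * p2 <= k * p2)%N by rewrite leq_mul2r bk orbT.
  by clear; lia.
Qed.

Let Sk := prob_ge P (S i k) 0.
Let Sk0 : 0 <= Sk. Proof. exact: prob_ge_ge0. Qed.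

(** The process is asked to reach [y + delta] at the coarse time and to lose at most [delta] during
    the remainder. The three factors [theta] pay for the coarse tail, the jump and the level
    shift. *)
Let level l j y : (i <= l)%N -> (j < J * 2 ^ l)%N -> - x <= y -> y <= 0 ->
  theta ^+ 3 * Sk * (expR (gamma * (j%:R * h l)) * expR (- (alpha * y)))
   <= prob_ge P (S l (k * 2 ^ (l - i) - j)%N) y.
Proof.
move=> il jJ xy y0; have [bJ jb [r [r0 ri rE]]] := step_time il jJ.
set b := _.+1 in bJ jb rE.
have SE : S l (k * 2 ^ (l - i) - j)%N = X ((k - b)%:R * h i + r).
  by rewrite /S /skeleton -/(h l) rE.
rewrite SE.
have := levy_prob_ge_split XL y (- delta) (t_ge0 i (k - b)%N) r0.
apply: le_trans; rewrite opprK.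
have lev := theta_level bJ xy y0; have jmp := theta_jump r0 ri.
apply: (@le_trans _ _ (theta * (expR (- (alpha * (y + 2 * delta))) * expR (gamma * (b%:R * h i)) *
    Sk) * theta)); last first.
  by apply: ler_pM => //; rewrite !mulr_ge0// expR_ge0.
rewrite [leLHS](_ : _ = theta * (theta * expR (- (alpha * y)) * expR (gamma * (j%:R * h l)) * Sk) * theta); last by ring.
apply: ler_wpM2r => //; apply: ler_wpM2l => //; apply: ler_wpM2r => //.
apply: ler_pM; rewrite ?mulr_ge0 ?expR_ge0//; last by rewrite ler_expR ler_wpM2l.
rewrite (_ : - (alpha * (y + 2 * delta)) = - (2 * alpha * delta) + - (alpha * y)); last by ring.
by rewrite expRD ler_wpM2r// expR_ge0.
Qed.

(** Only the terms of the recursion with [j < J * 2 ^ l] are kept. The left-hand side does not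
    depend on [l], so the mesh can tend to 0 with the time [k * h i] fixed; the fourth [theta] comes
    from the weight in [c_le]. *)
Lemma survival_lower l : (i <= l)%N ->
  theta ^+ 4 * expR (alpha * x) * c * Sk <=
  (k%:R * h i) * fine (P [set w | - x <= Z l (k * 2 ^ (l - i))%N w]).
Proof.
move=> il; set n := (k * 2 ^ (l - i))%N.
have Jn : (J * 2 ^ l <= n)%N.
  by rewrite /n -(subnKC il) expnD mulnA subnKC// leq_mul2r (ltnW Jk) orbT.
have -> : k%:R * h i = h l * n%:R.
  by rewrite /n natrM -(h_refine il); ring.
rewrite -[leRHS]mulrA skeleton_spitzer.
have kern j : (j < J * 2 ^ l)%N ->
    theta ^+ 3 * Sk * expR (alpha * x) * (expR (gamma * (j%:R * h l)) * Q l j) <= K l (n - j)%N j.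
  move=> jJ.
  rewrite /Q /trunc_moment.
  set cst_ := theta ^+ 3 * Sk * expR (alpha * x).
  have mt := measurable_trunc alpha x (mZ l j).
  have bt w : `|if - x <= Z l j w then expR (alpha * Z l j w) else 0| <= 1.
    exact: expR_trunc_bound.
  rewrite mulrA -RintegralZl//; last exact: bounded_integrable bt.
  pose C := `|cst_ * expR (gamma * (j%:R * h l))| + 1.
  apply: (@le_Rintegral_bounded _ _ _ P _ _ C).
  - exact: measurable_funM.
  - apply: (@measurable_if_ge _ _ _ (- x) (Z l j) (fun z => prob_ge P (S l (n - j)%N) (- x - z))) => //.
    apply: (measurableT_comp (measurable_prob_ge P _)) => //.
    by apply: measurable_funB.
  - by move=> w; rewrite normrM ler_wpDr// ler_piMr.
  - move=> w; apply: (@le_trans _ _ 1); last by rewrite lerDr.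
    case: ifP => _; last by rewrite normr0.
    by rewrite ger0_norm ?prob_ge_ge0// prob_ge_le1.
  - move=> w; case: ifP => [xZ|_]; last by rewrite mulr0.
    have y1 : - x <= - x - Z l j w by rewrite lerDl oppr_ge0.
    have y2 : - x - Z l j w <= 0 by rewrite lerBlDr add0r.
    apply: le_trans (level il jJ y1 y2).
    rewrite /cst_ (_ : - (alpha * (- x - Z l j w)) = alpha * x + alpha * Z l j w); last by ring.
    by rewrite expRD le_eqVlt; apply/orP; left; apply/eqP; ring.
have sum_le : theta ^+ 3 * Sk * expR (alpha * x) *
    \sum_(0 <= j < J * 2 ^ l) (expR (gamma * (j%:R * h l)) * Q l j) <=
    \sum_(1 <= k0 < n.+1) K l k0 (n - k0)%N.
  apply: le_trans (ler_sum_reflect Jn _); last by move=> *; exact: K_ge0.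
  by rewrite mulr_sumr ler_sum_nat// => j /andP[_ jJ]; exact: kern.
apply: le_trans (ler_wpM2l (ltW (h_gt0 l)) sum_le).
have cl : c * theta <= h l * \sum_(0 <= j < J * 2 ^ l) (expR (gamma * (j%:R * h l)) * Q l j).
  have hli : h l <= h i.
    by rewrite /h lef_pV2 ?posrE ?ltr0n ?expn_gt0// ler_nat leq_exp2l.
  have ql : h l * \sum_(0 <= j < J * 2 ^ l) (expR (gamma * (j%:R * h l)) * Q l j) >=
      \sum_(0 <= j < J * 2 ^ l) h l * (expR (gamma * (j%:R * h l)) * q (j%:R * h l)).
    rewrite mulr_sumr; apply: ler_sum => j _; apply: ler_wpM2l; first exact: ltW.
    apply: ler_wpM2l; first exact: expR_ge0.
    apply: le_trunc_moment => //; first exact: mN.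
    by move=> w; exact: running_inf_le_skeleton_min.
  apply: le_trans ql; have := c_le l; rewrite mulrC -ler_pdivrMr ?expR_gt0// -expRN.
  apply: le_trans; apply: ler_wpM2l => //; apply: (le_trans theta_mesh).
  by rewrite ler_expR lerN2 ler_wpM2l.
rewrite mulrCA; apply: (@le_trans _ _ (theta ^+ 3 * Sk * expR (alpha * x) * (c * theta))).
  by rewrite le_eqVlt; apply/orP; left; apply/eqP; ring.
by apply: ler_wpM2l => //; rewrite !mulr_ge0 ?expR_ge0// exprn_ge0.
Qed.

End Survival.
End LowerBound.

Section MeshLimits.
Context {R : realType}.

Lemma expR_mesh_cvg1 (a : R) : expR (a * (2 ^ l)%:R^-1) @[l --> \oo] --> (1 : R).
Proof.
have c : a * (2 ^ l)%:R^-1 @[l --> \oo] --> a * 0 by apply: cvgMr; exact: mesh_cvg0.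
have : expR (a * (2 ^ l)%:R^-1) @[l --> \oo] --> expR (a * 0).
  by apply: continuous_cvg => //; exact: continuous_expR.
by rewrite mulr0 expR0.
Qed.

Lemma expRN_step (a theta : R) : 0 <= a -> 0 < theta -> theta < 1 ->
  exists2 delta, 0 < delta & theta <= expR (- (a * delta)).
Proof.
move=> a0 t0 t1; have e0 : 0 < theta^-1 - 1 by rewrite subr_gt0 invf_gt1.
have [delta d0 dle] := expR_small_step a0 e0.
exists delta => //; rewrite expRN -[leLHS]invrK lef_pV2 ?posrE ?expR_gt0 ?invr_gt0//.
by rewrite subrKC in dle.
Qed.

Lemma near_pinfty_truncn (m : nat) (Q : nat -> Prop) : (0 < m)%N ->
  (\forall n \near \oo, Q n) -> \forall t \near +oo%R, Q (Num.truncn (t * m%:R : R)).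
Proof.
move=> m0 /near_infty_ex[N HN]; near=> t; apply: HN.
have Nt : N%:R <= t by near: t; exact: nbhs_pinfty_ge (num_real _).
have t0 : 0 <= t by exact: le_trans Nt.
have tm : t <= t * m%:R by rewrite ler_peMr// ler1n.
rewrite -ltnS -(ltr_nat R) (le_lt_trans Nt)// (le_lt_trans tm)//.
exact: truncnS_gt.
Unshelve. all: by end_near. Qed.

Lemma truncn_mesh_div (t : R) (m : nat) : 0 <= t -> (0 < m)%N ->
  (Num.truncn (t * m%:R) %/ m = Num.truncn t)%N.
Proof.
move=> t0 m0; set n := Num.truncn _.
have tm0 : 0 <= t * m%:R by rewrite mulr_ge0.
have /andP[n1 n2] := truncn_itv tm0; rewrite -/n in n1 n2.
apply/esym/truncn_def; apply/andP; split.
  have : (n %/ m * m)%:R <= t * m%:R by rewrite (le_trans _ n1)// ler_nat leq_divM.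
  by rewrite natrM ler_pM2r// ltr0n.
have : t * m%:R < ((n %/ m).+1 * m)%:R by rewrite (lt_le_trans n2)// ler_nat ltn_ceil.
by rewrite natrM ltr_pM2r// ltr0n.
Qed.

Lemma floor_truncn (t : R) : 0 <= t -> (Num.floor t)%:~R = (Num.truncn t)%:R :> R.
Proof.
move=> t0; rewrite truncn_floor t0.
have f0 : (0 <= Num.floor t)%R by rewrite floor_ge0.
by case: (Num.floor t) f0.
Qed.

End MeshLimits.

Section LowerAsymptotics.
Context {d : measure_display} {T : measurableType d} {R : realType}.
Variable P : probability T R.
Variables (X : R -> {RV P >-> R}) (XL : levy_process X) (gamma alpha x : R).
Hypothesis gamma0 : 0 <= gamma.
Hypothesis alpha0 : 0 <= alpha.
Hypothesis x0 : 0 <= x.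
Hypothesis tails : tail_conditions P gamma alpha (fun n => X n%:R).

Let h (l : nat) : R := ((2 ^ l)%:R)^-1.
Let N t w := running_inf (fun t => X t) t w.
Let S l := skeleton X (2 ^ l).
Let Z l j w := running_min (fun k => S l k) j w.
Let q t := trunc_moment P alpha x (N t).
Let G l k := prob_ge P (S l k).
Let p n := prob_ge P (X n%:R) 0.

Let h_gt0 l : 0 < h l. Proof. by rewrite invr_gt0 ltr0n expn_gt0. Qed.
Let p2 l : (0 < 2 ^ l)%N. Proof. by rewrite expn_gt0. Qed.

(** Uniformity in [r] comes from the running infimum on [[0, h i]], which by right continuity at 0
    exceeds [-delta] with probability tending to 1. *)
Lemma near_small_jump (theta delta : R) : theta < 1 -> 0 < delta ->
  \forall i \near \oo, forall r, 0 <= r -> r <= h i -> theta <= prob_ge P (X r) (- delta).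
Proof.
move=> t1 d0.
have mNh i : measurable_fun setT (N (h i)) by apply: measurable_running_inf => //; exact: ltW.
have c : \int[P]_w (if - delta <= N (h i) w then 1 else 0) @[i --> \oo] --> \int[P]_w (cst 1 w : R).
  apply: (@Rintegral_bounded_cvg _ _ _ _ _ _ 1) => //.
  - by move=> i; exact: (@measurable_if_ge _ _ _ (- delta) (N (h i)) (cst 1)).
  - by apply: nearW => i w; case: ifP; rewrite ?normr1 ?normr0.
  - move=> w; apply: cvg_near_cst.
    have [X0 _ _ rc _] := XL.
    have := @cvgr_ge _ _ 0^'+ _ (fun v => X v w) (X 0 w) (rc w 0 (lexx _)) (- delta).
    rewrite X0 oppr_lt0 => /(_ _ d0)/nbhs_ballP[e /= e0 He].
    have := mesh_cvg0 (R := R) => /cvgr_lt/(_ _ e0); apply: filterS => i hi.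
    rewrite ifT//; apply/(le_running_inf XL); first exact: ltW.
    move=> s s0 sh; have [->|sn0] := eqVneq s 0; first by rewrite X0 oppr_le0 ltW.
    have sp : 0 < s by rewrite lt_neqAle eq_sym sn0.
    apply: He => //; rewrite /ball /= sub0r normrN ger0_norm//.
    exact: le_lt_trans hi.
rewrite Rintegral_cst// mul1r in c.
have P1 : fine (P setT) = 1 by rewrite [X in fine X](_ : _ = 1%E)//; exact: probability_setT.
rewrite P1 in c; move/cvgr_ge : c => /(_ _ t1); apply: filterS => i Hi r r0 ri.
apply: (le_trans Hi); rewrite Rintegral_if; last by apply: measurable_ge.
apply: fine_probability_le; [exact: measurable_ge|exact: measurable_ge|].
move=> w /= dN; apply: (iffLR (le_running_inf XL _ w (ltW (h_gt0 i))) dN) => //.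
Qed.

Lemma skeleton_shift_ratio i b y :
  G i (k - b)%N y / G i k 0 @[k --> \oo] --> expR (- (alpha * y)) * expR (gamma * (b%:R * h i)).
Proof.
have c1 : G i (k - b)%N y / G i (k - b)%N 0 @[k --> \oo] --> expR (- (alpha * y)).
  rewrite (cvg_centern b (fun k => G i k y / G i k 0)).
  exact: (skeleton_level_ratio XL alpha0 tails (p2 i)).
have c2 : G i (k - b)%N 0 / G i k 0 @[k --> \oo] --> expR (gamma * (b%:R * h i)).
  rewrite (_ : gamma * (b%:R * h i) = gamma / (2 ^ i)%:R * b%:R); last first.
    by rewrite /h; ring.
  apply: (ratio_shift (a := fun k => G i k 0)).
    exact: (skeleton_prob_gt0 XL alpha0 tails (p2 i)).
  exact: (skeleton_time_ratio XL alpha0 tails (p2 i)).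
apply: cvg_trans (cvgM c1 c2); apply: near_eq_cvg.
have /near_infty_ex[M HM] := skeleton_prob_gt0 XL alpha0 tails (p2 i).
apply/near_infty_ex; exists (M + b)%N => k kM /=.
have g1 : G i (k - b)%N 0 != 0 by rewrite gt_eqF// HM// leq_subRL// ?(leq_trans (leq_addl _ _) kM)// addnC.
by rewrite mulrA divfK.
Qed.

(** The tail ratios converge at each level separately. Monotonicity in the level reduces the
    interval [[-x, 0]] to finitely many levels with spacing [delta]. *)
Lemma near_level (i B : nat) (theta delta : R) : 0 <= theta -> theta < 1 -> 0 < delta ->
  \forall k \near \oo, forall (b : nat) y, (b <= B)%N -> - x <= y -> y <= 0 ->
    theta * (expR (- (alpha * (y + 2 * delta))) * expR (gamma * (b%:R * h i)) * G i k 0)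
      <= G i (k - b)%N (y + delta).
Proof.
move=> t0 t1 d0.
(* For each [y] in the interval some [lev c] with [c <= C] lies between [y + delta] and
   [y + 2 * delta]; this is why these two shifts appear in the statement. *)
pose C := (Num.truncn (x / delta)).+1.
pose lev (c : nat) : R := - x + c%:R * delta + delta.
have : \forall k \near \oo, forall bc : 'I_B.+1 * 'I_C.+1,
    theta * (expR (- (alpha * lev bc.2)) * expR (gamma * (bc.1%:R * h i)))
      <= G i (k - bc.1)%N (lev bc.2) / G i k 0.
  apply: filter_forall => -[b c] /=.
  have := @skeleton_shift_ratio i b (lev c) => /cvgr_ge; apply.
  by rewrite gtr_pMl// mulr_gt0 ?expR_gt0.
have g0 := skeleton_prob_gt0 XL alpha0 tails (p2 i).
apply: filterS2 g0 => k Gk0 H b y bB xy y0.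
have yx : 0 <= y + x by rewrite -lerBlDr add0r.
have yx0 : 0 <= (y + x) / delta by rewrite divr_ge0// ltW.
pose c := (Num.truncn ((y + x) / delta)).+1.
have cC : (c < C.+1)%N.
  rewrite ltnS /c /C ltnS -ltnS -(ltr_nat R).
  apply: le_lt_trans (truncnS_gt (x / delta)).
  apply: (@le_trans _ _ ((y + x) / delta)); first by have /andP[] := truncn_itv yx0.
  by rewrite ler_pM2r ?invr_gt0// gerDr.
have := H (Ordinal (bB : (b < B.+1)%N), Ordinal cC) => /=.
rewrite ler_pdivlMr// => {}H.
have /andP[c1 c2] := truncn_itv yx0; rewrite ler_pdivlMr// in c1.
rewrite ltr_pdivrMr// -/c in c2.
have l1 : y + delta <= lev c by rewrite /lev; lra.
have l2 : lev c <= y + 2 * delta.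
  by rewrite /lev /c -natr1 mulrDl mul1r; lra.
apply: le_trans (prob_ge_nonincreasing P (measurable_funPT (S i (k - b)%N)) l1).
apply: le_trans H; rewrite -[leRHS]mulrA; apply: ler_wpM2l => //.
apply: ler_wpM2r; first exact: ltW.
apply: ler_wpM2r; first exact: expR_ge0.
by rewrite ler_expR lerN2 ler_wpM2l.
Qed.

Definition levy_rate (t : R) : R :=
  expR (- (gamma * (t - (Num.truncn t)%:R))) * (p (Num.truncn t) / t).

(** Four powers of [theta] come from [survival_lower], three from comparing the coarse tail at step
    [kap.+1] with [levy_rate], and one from replacing the grid time [TT] by [t]. *)
Lemma lower_asymptotics (theta c : R) : 0 < theta -> theta < 1 -> 0 <= c ->
  (exists J : nat, forall l, c <= expR (gamma * h l) *
    \sum_(0 <= j < J * 2 ^ l) h l * (expR (gamma * (j%:R * h l)) * q (j%:R * h l))) ->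
  \forall t \near +oo%R, theta ^+ 8 * expR (alpha * x) * c * levy_rate t <=
    fine (P [set w | (t%:E < exit_time (fun t => X t) x w)%E]).
Proof.
move=> t0 t1 c0 [J Jc].
have a20 : 0 <= 2 * alpha by rewrite mulr_ge0.
have [delta d0 dth] := expRN_step a20 t0 t1.
have emesh : \forall i \near \oo, theta <= expR (- (gamma * h i)).
  have := expR_mesh_cvg1 (- gamma) => /cvgr_ge/(_ _ t1).
  by apply: filterS => i; rewrite mulNr.
have [i [ith jump]] : exists i, theta <= expR (- (gamma * h i)) /\
    forall r, 0 <= r -> r <= h i -> theta <= prob_ge P (X r) (- delta).
  have jumps := near_small_jump t1 d0.
  have /near_infty_ex[i Hi] : \forall i \near \oo, theta <= expR (- (gamma * h i)) /\
    forall r, 0 <= r -> r <= h i -> theta <= prob_ge P (X r) (- delta).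
    by apply: filterS2 emesh jumps.
  by exists i; exact: Hi.
have levs := near_level i (J * 2 ^ i) (ltW t0) t1 d0.
have Jk := nbhs_infty_gt (J * 2 ^ i).
have r1 : \forall k \near \oo, theta <=
    G i k 0 / (p (k %/ 2 ^ i)%N * expR (- (gamma * ((k %% 2 ^ i)%:R / (2 ^ i)%:R)))).
  have := @skeleton_prob_cvg _ _ _ P X XL gamma alpha alpha0 tails (2 ^ i) (p2 i) 0.
  by rewrite mulr0 oppr0 expR0 => /cvgr_ge/(_ _ t1).
have r2 : \forall k \near \oo, G i k 0 / G i k.+1 0 <= theta^-1 * expR (gamma * h i).
  have := skeleton_time_ratio XL alpha0 tails (p2 i) => /cvgr_le; apply.
  by rewrite ltr_pMl ?expR_gt0// invf_gt1.
have p_pos := near_infty_divn (p2 i) (p_gt0 tails).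
have Gpos := skeleton_prob_gt0 XL alpha0 tails (p2 i).
have /near_infty_ex[M HM] : \forall k \near \oo, [/\ 0 < p (k %/ 2 ^ i)%N, 0 < G i k 0,
   theta <= G i k 0 / (p (k %/ 2 ^ i)%N * expR (- (gamma * ((k %% 2 ^ i)%:R / (2 ^ i)%:R)))),
   G i k 0 / G i k.+1 0 <= theta^-1 * expR (gamma * h i) & ((J * 2 ^ i < k)%N /\
   forall (b : nat) y, (b <= J * 2 ^ i)%N -> - x <= y -> y <= 0 ->
    theta * (expR (- (alpha * (y + 2 * delta))) * expR (gamma * (b%:R * h i)) * G i k 0)
      <= G i (k - b)%N (y + delta))].
  by near=> k; split; [near: k|near: k|near: k|near: k|split; near: k].
have kapM : \forall t \near +oo%R, (M <= Num.truncn (t * (2 ^ i)%:R : R))%N.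
  exact: (near_pinfty_truncn (p2 i) (nbhs_infty_ge M)).
near=> t.
have t_gt0 : 0 < t by near: t; exact: nbhs_pinfty_gt (num_real _).
have t_big : theta * h i / (1 - theta) <= t by near: t; exact: nbhs_pinfty_ge (num_real _).
have kapMt : (M <= Num.truncn (t * (2 ^ i)%:R : R))%N by near: t.
set kap := Num.truncn _ in kapMt.
have [pk Gk r1k r2k _] := HM kap kapMt.
have [_ Gk1 _ _ [Jk1 lev1]] := HM kap.+1 (leqW kapMt).
have m0R : 0 < (2 ^ i)%:R :> R by rewrite ltr0n.
have tm0 : 0 <= t * (2 ^ i)%:R by rewrite mulr_ge0// ltW.
have /andP[kt1 kt2] := truncn_itv tm0; rewrite -/kap in kt1 kt2.
(* The first grid time strictly after [t]: staying above [-x] up to [TT] puts the exit time at or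
   after [TT], hence strictly after [t]. *)
pose TT := kap.+1%:R * h i.
have tT : t < TT by rewrite /TT ltr_pdivlMr.
have TT0 : 0 < TT by exact: lt_trans tT.
have Tle : theta * TT <= t.
  have Tt : TT <= t + h i.
    by rewrite /TT -natr1 mulrDl mul1r lerD2r /h ler_pdivrMr.
  apply: (@le_trans _ _ (theta * (t + h i))); first by rewrite ler_wpM2l// ltW.
  have t1' : 0 < 1 - theta by rewrite subr_gt0.
  by rewrite ler_pdivrMr// in t_big; lra.
have surv : theta ^+ 4 * expR (alpha * x) * c * G i kap.+1 0 <=
    TT * fine (P [set w | - x <= N TT w]).
  have conv : TT * fine (P [set w | - x <= Z l (kap.+1 * 2 ^ (l - i))%N w]) @[l --> \oo] -->
      TT * fine (P [set w | - x <= N TT w]).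
    have mNT : measurable_fun setT (N TT) by apply: measurable_running_inf => //; exact: ltW.
    (* Survival probabilities are truncated moments with exponent 0, so their limit along refining
       grids is an instance of [trunc_moment_cvg]. *)
    have E0 N' : measurable_fun setT N' -> trunc_moment P 0 x N' = fine (P [set w | - x <= N' w]).
      move=> mN'; rewrite -Rintegral_if; last exact: measurable_ge.
      by apply: eq_Rintegral => w _; rewrite mul0r expR0.
    rewrite -E0// (_ : (fun l => _) =
      (fun l => TT * trunc_moment P 0 x (Z l (kap.+1 * 2 ^ (l - i))%N))); last first.
      by apply/funext => l; rewrite E0//; exact: measurable_skeleton_min.
    apply: cvgMr; apply: trunc_moment_cvg => //.
    - by move=> l; exact: measurable_skeleton_min.
    - by move=> l w; exact: skeleton_min_le0.
    - apply/near_infty_ex; exists i => l il w.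
      rewrite /TT /h -(dyadic_refine kap.+1 il).
      exact: running_inf_le_skeleton_min.
    - by move=> w y Ny; exact: skeleton_min_near.
  apply: (cvg_ge_cst conv); apply/near_infty_ex; exists i => l il.
  exact: (survival_lower XL gamma0 alpha0 x0 (ltW t0) c0 dth ith jump lev1 Jc Jk1).
have incl : fine (P [set w | - x <= N TT w]) <=
    fine (P [set w | (t%:E < exit_time (fun t => X t) x w)%E]).
  apply: fine_probability_le.
  - by apply: measurable_ge; apply: measurable_running_inf => //; exact: ltW.
  - by apply: measurable_lt_exit_time => //; exact: ltW.
  - move=> w /= xN; apply: (@lt_le_trans _ _ TT%:E); first by rewrite lte_fin.
    apply: (exit_time_ge (u := TT)) => s s0 sT.
    by apply: (iffLR (le_running_inf XL _ w (ltW TT0)) xN) => //; exact: ltW.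
apply: le_trans incl; rewrite -(ler_pM2l TT0); apply: le_trans surv.
have E_le : expR (- (gamma * (t - (Num.truncn t)%:R))) <=
    expR (- (gamma * ((kap %% 2 ^ i)%:R / (2 ^ i)%:R))).
  rewrite ler_expR lerN2 ler_wpM2l//.
  have := divn_eq kap (2 ^ i); rewrite truncn_mesh_div ?(ltW t_gt0)// => kE.
  rewrite lerBrDl -[X in X + _](mulfK (lt0r_neq0 m0R)) -mulrDl ler_pdivrMr//.
  by rewrite -natrM -natrD -kE.
have kd : (kap %/ 2 ^ i = Num.truncn t)%N by rewrite /kap truncn_mesh_div// ltW.
rewrite kd in r1k pk.
have g1 : theta ^+ 2 * (p (Num.truncn t) * expR (- (gamma * (t - (Num.truncn t)%:R)))) * theta <= G i kap.+1 0.
  rewrite ler_pdivlMr ?mulr_gt0 ?expR_gt0// in r1k.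
  rewrite ler_pdivrMr// in r2k.
  have s1 : theta * G i kap 0 * expR (- (gamma * h i)) <= G i kap.+1 0.
    rewrite expRN ler_pdivrMr ?expR_gt0// -ler_pdivlMl//.
    by apply: (le_trans r2k); rewrite -[leLHS]mulrA [expR _ * _]mulrC.
  apply: le_trans s1.
  rewrite [leLHS](_ : _ = theta * (theta * (p (Num.truncn t) * expR (- (gamma * (t - (Num.truncn t)%:R))))) * theta); last by ring.
  apply: ler_pM => //; [by rewrite !mulr_ge0 ?expR_ge0// ltW|exact: ltW|].
  apply: ler_wpM2l; first exact: ltW.
  apply: le_trans r1k; apply: ler_wpM2l; first exact: ltW.
  by apply: ler_wpM2l => //; exact: ltW.
rewrite /levy_rate.
move: g1; set b1 := expR (- (gamma * (t - _))); set pt := p (Num.truncn t) => g1.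
rewrite [leLHS](_ : _ = theta ^+ 4 * expR (alpha * x) * c * (theta ^+ 2 * (pt * b1) * theta) * ((theta * TT) / t)); last first.
  by field; rewrite gt_eqF.
apply: (@le_trans _ _ (theta ^+ 4 * expR (alpha * x) * c * (theta ^+ 2 * (pt * b1) * theta))).
  apply: ler_piMr; last by rewrite ler_pdivrMr// mul1r.
  have theta_ge0 := ltW t0.
  by rewrite !mulr_ge0 ?exprn_ge0// ?expR_ge0// ltW.
apply: ler_wpM2l => //; have theta_ge0 := ltW t0.
by rewrite !mulr_ge0 ?exprn_ge0// expR_ge0.
Unshelve. all: by end_near. Qed.

End LowerAsymptotics.

(** * Riemann sums for the limit constant *)

Section RiemannBounds.
Context {R : realType}.
Variables (gamma : R) (q : R -> R).
Hypothesis gamma0 : 0 <= gamma.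
Hypothesis q_ge0 : forall t, 0 <= q t.
Hypothesis q_ni : forall s t, s <= t -> q t <= q s.

Let f t := expR (gamma * t) * q t.
Local Notation leb := (@lebesgue_measure R).

Let f_ge0 t : (0 <= (f t)%:E)%E. Proof. by rewrite lee_fin mulr_ge0// expR_ge0. Qed.

Let mf : measurable_fun setT (fun t => (f t)%:E).
Proof.
apply/measurable_EFinP; apply: measurable_funM.
  by apply: measurableT_comp => //; exact: mulrl_measurable.
exact: nonincreasing_measurable.
Qed.

Let mfD D : measurable_fun D (fun t => (f t)%:E). Proof. exact: measurable_funTS mf. Qed.

(** The integrand need not be monotone: its weight increases while [q] decreases. Each factor is
    therefore estimated at its own end of the cell. *)
Lemma cell_integral_bounds (a b : R) : a <= b ->
  (((b - a) * (expR (gamma * a) * q b))%:E <= \int[leb]_(t in `[a, b[) (f t)%:E <=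
   ((b - a) * (expR (gamma * b) * q a))%:E)%E.
Proof.
move=> ab.
have len : leb `[a, b[ = (b - a)%:E.
  rewrite lebesgue_measure_itv /= lte_fin; case: ltP => // ba.
  have -> : a = b by apply/le_anti; rewrite ab ba.
  by rewrite subrr.
have cstE (c : R) : (\int[leb]_(t in `[a, b[) cst c%:E t)%E = ((b - a) * c)%:E.
  transitivity (c%:E * leb `[a, b[)%E; first exact: integral_cst.
  by rewrite len -EFinM mulrC.
rewrite -!cstE; apply/andP; split; apply: ge0_le_integral => //.
- by move=> t _; rewrite lee_fin mulr_ge0// expR_ge0.
- exact: mfD.
- move=> t; rewrite /= in_itv/= => /andP[ta tb]; rewrite lee_fin /f.
  apply: ler_pM; [exact: expR_ge0|exact: q_ge0| |].
    by rewrite ler_expR ler_wpM2l.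
  by apply: q_ni; exact: ltW.
- exact: mfD.
- move=> t; rewrite /= in_itv/= => /andP[ta tb]; rewrite lee_fin /f.
  apply: ler_pM; [exact: expR_ge0|exact: q_ge0| |].
    by rewrite ler_expR ler_wpM2l// ltW.
  exact: q_ni.
Qed.

Lemma grid_integral (h : R) (K : nat) : 0 <= h ->
  (\int[leb]_(t in `[0%R, (K%:R * h)%R[) (f t)%:E =
   \sum_(0 <= k < K) \int[leb]_(t in `[(k%:R * h)%R, (k.+1%:R * h)%R[) (f t)%:E)%E.
Proof.
move=> h0; elim: K => [|K IH].
  by rewrite mul0r big_nil set_itv_ge ?integral_set0// bnd_simp ltxx.
rewrite big_nat_recr//= -IH.
have dis : [disjoint `[0%R, (K%:R * h)%R[ & `[(K%:R * h)%R, (K.+1%:R * h)%R[]%classic.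
  apply/disj_set2P; apply/seteqP; split => // t /=; rewrite !in_itv/=.
  by move=> [/andP[_ tK] /andP[Kt _]]; move: tK; rewrite ltNge Kt.
have mA : measurable `[0%R, (K%:R * h)%R[%classic by exact: measurable_itv.
have mB : measurable `[(K%:R * h)%R, (K.+1%:R * h)%R[%classic by exact: measurable_itv.
have m_ : measurable_fun (`[0%R, (K%:R * h)%R[ `|` `[(K%:R * h)%R, (K.+1%:R * h)%R[)
  (fun t => (f t)%:E) by exact: mfD.
rewrite -(ge0_integral_setU leb mA mB m_ (fun t _ => f_ge0 t) dis).
have c1 : (BLeft (0 : R) <= BLeft (K%:R * h))%O by rewrite bnd_simp mulr_ge0.
have c2 : (BLeft (K%:R * h) <= BLeft (K.+1%:R * h))%O.
  by rewrite bnd_simp ler_wpM2r// ler_nat.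
by rewrite -(itv_bndbnd_setU c1 c2).
Qed.

Lemma grid_lower (h : R) (K : nat) : 0 <= h ->
  ((\sum_(0 <= k < K) h * (expR (gamma * (k%:R * h)) * q (k.+1%:R * h)))%:E <=
   \int[leb]_(t in `[0%R, +oo[) (f t)%:E)%E.
Proof.
move=> h0; apply: (@le_trans _ _ (\int[leb]_(t in `[0%R, (K%:R * h)%R[) (f t)%:E)%E).
  rewrite grid_integral// -sumEFin; apply: lee_sum => k _.
  have kk : k%:R * h <= k.+1%:R * h by rewrite ler_wpM2r// ler_nat.
  have /andP[+ _] := cell_integral_bounds kk.
  by rewrite -mulrBl -natrB// subSnn mul1r.
apply: ge0_subset_integral => //; first exact: mfD.
by move=> t /=; rewrite !in_itv/= andbT => /andP[].
Qed.

(** Monotone convergence gives an integer [J] with the integral over [[0, J[] above [c]. Being a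
    multiple of every dyadic mesh, it serves all [l]; moving the weight to the left end of each cell
    costs the leading factor. The full integral may be infinite. *)
Lemma grid_upper (c : R) : (c%:E < \int[leb]_(t in `[0%R, +oo[) (f t)%:E)%E ->
  exists J : nat, forall l : nat, c <= expR (gamma * ((2 ^ l)%:R)^-1) *
    \sum_(0 <= j < J * 2 ^ l) ((2 ^ l)%:R)^-1 *
      (expR (gamma * (j%:R * ((2 ^ l)%:R)^-1)) * q (j%:R * ((2 ^ l)%:R)^-1)).
Proof.
move=> cW.
have conv : (\int[leb]_(t in `[0%R, n%:R[) (f t)%:E)%E @[n --> \oo] -->
    (\int[leb]_(t in `[0%R, +oo[) (f t)%:E)%E.
  have -> : `[0%R, +oo[%classic = \bigcup_n `[0%R, (n%:R : R)[%classic.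
    apply/seteqP; split => t /=; rewrite in_itv/= andbT.
      by move=> t0; exists (Num.truncn t).+1 => //=; rewrite in_itv/= t0 truncnS_gt.
    by move=> [n _] /=; rewrite in_itv/= => /andP[].
  apply: ge0_nondecreasing_set_cvg_integral => //; last by move=> n; exact: mfD.
  move=> m n mn; apply/subsetPset => t /=; rewrite !in_itv/= => /andP[-> tm].
  by rewrite (lt_le_trans tm)// ler_nat.
have /near_infty_ex[J HJ] : \forall n \near \oo, (c%:E < \int[leb]_(t in `[0%R, n%:R[) (f t)%:E)%E.
  exact: (conv _ (open_ereal_gt' cW)).
exists J => l; set h := (_)^-1.
have h0 : 0 <= h by rewrite invr_ge0.
have Jh : J%:R = (J * 2 ^ l)%:R * h :> R.
  by rewrite /h natrM mulfK// pnatr_eq0 expn_eq0.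
have := HJ J (leqnn _); rewrite Jh grid_integral// => cJ.
rewrite -lee_fin; apply: (le_trans (ltW cJ)).
rewrite mulr_sumr -sumEFin; apply: lee_sum => k _.
have kk : k%:R * h <= k.+1%:R * h by rewrite ler_wpM2r// ler_nat.
have /andP[_ +] := cell_integral_bounds kk.
move=> /le_trans; apply; rewrite lee_fin -mulrBl -natrB// subSnn mul1r.
rewrite [leRHS]mulrCA; apply: ler_wpM2l => //; rewrite [leRHS]mulrA -expRD.
apply: ler_wpM2r => //; rewrite ler_expR -mulrDr.
by rewrite -natr1 mulrDl mul1r addrC.
Qed.

End RiemannBounds.

(** * Riemann sums for the mean exit time, when both exponents vanish *)

Section ExpectedExitTime.
Context {d : measure_display} {T : measurableType d} {R : realType}.
Variable P : probability T R.
Variables (X : R -> {RV P >-> R}) (XL : levy_process X) (x : R).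

Let N t w := running_inf (fun t => X t) t w.
Let tau w := exit_time (fun t => X t) x w.
Let alive t w : R := if - x <= N t w then 1 else 0.
Let q t := trunc_moment P 0 x (N t).

Let mN t : 0 <= t -> measurable_fun setT (N t). Proof. exact: measurable_running_inf. Qed.

Let malive t : 0 <= t -> measurable_fun setT (alive t).
Proof. by move=> t0; apply: (@measurable_if_ge _ _ _ (- x) (N t) (cst 1)) => //; exact: mN. Qed.

Let alive_ge0 t w : 0 <= alive t w. Proof. by rewrite /alive; case: ifP. Qed.
Let alive_le1 t w : alive t w <= 1. Proof. by rewrite /alive; case: ifP. Qed.

Lemma exit_time_ge0 w : (0 <= tau w)%E.
Proof. by apply/ereal_infP => _ [s [s0 _] <-]; rewrite lee_fin. Qed.

Lemma measurable_exit_time : measurable_fun setT tau.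
Proof.
apply: (measurability _ (ErealGenOInfty.measurableE R)) => //= _ [_ [y ->] <-].
rewrite setTI (_ : _ @^-1` _ = [set w | (y%:E < tau w)%E]); last first.
  apply/seteqP; split => w /=; rewrite in_itv/= andbT//.
have [y0|y0] := leP 0 y; first exact: measurable_lt_exit_time.
rewrite (_ : mkset _ = setT)//; apply/seteqP; split => // w _ /=.
by apply: lt_le_trans (exit_time_ge0 w); rewrite lte_fin.
Qed.

Let sum_alive_integral (h : R) (t : nat -> R) (K : nat) : 0 <= h -> (forall k, 0 <= t k) ->
  ((\sum_(0 <= k < K) h * (expR (0 * t k) * q (t k)))%:E =
   \int[P]_w (\sum_(0 <= k < K) h * alive (t k) w)%:E)%E.
Proof.
move=> h0 t0; under [in RHS]eq_integral do rewrite -sumEFin.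
rewrite ge0_integral_sum//; last 2 first.
- by move=> k; apply/measurable_EFinP; apply: measurable_funM => //; exact: malive.
- by move=> k w _; rewrite lee_fin mulr_ge0.
rewrite -sumEFin; apply: eq_bigr => k _.
rewrite mul0r expR0 mul1r EFinM /q /trunc_moment.
under eq_Rintegral do rewrite mul0r expR0.
rewrite -/(alive (t k)) /Rintegral fineK; last first.
  apply: integrable_fin_num => //; apply: (@bounded_integrable _ _ _ P _ 1).
    exact: malive.
  by move=> w; rewrite ger0_norm.
rewrite -ge0_integralZl//.
- by apply/measurable_EFinP; exact: malive.
- by move=> w _; rewrite lee_fin.
Qed.

(** Pathwise: if the path has stayed above [-x] up to the last grid time counted, the exit time is
    at least that grid time, which bounds the whole sum. *)
Let alive_sum_le (h : R) K w : 0 <= h ->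
  ((\sum_(0 <= k < K) h * alive (k.+1%:R * h) w)%:E <= tau w)%E.
Proof.
move=> h0; elim: K => [|K IH]; first by rewrite big_nil exit_time_ge0.
rewrite big_nat_recr//= {2}/alive; case: ifPn => [xN|_]; last by rewrite mulr0 addr0.
have Kh : 0 <= K.+1%:R * h by rewrite mulr_ge0.
apply: (@le_trans _ _ (K.+1%:R * h)%:E).
  rewrite lee_fin -natr1 mulrDl mul1r mulr1 lerD2r.
  apply: (@le_trans _ _ (\sum_(0 <= k < K) h)); last by rewrite sumr_const_nat subn0 mulr_natl.
  by apply: ler_sum => k _; rewrite ler_piMr.
apply: exit_time_ge => s s0 sK.
by apply: (iffLR (le_running_inf XL _ w Kh) xN) => //; exact: ltW.
Qed.

(** A finite sum sees the exit time only up to the horizon [K * h], hence the minimum. Sampling at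
    left endpoints rounds the exit time upwards. *)
Let min_le_alive_sum (h : R) K w : 0 <= h ->
  (Order.min (tau w) (K%:R * h)%:E <= (\sum_(0 <= k < K) h * alive (k%:R * h) w)%:E)%E.
Proof.
move=> h0; elim: K => [|K IH]; first by rewrite big_nil mul0r ge_min lexx orbT.
have [Kt|tK] := ltP (K%:R * h)%:E (tau w); last first.
  rewrite min_l; last by rewrite (le_trans tK)// lee_fin ler_wpM2r// ler_nat.
  rewrite min_l// in IH; apply: (le_trans IH); rewrite lee_fin big_nat_recr//=.
  by rewrite lerDl mulr_ge0.
rewrite ge_min; apply/orP; right; rewrite lee_fin.
rewrite (eq_big_nat _ _ (F2 := fun=> h)); first by rewrite sumr_const_nat subn0 mulr_natl.
move=> k /andP[_ kK]; rewrite /alive ifT ?mulr1//.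
apply: (running_inf_exit_time XL) => //; last by rewrite mulr_ge0.
by apply: le_lt_trans Kt; rewrite lee_fin ler_wpM2r// ler_nat.
Qed.

Lemma expected_exit_lower (h : R) (K : nat) : 0 <= h ->
  ((\sum_(0 <= k < K) h * (expR (0 * (k%:R * h)) * q (k.+1%:R * h)))%:E <=
   \int[P]_w tau w)%E.
Proof.
move=> h0.
rewrite (eq_bigr (fun k => h * (expR (0 * (k.+1%:R * h)) * q (k.+1%:R * h)))); last first.
  by move=> k _; rewrite !mul0r.
rewrite (sum_alive_integral (t := fun k => k.+1%:R * h))//; last first.
  by move=> k; rewrite mulr_ge0.
apply: ge0_le_integral => //.
- by move=> w _; rewrite lee_fin sumr_ge0// => k _; rewrite mulr_ge0.
- apply/measurable_EFinP; apply: measurable_sum => k.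
  by apply: measurable_funM => //; apply: malive; rewrite mulr_ge0.
- exact: measurable_exit_time.
- by move=> w _; exact: alive_sum_le.
Qed.

Lemma expected_exit_upper (c : R) : (c%:E < \int[P]_w tau w)%E ->
  exists J : nat, forall l : nat, c <= expR (0 * ((2 ^ l)%:R)^-1) *
    \sum_(0 <= j < J * 2 ^ l) ((2 ^ l)%:R)^-1 *
      (expR (0 * (j%:R * ((2 ^ l)%:R)^-1)) * q (j%:R * ((2 ^ l)%:R)^-1)).
Proof.
move=> cW.
have mtau := measurable_exit_time.
have mm n : measurable_fun setT (fun w => Order.min (tau w) (n%:R)%:E).
  by apply: measurable_mine => //; exact: measurable_cst.
have m0 n w : (0 <= Order.min (tau w) (n%:R)%:E)%E.
  by rewrite le_min exit_time_ge0 lee_fin ler0n.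
have conv : (\int[P]_w Order.min (tau w) (n%:R)%:E)%E @[n --> \oo] --> (\int[P]_w tau w)%E.
  have := @cvg_monotone_convergence _ _ _ P setT measurableT
    (fun n w => Order.min (tau w) (n%:R)%:E) mm (fun n w _ => m0 n w).
  rewrite (_ : (fun x0 => limn _) = tau); first apply.
    move=> w _ n m nm; rewrite le_min ge_min lexx/= ge_min; apply/orP; right.
    by rewrite lee_fin ler_nat.
  apply/funext => w; apply/cvg_lim => //.
  case E : (tau w) => [r| |]; last by have := exit_time_ge0 w; rewrite E.
    apply: cvg_near_cst; exists (Num.truncn r).+1 => // n /= rn.
    by rewrite min_l// lee_fin ltW// (lt_le_trans (truncnS_gt _))// ler_nat.
  rewrite (_ : (fun n => _) = (fun n => n%:R%:E)); first by apply/cvgenyP.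
  by apply/funext => n; rewrite min_r// leey.
have /near_infty_ex[J HJ] : \forall n \near \oo, (c%:E < \int[P]_w Order.min (tau w) (n%:R)%:E)%E.
  exact: (conv _ (open_ereal_gt' cW)).
exists J => l; set h := (_)^-1.
have h0 : 0 <= h by rewrite invr_ge0.
have Jh : J%:R = (J * 2 ^ l)%:R * h :> R.
  by rewrite /h natrM mulfK// pnatr_eq0 expn_eq0.
rewrite mul0r expR0 mul1r -lee_fin.
rewrite (sum_alive_integral (t := fun k => k%:R * h))//; last first.
  by move=> k; rewrite mulr_ge0.
apply: (le_trans (ltW (HJ J (leqnn _)))); apply: ge0_le_integral => //.
- by apply/measurable_EFinP; apply: measurable_sum => k;
    apply: measurable_funM => //; apply: malive; rewrite mulr_ge0.
- by move=> w _; rewrite Jh; exact: min_le_alive_sum.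
Qed.

End ExpectedExitTime.

(** * Exit times of Lévy processes *)

Section Sandwich.
Context {R : realType} {I : Type} (F : set_system I) {FF : Filter F}.

(** Every loss in the estimates is a power of [1 - u] or [1 + u], apart from one additive error in
    the constant. The exponents can therefore simply be counted, with no choice of epsilons. *)
Lemma cvg_power_sandwich (r : I -> R) (V K : R) (m n : nat) :
  (forall u, 0 < u -> u < 1 -> \forall t \near F,
     (1 - u) ^+ m * V <= r t <= (1 + u) ^+ n * (V + K * u)) ->
  r t @[t --> F] --> V.
Proof.
move=> H; apply/cvgrPdist_le => e e0.
have powc (g : nat -> R) k : g j @[j --> \oo] --> (1 : R) -> g j ^+ k @[j --> \oo] --> (1 : R).
  by move=> g1; rewrite -(expr1n R k); exact: (cvg_comp _ _ g1 (@exprn_continuous R k 1)).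
have lo : (1 - harmonic j) ^+ m * V @[j --> \oo] --> V.
  rewrite -[X in _ --> X]mul1r; apply: cvgMl; apply: powc.
  rewrite -[X in _ --> X](subr0 1).
  by apply: cvgB; [exact: cvg_cst|exact: cvg_harmonic].
have hi : (1 + harmonic j) ^+ n * (V + K * harmonic j) @[j --> \oo] --> V.
  rewrite -[X in _ --> X]mul1r; apply: cvgM.
    apply: powc; rewrite -[X in _ --> X](addr0 1).
    by apply: cvgD; [exact: cvg_cst|exact: cvg_harmonic].
  rewrite -[X in _ --> X]addr0 -[X in _ --> _ + X](mulr0 K).
  by apply: cvgD; [exact: cvg_cst|apply: cvgMr; exact: cvg_harmonic].
have Ve1 : V - e < V by rewrite gtrBl.
have Ve2 : V < V + e by rewrite ltrDl.
have j0 := nbhs_infty_gt 0.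
have /near_infty_ex[j Hj] : \forall j \near \oo, [/\ (0 < j)%N, V - e <= (1 - harmonic j) ^+ m * V &
    (1 + harmonic j) ^+ n * (V + K * harmonic j) <= V + e].
  apply: filter_app j0; move/cvgr_ge: lo => /(_ _ Ve1); apply: filter_app.
  by move/cvgr_le: hi => /(_ _ Ve2); apply: filterS => j h1 h2 h3; split.
have [jp h1 h2] := Hj j (leqnn _).
have u1 : harmonic j < 1 :> R by rewrite invf_lt1// ltr1n.
apply: filterS (H (harmonic j) (harmonic_gt0 _) u1) => t /andP[r1 r2].
by rewrite ler_distlC (le_trans h1 r1) (le_trans r2 h2).
Qed.

End Sandwich.

Section UpperAsymptotics.
Context {d : measure_display} {T : measurableType d} {R : realType}.
Variable P : probability T R.
Variables (X : R -> {RV P >-> R}) (XL : levy_process X) (gamma alpha x : R).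
Hypothesis gamma0 : 0 <= gamma.
Hypothesis alpha0 : 0 <= alpha.
Hypothesis tails : tail_conditions P gamma alpha (fun n => X n%:R).

Let p n := prob_ge P (X n%:R) 0.
Let tau w := exit_time (fun t => X t) x w.

Lemma exit_time_le_skeleton (m : nat) (t : R) : (0 < m)%N -> 0 <= t ->
  fine (P [set w | (t%:E < tau w)%E]) <=
  fine (P [set w | - x <= lmin 0 (Num.truncn (t * m%:R))
                     (fun n => skeleton X m n.+1 w - skeleton X m n w)]).
Proof.
move=> m0 t0; have rw : random_walk (skeleton X m) by exact: skeleton_random_walk.
apply: fine_probability_le.
- exact: measurable_lt_exit_time.
- by apply: measurable_ge; exact: (measurable_walk_min (random_walk_iid rw)).
move=> w /= tw; rewrite (walk_lmin rw); apply/(le_running_min rw) => k kt.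
have m0R : 0 < m%:R :> R by rewrite ltr0n.
have s0 : 0 <= k%:R / m%:R :> R by rewrite divr_ge0.
apply: exit_time_gt_ge tw s0 _.
rewrite ler_pdivrMr//.
have /andP[+ _] : (Num.truncn (t * m%:R))%:R <= t * m%:R < (Num.truncn (t * m%:R)).+1%:R.
  by apply: truncn_itv; rewrite mulr_ge0.
by apply: le_trans; rewrite ler_nat.
Qed.

(** One factor [1 + u] each for the limit of the tails, for the rounding of the fractional part
    inside the exponential, and for the rounding of the denominator. *)
Lemma near_skeleton_rate (m : nat) (u : R) : (0 < m)%N -> 0 < u ->
  expR (gamma / m%:R) <= 1 + u ->
  \forall t \near +oo%R, let k := Num.truncn (t * m%:R) in
    0 < prob_ge P (skeleton X m k) 0 / k%:R <= (1 + u) ^+ 3 / m%:R * levy_rate X gamma t.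
Proof.
move=> m0 u0 eu.
have m0R : 0 < m%:R :> R by rewrite ltr0n.
have u10 : 0 < 1 + u by rewrite addr_gt0.
have G1 : \forall k \near \oo, prob_ge P (skeleton X m k) 0 /
   (p (k %/ m)%N * expR (- (gamma * ((k %% m)%:R / m%:R)))) <= 1 + u.
  have := @skeleton_prob_cvg _ _ _ P X XL gamma alpha alpha0 tails m m0 0.
  by rewrite mulr0 oppr0 expR0 => /cvgr_le; apply; rewrite ltrDl.
have pm := near_infty_divn m0 (p_gt0 tails).
have Gp := skeleton_prob_gt0 XL alpha0 tails m0.
have k0 := nbhs_infty_gt 0.
have Gk : \forall k \near \oo, [/\ (0 < k)%N, 0 < p (k %/ m)%N, 0 < prob_ge P (skeleton X m k) 0 &
   prob_ge P (skeleton X m k) 0 <=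
     (1 + u) * (p (k %/ m)%N * expR (- (gamma * ((k %% m)%:R / m%:R))))].
  apply: filter_app k0; apply: filter_app pm; apply: filter_app Gp; apply: filterS G1.
  move=> k H1 H2 H3 H4; split => //.
  by rewrite -ler_pdivrMr// mulr_gt0// expR_gt0.
apply: filter_app (near_pinfty_truncn m0 Gk).
near=> t => -[] /=; set k := Num.truncn (t * m%:R) => kp pk Gk0 Gk1.
have t0 : 0 < t by near: t; exact: nbhs_pinfty_gt (num_real _).
have tm0 : 0 <= t * m%:R by rewrite mulr_ge0// ltW.
have kR : 0 < k%:R :> R by rewrite ltr0n.
rewrite divr_gt0//=.
have km : (k %/ m = Num.truncn t)%N by rewrite truncn_mesh_div// ltW.
have /andP[kt1 kt2] := truncn_itv tm0; rewrite -/k in kt1 kt2.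
have kE : k%:R = (Num.truncn t)%:R * m%:R + (k %% m)%:R :> R.
  by rewrite {1}(divn_eq k m) natrD natrM km.
have E1 : expR (- (gamma * ((k %% m)%:R / m%:R))) <=
    (1 + u) * expR (- (gamma * (t - (Num.truncn t)%:R))).
  apply: (@le_trans _ _ (expR (gamma / m%:R) * expR (- (gamma * (t - (Num.truncn t)%:R))))).
    rewrite -expRD ler_expR.
    have -> : gamma / m%:R - gamma * (t - (Num.truncn t)%:R) =
        - (gamma * (t - (Num.truncn t)%:R - m%:R^-1)) by ring.
    rewrite lerN2; apply: ler_wpM2l => //; rewrite ler_pdivlMr// !mulrBl mulVf ?gt_eqF//.
    rewrite -natr1 in kt2; rewrite kE in kt2; lra.
  by apply: ler_wpM2r => //; exact: expR_ge0.
have k1 : k%:R^-1 <= (1 + u) / (m%:R * t).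
  rewrite ler_pdivlMr ?mulr_gt0// mulrC ler_pdivrMr//.
  (* Since [k + 1 > m * t], this turns the loss of less than one unit into a factor:
     [(1 + u) * k >= m * t]. *)
  have ut : m%:R * t * u >= 1 + u.
    have mt : (1 + u) / u <= t by near: t; exact: nbhs_pinfty_ge (num_real _).
    rewrite ler_pdivrMr// in mt; apply: (le_trans mt).
    by apply: ler_wpM2r; [exact: ltW|apply: ler_peMl; [exact: ltW|rewrite ler1n]].
  rewrite -natr1 in kt2.
  have : (1 + u) * (t * m%:R) <= (1 + u) * (k%:R + 1) by rewrite ler_wpM2l// ltW.
  by move: ut; rewrite !mulrDl !mulrDr !mul1r !mulr1 (mulrC m%:R t); lra.
rewrite /levy_rate -km -/(p (k %/ m)%N).
have step : prob_ge P (skeleton X m k) 0 <= (1 + u) * (p (k %/ m)%N *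
   ((1 + u) * expR (- (gamma * (t - (k %/ m)%:R))))).
  apply: (le_trans Gk1); apply: ler_wpM2l; first exact: ltW.
  by apply: ler_wpM2l; [exact: ltW|rewrite km].
apply: le_trans (ler_pM _ _ step k1) _; [exact: ltW|by rewrite invr_ge0 ltW|].
by rewrite le_eqVlt; apply/orP; left; apply/eqP; field; rewrite !gt_eqF.
Unshelve. all: by end_near. Qed.

Lemma levy_rate_gt0 : \forall t \near +oo%R, 0 < levy_rate X gamma t.
Proof.
have t0 : \forall t \near +oo%R, (0 : R) < t by exact: nbhs_pinfty_gt (num_real _).
apply: filter_app (near_pinfty_truncn (isT : (0 < 1)%N) (p_gt0 tails)); apply: filterS t0 => t t0; rewrite mulr1 => pt.
by rewrite /levy_rate mulr_gt0 ?expR_gt0// divr_gt0.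
Qed.

End UpperAsymptotics.

Section LevyLimit.
Context {d : measure_display} {T : measurableType d} {R : realType}.
Variable P : probability T R.
Variables (X : R -> {RV P >-> R}) (XL : levy_process X) (gamma alpha x : R).
Hypothesis gamma0 : 0 <= gamma.
Hypothesis alpha0 : 0 <= alpha.
Hypothesis x0 : 0 <= x.
Hypothesis tails : tail_conditions P gamma alpha (fun n => X n%:R).

Let h (l : nat) : R := ((2 ^ l)%:R)^-1.
Let N t w := running_inf (fun t => X t) t w.
Let S l := skeleton X (2 ^ l).
Let Z l j w := running_min (fun k => S l k) j w.
Let q t := trunc_moment P alpha x (N t).
Let Q l j := trunc_moment P alpha x (Z l j).
Let f l k := fine (P [set w | - x <= lmin 0 k (fun n => S l n.+1 w - S l n w)]).

(** [W] stands for the mean exit time when both exponents vanish and for the integral otherwise.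
    Comparison with Riemann sums of [q] on both sides is the interface common to the two cases;
    finiteness is proved from it. *)
Variable W : \bar R.
Hypothesis W_ge0 : (0 <= W)%E.
Hypothesis W_lower : forall l K,
  ((\sum_(0 <= k < K) h l * (expR (gamma * (k%:R * h l)) * q (k.+1%:R * h l)))%:E <= W)%E.
Hypothesis W_upper : forall c, (c%:E < W)%E -> exists J : nat, forall l,
  c <= expR (gamma * h l) *
    \sum_(0 <= j < J * 2 ^ l) h l * (expR (gamma * (j%:R * h l)) * q (j%:R * h l)).

Let h_gt0 l : 0 < h l. Proof. by rewrite invr_gt0 ltr0n expn_gt0. Qed.
Let p2 l : (0 < 2 ^ l)%N. Proof. by rewrite expn_gt0. Qed.
Let mZ l j : measurable_fun setT (Z l j). Proof. exact: measurable_skeleton_min. Qed.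
Let Z0 l j w : Z l j w <= 0. Proof. exact: (skeleton_min_le0 XL). Qed.
Let th_ge0 l j : 0 <= j%:R * h l. Proof. by rewrite mulr_ge0// ltW. Qed.
Let mN l j : measurable_fun setT (N (j%:R * h l)).
Proof. exact: measurable_running_inf. Qed.
Let N0 l j w : N (j%:R * h l) w <= 0. Proof. exact: (running_inf_le0 XL). Qed.

Let mesh_sums : exists s : nat -> R, forall l,
  [series h l * (expR (gamma * (j%:R * h l)) * Q l j)]_j @ \oo --> s l /\
  f l k / (prob_ge P (S l k) 0 / k%:R) @[k --> \oo] --> expR (alpha * x) * s l / h l.
Proof.
have H l : exists s : R,
  [series h l * (expR (gamma * (j%:R * h l)) * Q l j)]_j @ \oo --> s /\
  f l k / (prob_ge P (S l k) 0 / k%:R) @[k --> \oo] --> expR (alpha * x) * s / h l.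
  have rw : random_walk (S l) by exact: skeleton_random_walk.
  have [U [sU fU]] := skeleton_survival XL alpha0 tails (p2 l) x0.
  exists (expR (- (alpha * x)) * h l * U); split.
    rewrite (_ : [series _]_j = fun n => expR (- (alpha * x)) * h l *
      [series expR (gamma / (2 ^ l)%:R * j%:R) * (expR (alpha * x) *
        walk_trunc_moment P (fun n w => S l n.+1 w - S l n w) alpha x j)]_j n).
      exact: cvgMr.
    apply/funext => n; rewrite /series /= mulr_sumr; apply: eq_bigr => j _.
    have -> : Q l j = walk_trunc_moment P (fun n w => S l n.+1 w - S l n w) alpha x j.
      rewrite /Q /trunc_moment /walk_trunc_moment; apply: eq_Rintegral => w _.
      by rewrite (walk_lmin rw).
    have -> : gamma / (2 ^ l)%:R * j%:R = gamma * (j%:R * h l) by rewrite -mulrA (mulrC j%:R).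
    rewrite [RHS](_ : _ = (expR (- (alpha * x)) * expR (alpha * x)) * (h l *
      (expR (gamma * (j%:R * h l)) *
       walk_trunc_moment P (fun n w => S l n.+1 w - S l n w) alpha x j))); last by ring.
    by rewrite -expRD addNr expR0 mul1r.
  rewrite (_ : expR (alpha * x) * _ / h l = U)//.
  rewrite [LHS](_ : _ = (expR (alpha * x) * expR (- (alpha * x))) * U); last first.
    by field; rewrite gt_eqF.
  by rewrite -expRD addrN expR0 mul1r.
by have [s Hs] := choice H; exists s.
Qed.

Let Q_cvg i k : Q l (k * 2 ^ (l - i))%N @[l --> \oo] --> q (k%:R * h i).
Proof.
apply: trunc_moment_cvg => //.
  apply/near_infty_ex; exists i => l il w.
  by rewrite /h -(dyadic_refine k il); exact: (running_inf_le_skeleton_min XL).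
by move=> w y; exact: (skeleton_min_near XL).
Qed.

Let q_le_Q l j : q (j%:R * h l) <= Q l j.
Proof.
apply: le_trunc_moment => // w; exact: (running_inf_le_skeleton_min XL).
Qed.

Let Q_ge0 l j : 0 <= Q l j. Proof. exact: trunc_moment_ge0. Qed.

(** The skeleton of mesh 1 has a convergent series by the walk case, and [q] is dominated by its
    truncated moments. *)
Lemma levy_weight_fin_num : W \is a fin_num.
Proof.
have [s /(_ 0%N)[s0 _]] := mesh_sums.
rewrite ge0_fin_numE//; apply: le_lt_trans (ltry (expR (gamma * h 0) * s 0%N)).
apply: ereal_le_of_lt => c /W_upper[J /(_ 0%N)/le_trans]; apply.
apply: ler_wpM2l; first exact: expR_ge0.
apply: le_trans (series_nonneg_le_limit (J * 2 ^ 0) _ s0); last first.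
  by move=> j; rewrite !mulr_ge0 ?expR_ge0// ltW.
apply: ler_sum => j _; apply: ler_wpM2l; first exact: ltW.
by apply: ler_wpM2l; first exact: expR_ge0.
Qed.

Let w := fine W.
Let w_ge0 : 0 <= w. Proof. exact: fine_ge0. Qed.
Let wE : W = w%:E. Proof. by rewrite fineK// levy_weight_fin_num. Qed.

(** The value of [q] at grid point [k] belongs in the lower sum to the weight at [k - 1], but here
    to that at [k + 1]; these two mesh steps give the factor [expR (2 * (gamma * h l))]. *)
Let W_sum l K :
  \sum_(1 <= k < K) h l * (expR (gamma * (k.+1%:R * h l)) * q (k%:R * h l)) <=
    expR (2 * (gamma * h l)) * w.
Proof.
case: K => [|K]; first by rewrite big_geq// mulr_ge0// expR_ge0.
rewrite big_add1 /=.
apply: (@le_trans _ _ (expR (2 * (gamma * h l)) *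
   \sum_(0 <= k < K) h l * (expR (gamma * (k%:R * h l)) * q (k.+1%:R * h l)))).
  rewrite mulr_sumr; apply: ler_sum => k _.
  rewrite [leRHS]mulrCA; apply: ler_wpM2l; first exact: ltW.
  rewrite [leRHS]mulrA -expRD.
  rewrite (_ : 2 * _ + _ = gamma * (k.+2%:R * h l))//.
  by rewrite -[k.+2]addn2 natrD; ring.
apply: ler_wpM2l; first exact: expR_ge0.
by rewrite -lee_fin -wE.
Qed.

(** The exponent 9 is the eighth power of [lower_asymptotics] with one more factor from taking [c]
    slightly below [w]. The exponent 4 is the third power of [near_skeleton_rate] with one more from
    the limit on the fixed skeleton, and the additive error is that of [upper_limit]. *)
Lemma levy_exit_ratio :
  fine (P [set w | (t%:E < exit_time (fun t => X t) x w)%E]) / levy_rate X gamma t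
    @[t --> +oo%R] --> expR (alpha * x) * w.
Proof.
have [s Hs] := mesh_sums.
have rate := levy_rate_gt0 tails.
have q01 : q 0 <= 1.
  by have := trunc_moment_le1 P x alpha0 (mN 0 0) (N0 0 0); rewrite mul0r.
apply: (cvg_power_sandwich (K := expR (alpha * x)) (m := 9) (n := 4)) => u u0 u1.
have u10 : 0 < 1 + u by rewrite addr_gt0.
have lower : \forall t \near +oo%R, (1 - u) ^+ 9 * (expR (alpha * x) * w) * levy_rate X gamma t <=
    fine (P [set w | (t%:E < exit_time (fun t => X t) x w)%E]).
  have [w0|wn0] := eqVneq w 0.
    near=> t; rewrite w0 !mulr0 mul0r; exact: fine_ge0.
  have wp : 0 < w by rewrite lt_neqAle eq_sym wn0.
  have th0 : 0 < 1 - u by rewrite subr_gt0.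
  have th1 : 1 - u < 1 by rewrite gtrBl.
  have c0 : 0 <= (1 - u) * w by rewrite mulr_ge0// ltW.
  have cW : (((1 - u) * w)%:E < W)%E by rewrite wE lte_fin gtr_pMl.
  apply: filterS (lower_asymptotics XL gamma0 alpha0 x0 tails th0 th1 c0 (W_upper cW)) => t.
  by apply: le_trans; rewrite le_eqVlt; apply/orP; left; apply/eqP; ring.
have upper : \forall t \near +oo%R,
    fine (P [set w | (t%:E < exit_time (fun t => X t) x w)%E]) <=
    (1 + u) ^+ 4 * (expR (alpha * x) * w + expR (alpha * x) * u) * levy_rate X gamma t.
  have [L HL] : exists L, forall l, (L <= l)%N -> expR (gamma * h l) <= 1 + u.
    have : (1 : R) < 1 + u by rewrite ltrDl.
    by move: (expR_mesh_cvg1 gamma) => /cvgr_le/[apply]/near_infty_ex[L HL]; exists L.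
  have [l Ll sl] := @upper_limit R gamma Q q s w gamma0 Q_ge0
    (fun i l k j il kj => le_trunc_moment P x alpha0 (mZ l j) (mZ i k) (Z0 i k)
       (fun w => skeleton_min_refine XL w il kj))
    Q_cvg q01 (fun l => (Hs l).1) w_ge0 W_sum u L u0.
  have wu : 0 < w + u by rewrite ltr_wpDl.
  have fl : \forall k \near \oo, f l k / (prob_ge P (S l k) 0 / k%:R) <=
      (1 + u) * (expR (alpha * x) * (w + u) / h l).
    move/cvgr_le: (Hs l).2; apply.
    apply: (@le_lt_trans _ _ (expR (alpha * x) * (w + u) / h l)).
      apply: ler_wpM2r; first by rewrite invr_ge0 ltW.
      by apply: ler_wpM2l => //; exact: expR_ge0.
    by rewrite ltr_pMl ?ltrDl// divr_gt0// mulr_gt0// expR_gt0.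
  apply: filter_app (near_pinfty_truncn (p2 l) fl).
  have rl := near_skeleton_rate XL gamma0 alpha0 tails (p2 l) u0 (HL l Ll).
  have t0 : \forall t \near +oo%R, (0 : R) <= t by exact: nbhs_pinfty_ge (num_real _).
  apply: filter_app rl; apply: filterS t0 => t t0 /= /andP[r0 r1] fk.
  apply: (le_trans (exit_time_le_skeleton XL x (p2 l) t0)).
  rewrite ler_pdivrMr// in fk; apply: (le_trans fk).
  apply: le_trans (ler_wpM2l _ r1) _.
    by rewrite !mulr_ge0 ?expR_ge0 ?invr_ge0// ltW.
  rewrite le_eqVlt; apply/orP; left; apply/eqP; rewrite -/(h l).
  by field; rewrite gt_eqF.
apply: filter_app rate; apply: filter_app upper; apply: filterS lower => t lo up rt.
by rewrite ler_pdivlMr// ler_pdivrMr// lo up.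
Unshelve. all: by end_near. Qed.

End LevyLimit.

Section LevyTheorem.
Context {d : measure_display} {T : measurableType d} {R : realType}.
Variable P : probability T R.
Variables (X : R -> {RV P >-> R}) (XL : levy_process X) (gamma alpha x : R).
Hypothesis gamma0 : 0 <= gamma.
Hypothesis alpha0 : 0 <= alpha.
Hypothesis x0 : 0 <= x.

Let N t w := running_inf (fun t => X t) t w.
Let q t := trunc_moment P alpha x (N t).
(** Extended by its value at 0 to negative times, the function is nonincreasing on the whole line,
    as the Riemann bounds demand; running infima are handled at nonnegative times only. *)
Let qp t := q (Num.max 0 t).

Let qp_ge0 t : 0 <= qp t. Proof. exact: trunc_moment_ge0. Qed.

Let qp_nonincreasing s t : s <= t -> qp t <= qp s.
Proof.
move=> st; have m0 u : 0 <= Num.max 0 u :> R by rewrite le_max lexx.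
apply: le_trunc_moment => //.
- exact: measurable_running_inf.
- exact: measurable_running_inf.
- by move=> w; exact: (running_inf_le0 XL).
- move=> w; apply: (running_inf_nonincreasing XL) => //.
  by rewrite ge_max m0 le_max st orbT.
Qed.

Let qpE t : 0 <= t -> qp t = q t.
Proof. by move=> t0; rewrite /qp max_r. Qed.

Lemma V_levy_integral : ~~ ((gamma == 0) && (alpha == 0)) ->
  V_levy P gamma alpha (fun t => X t) x =
  ((expR (alpha * x))%:E *
   \int[lebesgue_measure]_(t in `[0%R, +oo[) (expR (gamma * t) * qp t)%:E)%E.
Proof.
rewrite /V_levy => /negbTE ->; congr (_ * _)%E; apply: eq_integral => t.
rewrite inE/= in_itv/= andbT => t0.
have -> : trunc_exp_moment P alpha x (running_inf (fun t => X t) t) = (qp t)%:E.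
  rewrite (qpE t0); apply: trunc_exp_momentE => //.
    exact: (measurable_running_inf XL t0).
  by move=> w; exact: (running_inf_le0 XL).
by rewrite EFinM.
Qed.

Lemma levy_exit_asymptotics :
  tail_conditions P gamma alpha (fun n => X n%:R) ->
  equiv_mul (pinfty_nbhs R)
    (fun t : R => fine (P [set w | (t%:E < exit_time (fun t => X t) x w)%E]))
    (V_levy P gamma alpha (fun t => X t) x)
    (fun t : R => expR (- (gamma * (t - (Num.floor t)%:~R)))
                  * (prob_ge P (X (Num.floor t)%:~R) 0 / t)).
Proof.
move=> tails.
have [W [VW W0 Wlo Wup]] : exists W : \bar R,
  [/\ V_levy P gamma alpha (fun t => X t) x = ((expR (alpha * x))%:E * W)%E, (0 <= W)%E,
   forall l K : nat, ((\sum_(0 <= k < K) ((2 ^ l)%:R)^-1 * (expR (gamma * (k%:R * ((2 ^ l)%:R)^-1)) *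
      q (k.+1%:R * ((2 ^ l)%:R)^-1)))%:E <= W)%E &
   forall c, (c%:E < W)%E -> exists J : nat, forall l : nat, c <= expR (gamma * ((2 ^ l)%:R)^-1) *
    \sum_(0 <= j < J * 2 ^ l) ((2 ^ l)%:R)^-1 *
      (expR (gamma * (j%:R * ((2 ^ l)%:R)^-1)) * q (j%:R * ((2 ^ l)%:R)^-1))].
  have [/andP[/eqP g0 /eqP a0]|ga0] := boolP ((gamma == 0) && (alpha == 0)).
    exists (\int[P]_w exit_time (fun t => X t) x w)%E; split.
    - by rewrite /V_levy g0 a0 eqxx/= mul0r expR0 mul1e.
    - by apply: integral_ge0 => w _; exact: exit_time_ge0.
    - by move=> l K; rewrite g0 /q a0; apply: expected_exit_lower => //; rewrite invr_ge0.
    - by rewrite g0 /q a0; exact: expected_exit_upper.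
  exists (\int[lebesgue_measure]_(t in `[0%R, +oo[) (expR (gamma * t) * qp t)%:E)%E; split.
  - exact: V_levy_integral.
  - by apply: integral_ge0 => t _; rewrite lee_fin mulr_ge0// expR_ge0.
  - move=> l K; under eq_bigr => k _ do rewrite -qpE ?divr_ge0//.
    by apply: grid_lower => //; rewrite invr_ge0.
  - move=> c /(grid_upper gamma0 qp_ge0 qp_nonincreasing)[J HJ]; exists J => l.
    by under eq_bigr => k _ do rewrite -qpE ?divr_ge0//; exact: HJ.
have Wfin := levy_weight_fin_num XL alpha0 x0 tails W0 Wup.
have lim := levy_exit_ratio XL gamma0 alpha0 x0 tails W0 Wlo Wup.
have rateE : \forall t \near +oo%R, levy_rate X gamma t =
    expR (- (gamma * (t - (Num.floor t)%:~R))) * (prob_ge P (X (Num.floor t)%:~R) 0 / t).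
  have t0 : \forall t \near +oo%R, (0 : R) <= t by exact: nbhs_pinfty_ge (num_real _).
  by apply: filterS t0 => t t0; rewrite floor_truncn.
apply: (equiv_mul_cvg (v := expR (alpha * x) * fine W)).
- by rewrite VW EFinM fineK.
- by apply: filterS2 rateE (levy_rate_gt0 (gamma := gamma) tails) => t <-.
- by apply: cvg_trans lim; apply: near_eq_cvg; apply: filterS rateE => t <-.
Qed.

End LevyTheorem.

Theorem theorem1p2 (d : measure_display) (T : measurableType d) (R : realType)
    (P : probability T R) (gamma alpha : R)
    (hgamma : 0 <= gamma) (halpha : 0 <= alpha) :
  (forall X : R -> {RV P >-> R},
     levy_process X ->
     {ae P, forall w, X t w @[t --> +oo%R] --> -oo%R} ->
     tail_conditions P gamma alpha (fun n => X n%:R) ->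
     forall x : R, 0 <= x ->
       equiv_mul (pinfty_nbhs R)
         (fun t : R => fine (P [set w | (t%:E < exit_time X x w)%E]))
         (V_levy P gamma alpha X x)
         (fun t : R => expR (- (gamma * (t - (Num.floor t)%:~R)))
                       * (prob_ge P (X (Num.floor t)%:~R) 0 / t)))
  /\
  (forall X : nat -> {RV P >-> R},
     random_walk X ->
     {ae P, forall w, X n w @[n --> \oo] --> -oo%R} ->
     tail_conditions P gamma alpha X ->
     forall x : R, 0 <= x ->
       equiv_mul \oo
         (fun n : nat => fine (P [set w | (n%:R%:E < exit_time_rw X x w)%E]))
         (V_rw P gamma alpha X x)
         (fun n : nat => prob_ge P (X n) 0 / n%:R)).
Proof.
split=> [X XL _ tails x x0|X Xrw _ tails x x0].
  exact: (levy_exit_asymptotics XL hgamma halpha x0 tails).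
exact: (random_walk_exit_asymptotics Xrw halpha tails x0).
Qed.
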